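(* Let $g\geq 1$, let $n=2g+1$, let $p(x)=\sum_{k=0}^{n}a_kx^{n-k}$ ($a_k\in\mathbb{C}$, $a_0\neq 0$) be a polynomial of odd degree $n$ without multiple zeros, and let $X$ be the genus $g$ hyperelliptic Riemann surface $y^2=p(x)$. Let $\langle\quad\rangle$ be a state on $X$ with $\langle 1\rangle\neq 0$, let $T$ be the Virasoro field, of central charge $c$, and let $$\langle T(x_1)T(x_2)\rangle_c:=\langle 1\rangle^{-1}\langle T(x_1)T(x_2)\rangle-\langle 1\rangle^{-2}\langle T(x_1)\rangle\langle T(x_2)\rangle$$ be the connected two-point function. Let $\Theta,\Theta^{[y]},\Pi^{[1]},\Pi^{[x]},p^{[1]},p^{[x]}$ be as defined in the context, and for $j=1,2$ write $p_j=p(x_j)$, $p_j'=p'(x_j)$, $\Theta_j=\Theta(x_j,y_j)$, $\Theta^{[y]}_j=\Theta^{[y]}(x_j)$, where $y_j^2=p(x_j)$. Then the following hold. 1. As $x_1\to\infty$ (with the second point fixed), $\langle T(x_1)T(x_2)\rangle_c\,p_1p_2=O(x_1^{n-3})$. 2. For $|x_1|,|x_2|$ small, $$\langle T(x_1)T(x_2)\rangle_c\,p_1p_2=\langle 1\rangle^{-1}R(x_1,x_2)+O(1)|_{x_1=x_2},$$ where $R(x_1,x_2)$ is a rational function of $x_1,x_2$ and $y_1,y_2$, and $O(1)|_{x_1=x_2}$ denotes terms that are regular on the diagonal $x_1=x_2$. 3. The rational function is given by \begin{align*} R(x_1,x_2) &=\frac{c}{4}\langle 1\rangle\frac{p_1p_2}{(x_1-x_2)^4}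 +\frac{c}{4}y_1y_2\langle 1\rangle\left(\frac{p^{[1]}(\sqrt{x_1x_2})}{(x_1-x_2)^4}+\frac{1}{2}(x_1+x_2)\frac{p^{[x]}(\sqrt{x_1x_2})}{(x_1-x_2)^4}\right)\\ &+\frac{c}{32}\langle 1\rangle\frac{p_1'p_2'}{(x_1-x_2)^2}\\ &+\frac{c}{32}y_1y_2\langle 1\rangle\left(\frac{\frac{1}{\sqrt{x_1x_2}}\,p^{[1]'}(\sqrt{x_1x_2})}{(x_1-x_2)^2}+\frac{3}{2}(x_1+x_2)\frac{\frac{1}{\sqrt{x_1x_2}}\,p^{[x]'}(\sqrt{x_1x_2})}{(x_1-x_2)^2}\right)\\ &+\frac{1}{8}\frac{p_1\Theta_2+p_2\Theta_1}{(x_1-x_2)^2}\\ &+\frac{1}{8}\left(y_1\Theta_2^{[y]}+y_2\Theta_1^{[y]}\right)\left(\frac{p^{[1]}(\sqrt{x_1x_2})}{(x_1-x_2)^2}+\frac{1}{2}(x_1+x_2)\frac{p^{[x]}(\sqrt{x_1x_2})}{(x_1-x_2)^2}\right)\\ &+\frac{c}{32}y_1y_2\langle 1\rangle\left(\frac{p^{[1]''}(\sqrt{x_1x_2})}{(x_1-x_2)^2}+\frac{1}{2}(x_1+x_2)\frac{p^{[x]''}(\sqrt{x_1x_2})}{(x_1-x_2)^2}\right)\\ &-\frac{c}{32}y_1y_2\left(\frac{\Pi^{[1]}(\sqrt{x_1x_2})}{(x_1-x_2)^2}+\frac{1}{2}(x_1+x_2)\frac{\Pi^{[x]}(\sqrt{x_1x_2})}{(x_1-x_2)^2}\right).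 \end{align*} 4. For $R(x_1,x_2)$ thus defined, the connected Virasoro two-point function reads \begin{align*} \langle 1\rangle\langle T(x_1)T(x_2)\rangle_c\,p_1p_2 &=R(x_1,x_2)+P(x_1,x_2,y_1,y_2)\\ &-\frac{1}{8}a_0\left(x_1^{n-2}\Theta_2+x_2^{n-2}\Theta_1\right)-\frac{c}{64}\langle 1\rangle(n^2-1)a_0^2x_1^{n-2}x_2^{n-2}\\ &-\frac{1}{8}y_1a_1x_1^{\frac{n-5}{2}}x_2^{\frac{n-1}{2}}\Theta_2^{[y]}-\frac{1}{8}y_2a_1x_1^{\frac{n-1}{2}}x_2^{\frac{n-5}{2}}\Theta_1^{[y]}\\ &-\frac{1}{16}y_1a_0x_1^{\frac{n-3}{2}}x_2^{\frac{n-1}{2}}\Theta_2^{[y]}-\frac{1}{16}y_2a_0x_1^{\frac{n-1}{2}}x_2^{\frac{n-3}{2}}\Theta_1^{[y]}\\ &-\frac{3}{16}y_1a_0x_1^{\frac{n-5}{2}}x_2^{\frac{n+1}{2}}\Theta_2^{[y]}-\frac{3}{16}y_2a_0x_1^{\frac{n+1}{2}}x_2^{\frac{n-5}{2}}\Theta_1^{[y]}\\ &-\frac{1}{16}y_1a_2x_1^{\frac{n-5}{2}}x_2^{\frac{n-3}{2}}\Theta_2^{[y]}-\frac{1}{16}y_2a_2x_1^{\frac{n-3}{2}}x_2^{\frac{n-5}{2}}\Theta_1^{[y]}, \end{align*} where $$P(x_1,x_2,y_1,y_2)=P^{[1]}(x_1,x_2)+y_1P^{[y_1]}(x_1,x_2)+y_2P^{[y_2]}(x_1,x_2)+y_1y_2P^{[y_1y_2]}(x_1,x_2).$$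 Here $P^{[1]},P^{[y_1]},P^{[y_2]},P^{[y_1y_2]}$ are polynomials in $x_1$ and $x_2$, specific to the state, such that, $\deg_i$ denoting the degree in $x_i$ ($i=1,2$), $$\deg_iP^{[1]}\leq n-3,\qquad \deg_iP^{[y_j]}\leq n-3\ \ (j\neq i),\qquad \deg_iP^{[y_i]}\leq\frac{n-1}{2}-3,\qquad \deg_iP^{[y_1y_2]}\leq\frac{n-1}{2}-3.$$ Moreover $P^{[1]}$, $P^{[y_1y_2]}$ and $y_1P^{[y_1]}+y_2P^{[y_2]}$ are symmetric under flipping $1\leftrightarrow 2$.
   Context: **Conformal field theory setting.** A meromorphic conformal field theory consists of a graded complex vector space $F=\bigoplus_{h\in\mathbb{N}_0}F(h)$ of holomorphic fields, each $F(h)$ finite dimensional, $F(0)=\mathbb{C}\cdot 1$ spanned by the identity field $1$ (elements of $F(h)$ have dimension $h$), together with linear maps $N_m:F\otimes F\to F$, $m\in\mathbb{Z}$, of degree $m$ (i.e. $N_m(\varphi_1,\varphi_2)$ has dimension $m+h(\varphi_1)+h(\varphi_2)$), with $N_m(\varphi,1)=0$ for $m<0$, and $\partial\varphi:=N_1(\varphi,1)$. For every Riemann surface $X$ the fields form a vector bundle $\mathcal{F}$ over $X$ with fibre $F$, trivialised over every chart $(U,z)$; $\varphi(z)$ is the field $\varphi\in F$ at a point of $U$ in the trivialisation given by $z$. A state on $X$ is a multilinear map $\langle\quad\rangle$ assigning a complex number to symmetrised tensor products of fields at pairwise distinct points of $X$, such that (i) in any chart the $N$-point function $\langle\varphi_1(z_1)\ldots\varphi_N(z_N)\rangle$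 is holomorphic in $(z_1,\ldots,z_N)$ off the partial diagonals; (ii) factors equal to the identity field can be omitted; (iii) it is compatible with the operator product expansion (OPE): for all $N\ge2$, $\langle\varphi_1(z_1)\varphi_2(z_2)\ldots\varphi_N(z_N)\rangle=\sum_{m\geq m_0}(z_1-z_2)^m\langle N_m(\varphi_1,\varphi_2)(z_2)\varphi_3(z_3)\ldots\varphi_N(z_N)\rangle$ as Laurent series about $z_1=z_2$, for some $m_0\in\mathbb{Z}$; and $\langle\partial\varphi(z)\ldots\rangle=\partial_z\langle\varphi(z)\ldots\rangle$. $\langle 1\rangle\in\mathbb{C}$ is the zero-point function. There is a Virasoro field $T\in F(2)$ with $N_{-1}(T,\varphi)=\partial\varphi$ for all $\varphi$; its OPE is, in any local coordinate, $$T(z)T(w)\mapsto\frac{c/2}{(z-w)^4}\,1+\frac{1}{(z-w)^2}(T(z)+T(w))+\Phi(w)+O(z-w),$$ where $c\in\mathbb{C}$ is the central charge and $\Phi=N_0(T,T)-\frac12\partial^2T$. Under a change of local coordinate $x\mapsto\hat x(x)$, the Virasoro field transforms (inside any $N$-point function) as $$\hat T(\hat x)\left[\frac{d\hat x}{dx}\right]^2=T(x)-\frac{c}{12}S(\hat x)\,1,\qquad S(f)=\frac{f'''}{f'}-\frac{3[f'']^2}{2[f']^2}.$$ **Hyperelliptic surface.** $X$ is compact, including the point at $x=\infty$. The function $x$ is a local coordinate at finite points where $p\neq0$, $y$ is a local coordinate where $p'\neq0$, and for $n$ odd $x^{-1/2}$ is a local coordinate at $x=\infty$. $T(x)$ denotes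 the Virasoro field in the coordinate $x$; $\langle T(x_1)\ldots T(x_N)\rangle$ is a function of the points $(x_i,y_i)\in X$, i.e. a rational function of $x_1,y_1,\ldots,x_N,y_N$. **The polynomials.** $\Theta$ is the polynomial in $x$ and $y$ defined by $$p\langle T(x)\rangle=\frac{c}{32}\frac{[p']^2}{p}\langle 1\rangle+\frac14\Theta(x,y),\qquad \Theta(x,y)=\Theta^{[1]}(x)+y\,\Theta^{[y]}(x),$$ with $\Theta^{[1]},\Theta^{[y]}$ polynomials in $x$; $\Theta^{[y]}=0$ if $g\leq 2$ (so terms above containing $\Theta^{[y]}$ are absent in that case). Define $\Pi$ by $\Theta^{[1]}(x)=-\frac{c}{8}\Pi(x)$, and let $\Pi^{[1]},\Pi^{[x]},p^{[1]},p^{[x]}$ be the even polynomials in $x$ with $\Pi(x)=\Pi^{[1]}(x)+x\Pi^{[x]}(x)$ and $p(x)=p^{[1]}(x)+xp^{[x]}(x)$. (In the formulas $\frac{c}{8}\Pi$ always means $-\Theta^{[1]}$.) For an even polynomial $q$, the expressions $q(\sqrt{x_1x_2})$, $q''(\sqrt{x_1x_2})$ and $\frac{1}{\sqrt{x_1x_2}}q'(\sqrt{x_1x_2})$ are polynomials in $x_1x_2$; primes on $p^{[1]},p^{[x]}$ denote derivatives of these polynomials. A polynomial whose degree is bounded by a negative number is zero. *)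

(* Defs.v *)
From HB Require Import structures.
From mathcomp Require Import all_boot all_order all_algebra.
From mathcomp Require Import all_classical all_reals all_analysis.
From mathcomp Require Import complex polyXY.

Set Implicit Arguments.
Unset Strict Implicit.
Unset Printing Implicit Defensive.

Import Order.TTheory GRing.Theory Num.Theory numFieldNormedType.Exports.

Local Open Scope classical_set_scope.
Local Open Scope ring_scope.

(* R[i] packaged as a numClosedFieldType, which is how it receives its
   canonical normed module structure over itself: [derivable], [differentiable]
   and [derive1] below are complex differentiability and complex derivatives. *)
Definition Cplx (R : realType) : numClosedFieldType := R[i].

Section RiemannSurfaces.
Variable R : realType.
Local Notation C := (Cplx R).

Record chart (X : topologicalType) := Chart {
  dom : set X;
  coord : X -> C;
  param : C -> X;
  dom_open : open dom;
  codom_open : open (coord @` dom);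
  coordK : forall P, dom P -> param (coord P) = P;
  coord_cont : forall P, dom P -> {for P, continuous coord};
  param_cont : forall u, (coord @` dom) u -> {for u, continuous param} }.

Definition transition (X : topologicalType) (z w : chart X) : C -> C :=
  coord w \o param z.

Definition compatible (X : topologicalType) (z w : chart X) : Prop :=
  forall P, dom z P -> dom w P ->
    derivable (transition z w) (coord z P) 1 /\
    derivable (transition w z) (coord w P) 1.

Record riemann_surface := RiemannSurface {
  surf :> topologicalType;
  atlas : set (chart surf);
  surf_hausdorff : hausdorff_space surf;
  surf_connected : connected [set: surf];
  atlas_cover : forall P, exists2 z, atlas z & dom z P;
  atlas_compatible : forall z w, atlas z -> atlas w -> compatible z w;
  atlas_maximal : forall z, (forall w, atlas w -> compatible z w) -> atlas z }.

(* S(f) = f'''/f' - 3 (f'')^2 / (2 (f')^2) *)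
Definition schwarzian (f : C -> C) (u : C) : C :=
  derive1n 3 f u / derive1 f u - 3 * derive1n 2 f u ^+ 2 / (2 * derive1 f u ^+ 2).

End RiemannSurfaces.

Section FieldTheory.
Variable R : realType.
Local Notation C := (Cplx R).

(* The grading F = \bigoplus_h F(h) is internal: [homog h] is the subspace
   F(h) of [field].  [ope m phi1 phi2] is N_m(phi1, phi2). *)
Record cft := Cft {
  field :> lmodType C;
  homog : nat -> set field;
  fone : field;
  ope : int -> field -> field -> field;
  homog0 : forall h, homog h 0;
  homogD : forall h (k : C) u v, homog h u -> homog h v -> homog h (k *: u + v);
  homog_fin : forall h, exists b : seq field,
    (forall v, v \in b -> homog h v) /\
    (forall v, homog h v -> exists k : 'I_(size b) -> C,
       v = \sum_(i < size b) k i *: b`_i);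
  homog_span : forall v, exists m (v_ : nat -> field),
    (forall h, homog h (v_ h)) /\ v = \sum_(h < m) v_ h;
  homog_direct : forall m (v_ : nat -> field),
    (forall h, homog h (v_ h)) -> \sum_(h < m) v_ h = 0 ->
    forall h, (h < m)%N -> v_ h = 0;
  fone_neq0 : fone != 0;
  homog_0E : forall v, homog 0 v <-> exists k : C, v = k *: fone;
  ope_linearl : forall m (k : C) u v w,
    ope m (k *: u + v) w = k *: ope m u w + ope m v w;
  ope_linearr : forall m (k : C) u v w,
    ope m w (k *: u + v) = k *: ope m w u + ope m w v;
  ope_degree : forall m h1 h2 u v, homog h1 u -> homog h2 v ->
    forall h : nat, m + h1%:Z + h2%:Z = h%:Z -> homog h (ope m u v);
  ope_degree_neg : forall m h1 h2 u v, homog h1 u -> homog h2 v ->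
    m + h1%:Z + h2%:Z < 0 -> ope m u v = 0;
  ope_fone : forall m u, m < 0 -> ope m u fone = 0 }.

Definition dfield (F : cft) (u : F) : F := ope 1 u (fone F).

(* The OPE of T with itself, after Taylor expansion of the field T(z) around w:
   T(z) + T(w) = 2 T(w) + (z - w) dT(w) + (z - w)^2 d^2T(w)/2 + ...
   The term of order 0, Phi + d^2T/2 = N_0(T, T), is the definition of Phi,
   and the terms of order < -4 vanish for reasons of degree. *)
Record is_virasoro (F : cft) (T : F) (c : C) : Prop := IsVirasoro {
  vir_dim : homog 2 T;
  vir_transl : forall u : F, ope (-1) T u = dfield u;
  vir_ope4 : ope (-4) T T = (c / 2) *: fone F;
  vir_ope3 : ope (-3) T T = 0;
  vir_ope2 : ope (-2) T T = 2 *: T;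
  vir_ope1 : ope (-1) T T = dfield T }.

(* The holomorphic vector bundle of fields on X.  Only the values of
   [triv z P] for z in the atlas and P in the domain of z are meaningful.
   As the fibre F may have infinite dimension, the transition functions are
   required to be holomorphic in the locally finite sense. *)
Record field_bundle (F : cft) (X : riemann_surface R) := FieldBundle {
  fib : X -> lmodType C;
  triv : chart R X -> forall P : X, {linear F -> fib P};
  triv_bij : forall z P, atlas z -> dom z P -> bijective (triv z P);
  triv_holomorphic : forall z w P0 (u : F),
    atlas z -> atlas w -> dom z P0 -> dom w P0 ->
    exists m (v : 'I_m -> F) (k : 'I_m -> C -> C),
      (forall i, \forall t \near coord z P0, derivable (k i) t 1) /\
      (\forall P \near P0,
         triv w P u = \sum_(i < m) k i (coord z P) *: triv z P (v i)) }.

Section States.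
Variables (F : cft) (X : riemann_surface R) (B : field_bundle F X).

Definition insertion : Type := {P : X & fib B P}.

(* phi(z) at the point P: the field phi in the trivialisation given by z. *)
Definition ins (z : chart R X) (P : X) (u : F) : insertion :=
  existT (fun P => fib B P) P (triv B z P u).

Definition points (s : seq insertion) : seq X := [seq tag v | v <- s].

(* A state is given by its values on finite lists of insertions, and these
   are meaningful only if the points are pairwise distinct. *)
Record is_state (corr : seq insertion -> C) : Prop := IsState {
  state_sym : forall s t : seq insertion,
    uniq (points s) -> perm_eq s t -> corr s = corr t;
  state_linear : forall P (k : C) (u v : fib B P) s, uniq (P :: points s) ->
    corr (existT _ P (k *: u + v) :: s) =
    k * corr (existT _ P u :: s) + corr (existT _ P v :: s);
  state_holomorphic : forall N (z : 'I_N -> chart R X) (u : 'I_N -> F)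
      (t0 : 'rV[C]_N),
    (forall i, atlas (z i)) ->
    (forall i, (coord (z i) @` dom (z i)) (t0 ord0 i)) ->
    injective (fun i => param (z i) (t0 ord0 i)) ->
    differentiable (fun t : 'rV[C]_N =>
      corr [seq ins (z i) (param (z i) (t ord0 i)) (u i) | i <- enum 'I_N]) t0;
  state_fone : forall z P s, atlas z -> dom z P -> uniq (P :: points s) ->
    corr (ins z P (fone F) :: s) = corr s;
  state_ope : forall z P2 (u1 u2 : F) s, atlas z -> dom z P2 ->
    uniq (P2 :: points s) ->
    exists m0 : int,
      (forall m, m < m0 -> ope m u1 u2 = 0) /\
      (\forall P1 \near P2^',
         series (fun k : nat => (coord z P1 - coord z P2) ^ (m0 + k%:Z) *
                   corr (ins z P2 (ope (m0 + k%:Z) u1 u2) :: s)) @ \oo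
         --> corr (ins z P1 u1 :: ins z P2 u2 :: s));
  state_deriv : forall z P (u : F) s, atlas z -> dom z P ->
    uniq (P :: points s) ->
    is_derive (coord z P : C) (1 : C)
      (fun t : C => corr (ins z (param z t) u :: s))
      (corr (ins z P (dfield u) :: s)) }.

(* The transformation law of T under a change of coordinate z |-> w, inside
   any N-point function. *)
Definition virasoro_covariant (T : F) (c : C) (corr : seq insertion -> C) :=
  forall z w P s, atlas z -> atlas w -> dom z P -> dom w P ->
    uniq (P :: points s) ->
    corr (ins w P T :: s) * derive1 (transition z w) (coord z P) ^+ 2 =
    corr (ins z P T :: s)
    - c / 12 * schwarzian (transition z w) (coord z P) * corr s.

End States.
End FieldTheory.

Section Hyperelliptic.
Variable R : realType.
Local Notation C := (Cplx R).

(* X is the compact Riemann surface y^2 = p(x), for p of odd degree without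
   multiple zeros: one point at infinity, the others being the points of the
   affine curve, with the indicated local coordinates.  [xcoord] and [ycoord]
   are not meaningful at [infpt]. *)
Record hyperelliptic (X : riemann_surface R) (p : {poly C}) := Hyperelliptic {
  infpt : X;
  xcoord : X -> C;
  ycoord : X -> C;
  curve_eq : forall P, P <> infpt -> ycoord P ^+ 2 = p.[xcoord P];
  curve_inj : forall P Q, P <> infpt -> Q <> infpt ->
    xcoord P = xcoord Q -> ycoord P = ycoord Q -> P = Q;
  curve_surj : forall x y : C, y ^+ 2 = p.[x] ->
    exists P, [/\ P <> infpt, xcoord P = x & ycoord P = y];
  curve_compact : compact [set: X];
  xcoord_cont : forall P, P <> infpt -> {for P, continuous xcoord};
  ycoord_cont : forall P, P <> infpt -> {for P, continuous ycoord};
  xchart : X -> chart R X;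
  xchartP : forall P, P <> infpt -> p.[xcoord P] != 0 ->
    [/\ atlas (xchart P), dom (xchart P) P &
        forall Q, dom (xchart P) Q ->
          Q <> infpt /\ coord (xchart P) Q = xcoord Q];
  ychartP : forall P, P <> infpt -> p^`().[xcoord P] != 0 ->
    exists z, [/\ atlas z, dom z P &
        forall Q, dom z Q -> Q <> infpt /\ coord z Q = ycoord Q];
  infchartP : exists z, [/\ atlas z, dom z infpt, coord z infpt = 0 &
        forall Q, dom z Q -> Q <> infpt ->
          xcoord Q != 0 /\ coord z Q ^+ 2 = (xcoord Q)^-1] }.

Section Correlators.
Variables (X : riemann_surface R) (p : {poly C}) (H : hyperelliptic X p).

Definition generic (P : X) : Prop := P <> infpt H /\ p.[xcoord H P] != 0.

Variables (F : cft R) (B : field_bundle F X) (T : F).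

(* T(x) at a generic point P.  In correlators, the choice of the chart
   [xchart H P] with coordinate x is immaterial, by the covariance of T. *)
Definition Tx (P : X) : insertion B := ins B (xchart H P) P T.

Variable corr : seq (insertion B) -> C.

(* <T(x1) T(x2)>_c *)
Definition TTc (P1 P2 : X) : C :=
  (corr [::])^-1 * corr [:: Tx P1; Tx P2]
  - (corr [::]) ^- 2 * (corr [:: Tx P1] * corr [:: Tx P2]).

End Correlators.

(* f, defined at pairs of generic points with different x, is regular on the
   diagonal x1 = x2: about any two finite points with the same x, it is the
   restriction of a holomorphic function of the local coordinates. *)
Definition diag_regular (X : riemann_surface R) (p : {poly C})
    (H : hyperelliptic X p) (f : X -> X -> C) : Prop :=
  forall P0 Q0 z w, P0 <> infpt H -> Q0 <> infpt H ->
    xcoord H P0 = xcoord H Q0 ->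
    atlas z -> atlas w -> dom z P0 -> dom w Q0 ->
    exists h : C * C -> C,
      (\forall t \near (coord z P0, coord w Q0), differentiable h t) /\
      (\forall P \near P0 & Q \near Q0,
         generic H P -> generic H Q -> xcoord H P <> xcoord H Q ->
         f P Q = h (coord z P, coord w Q)).

Implicit Types q p : {poly C}.

(* q = evenpart q + 'X * xpart q, with [evenpart q] and [xpart q] even:
   q^[1] and q^[x]. *)
Definition evenpart q : {poly C} := even_poly q \Po 'X^2.
Definition xpart q : {poly C} := odd_poly q \Po 'X^2.

(* q(sqrt t), for an even polynomial q; then q(x) = (even_poly q)(x^2). *)
Definition at_sqrt q (t : C) : C := (even_poly q).[t].

(* q'(x)/x, a polynomial for q even, and itself even. *)
Definition deriv_over_x q : {poly C} := q^`() %/ 'X.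

Definition Theta (Th1 Thy : {poly C}) (x y : C) : C := Th1.[x] + y * Thy.[x].

(* The rational function R(x1, x2), with e = <1>.  By definition of Pi, its
   last line - (c/32) Pi is + (1/4) Theta^[1], which makes sense also for
   c = 0. *)
Definition Rsing p (Th1 Thy : {poly C}) (c e x1 y1 x2 y2 : C) : C :=
  let t := x1 * x2 in
  let Th := Theta Th1 Thy in
  let p1 := evenpart p in
  let px := xpart p in
  c / 4 * e * (p.[x1] * p.[x2] / (x1 - x2) ^+ 4)
  + c / 4 * (y1 * y2) * e *
      (at_sqrt p1 t / (x1 - x2) ^+ 4
       + 1 / 2 * (x1 + x2) * (at_sqrt px t / (x1 - x2) ^+ 4))
  + c / 32 * e * (p^`().[x1] * p^`().[x2] / (x1 - x2) ^+ 2)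
  + c / 32 * (y1 * y2) * e *
      (at_sqrt (deriv_over_x p1) t / (x1 - x2) ^+ 2
       + 3 / 2 * (x1 + x2) * (at_sqrt (deriv_over_x px) t / (x1 - x2) ^+ 2))
  + 1 / 8 * ((p.[x1] * Th x2 y2 + p.[x2] * Th x1 y1) / (x1 - x2) ^+ 2)
  + 1 / 8 * (y1 * Thy.[x2] + y2 * Thy.[x1]) *
      (at_sqrt p1 t / (x1 - x2) ^+ 2
       + 1 / 2 * (x1 + x2) * (at_sqrt px t / (x1 - x2) ^+ 2))
  + c / 32 * (y1 * y2) * e *
      (at_sqrt p1^`(2) t / (x1 - x2) ^+ 2
       + 1 / 2 * (x1 + x2) * (at_sqrt px^`(2) t / (x1 - x2) ^+ 2))
  + 1 / 4 * (y1 * y2) *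
      (at_sqrt (evenpart Th1) t / (x1 - x2) ^+ 2
       + 1 / 2 * (x1 + x2) * (at_sqrt (xpart Th1) t / (x1 - x2) ^+ 2)).

(* The explicit terms added to R + P in the two-point function.  Exponents use
   truncated subtraction: for n = 3, where (n - 5)/2 < 0, the terms concerned
   contain Theta^[y] = 0. *)
Definition Rcorr (n : nat) (a : nat -> C) (Th1 Thy : {poly C})
    (c e x1 y1 x2 y2 : C) : C :=
  let Th := Theta Th1 Thy in
  let m5 := ((n - 5)./2)%N in
  let m3 := ((n - 3)./2)%N in
  let m1 := ((n - 1)./2)%N in
  let m'1 := ((n + 1)./2)%N in
  - (1 / 8 * a 0%N * (x1 ^+ (n - 2) * Th x2 y2 + x2 ^+ (n - 2) * Th x1 y1))
  - c / 64 * e * (n%:R ^+ 2 - 1) * a 0%N ^+ 2 * x1 ^+ (n - 2) * x2 ^+ (n - 2)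
  - 1 / 8 * y1 * a 1%N * x1 ^+ m5 * x2 ^+ m1 * Thy.[x2]
  - 1 / 8 * y2 * a 1%N * x1 ^+ m1 * x2 ^+ m5 * Thy.[x1]
  - 1 / 16 * y1 * a 0%N * x1 ^+ m3 * x2 ^+ m1 * Thy.[x2]
  - 1 / 16 * y2 * a 0%N * x1 ^+ m1 * x2 ^+ m3 * Thy.[x1]
  - 3 / 16 * y1 * a 0%N * x1 ^+ m5 * x2 ^+ m'1 * Thy.[x2]
  - 3 / 16 * y2 * a 0%N * x1 ^+ m'1 * x2 ^+ m5 * Thy.[x1]
  - 1 / 16 * y1 * a 2%N * x1 ^+ m5 * x2 ^+ m3 * Thy.[x2]
  - 1 / 16 * y2 * a 2%N * x1 ^+ m3 * x2 ^+ m5 * Thy.[x1].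

End Hyperelliptic.

(* Main.v *)
(* Fix a generic point Q.  As a function of P, the connected two-point function
   is holomorphic off Q and the branch points; since the Schwarzian terms cancel
   in it, the covariance of T shows that it becomes bounded at a branch point
   after multiplication by p, and is O(x^-3) at infinity.  At P = Q the OPE
   gives its singular part, and R has the same one there, but none at the
   conjugate point, where y1 y2 tends to - p(x2).  The explicit correction terms
   cancel the part of R of order greater than n - 3 at infinity.  So the
   remainder has no poles at finite points and is O(x^(n-3)), and Liouville's
   theorem, applied to its traces over the two sheets of x, shows that it is
   A(x) + y B(x), where A and B are polynomials depending on Q.  By symmetry of
   the remainder, interpolation at finitely many abscissae makes them
   polynomials in the coordinates of Q as well.

   Complex analysis enters only through expansions to second order with a cubic
   error term: they suffice for the maximum principle, and the OPE of a field
   with the identity provides them for correlation functions. *)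
Require Import Defs.
From HB Require Import structures.
From mathcomp Require Import all_boot all_order all_algebra.
From mathcomp Require Import all_classical all_reals all_analysis.
From mathcomp Require Import complex polyXY.
From mathcomp Require Import ring lra zify.

Set Implicit Arguments.
Unset Strict Implicit.
Unset Printing Implicit Defensive.

Import Order.TTheory GRing.Theory Num.Theory numFieldNormedType.Exports.
Import Defs.

Local Open Scope classical_set_scope.
Local Open Scope ring_scope.

(** The shape of [Rsing] comes from one polynomial. For x2 = b let q(x) = p^[1](sqrt(xb)) + (x+b)/2
    p^[x](sqrt(xb)). It is symmetric in x and b, has about half the degree of p, and agrees with y1
    y2 to first order at the diagonal point of the same sheet. Hence p1 p2 - q^2 = d^2 K with d = x1
    - x2. In p1 p2 + y1 y2 q = y1 y2 (y1 y2 + q), the last factor tends to 2 p(b) on the same sheet,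
    which gives the full pole of the OPE; on the opposite sheet it equals d^2 K / (y1 y2 - q), so
    that the pole of order 4 drops to order 2. The terms with derivatives of p^[1] and p^[x] are
    made to cancel what is left. The low degree of q also matters at infinity: y1 y2 q / d^4 is
    within the order n - 3, which p in place of q would exceed.

    The behaviour of Theta at infinity is derived from the state: in the coordinate u with x = u^-2
    the Schwarzian contributes c/32 x^-2 to the normalised one-point function of T, which fixes the
    leading coefficient of Theta^[1]. The factor n^2 - 1 in the correction terms stems from there,
    and the same value makes the top coefficients of the y1 y2 terms of order d^-2 cancel. *)

(** * The real-valued modulus of complex numbers *)

Section ComplexNorm.
Variable R : realType.
Local Notation C := (Cplx R).
Implicit Types (z t : C) (r : R).

(** The norm of [C] is itself [C]-valued. Its real part brings estimates into the ordered field [R],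
    where [lra] and [nra] apply. *)
Definition nm z : R := complex.Re `|z|.
Definition ofR r : C := (r%:C)%C.

Lemma normE z : `|z| = ofR (nm z).
Proof. by rewrite /ofR /nm RRe_real ?normr_real. Qed.

Lemma ofR_lt r1 r2 : (ofR r1 < ofR r2) = (r1 < r2).
Proof. exact: ltcR. Qed.

Lemma ofR_le r1 r2 : (ofR r1 <= ofR r2) = (r1 <= r2).
Proof. exact: lecR. Qed.

Lemma ofR_inj : injective ofR.
Proof. exact: complexI. Qed.

Lemma ofRD r1 r2 : ofR (r1 + r2) = ofR r1 + ofR r2.
Proof. exact: (rmorphD (real_complex R)). Qed.

Lemma ofRM r1 r2 : ofR (r1 * r2) = ofR r1 * ofR r2.
Proof. exact: (rmorphM (real_complex R)). Qed.

Lemma ofR0 : ofR 0 = 0. Proof. by []. Qed.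

Lemma nm_ofR r : nm (ofR r) = `|r|.
Proof.
apply: ofR_inj; rewrite -normE /ofR normc_def /=.
by rewrite expr0n /= addr0 sqrtr_sqr.
Qed.

Lemma nm_ge0 z : 0 <= nm z.
Proof. by rewrite -ofR_le -normE normr_ge0. Qed.

Lemma nm0 : nm 0 = 0. Proof. by apply: ofR_inj; rewrite -normE normr0. Qed.
Lemma nm1 : nm 1 = 1. Proof. by apply: ofR_inj; rewrite -normE normr1. Qed.

Lemma nm_eq0 z : (nm z == 0) = (z == 0).
Proof. by rewrite -(inj_eq ofR_inj) -normE normr_eq0. Qed.

Lemma nm_gt0 z : (0 < nm z) = (z != 0).
Proof. by rewrite lt_def nm_ge0 andbT nm_eq0. Qed.

Lemma nmM z t : nm (z * t) = nm z * nm t.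
Proof. by apply: ofR_inj; rewrite ofRM -!normE normrM. Qed.

Lemma nmX z n : nm (z ^+ n) = nm z ^+ n.
Proof. by elim: n => [|n IH]; rewrite ?expr0 ?nm1 // !exprS nmM IH. Qed.

Lemma nmV z : nm z^-1 = (nm z)^-1.
Proof.
apply: ofR_inj; rewrite -normE normfV normE.
exact: esym (fmorphV (real_complex R) (nm z)).
Qed.

Lemma nmN z : nm (- z) = nm z.
Proof. by rewrite /nm normrN. Qed.

Lemma nmC z t : nm (z - t) = nm (t - z).
Proof. by rewrite -nmN opprB. Qed.

Lemma nmD z t : nm (z + t) <= nm z + nm t.
Proof. by rewrite -ofR_le ofRD -!normE ler_normD. Qed.

Lemma nmB z t : nm (z - t) <= nm z + nm t.
Proof. by rewrite -(nmN t) nmD. Qed.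

Lemma nmB_ge z t : nm z - nm t <= nm (z - t).
Proof. by rewrite lerBlDr -{1}(subrK t z) nmD. Qed.

Lemma nmD_ge z t : nm z - nm t <= nm (z + t).
Proof. by rewrite -(nmN t) -{2}(opprK t) nmB_ge. Qed.

Lemma nm_nat n : nm n%:R = n%:R.
Proof.
by apply: ofR_inj; rewrite -normE normr_nat; rewrite /ofR (rmorph_nat (real_complex R)).
Qed.

Lemma nm_sum (I : Type) (s : seq I) (P : pred I) (F : I -> C) :
  nm (\sum_(i <- s | P i) F i) <= \sum_(i <- s | P i) nm (F i).
Proof.
elim/big_rec2: _ => [|i y x _ h]; first by rewrite nm0.
by apply: le_trans (nmD _ _) _; rewrite lerD2l.
Qed.

Lemma nm_nbhs (z0 : C) (P : set C) :
  (\forall t \near z0, P t) <->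
  exists2 d : R, 0 < d & forall t, nm (t - z0) < d -> P t.
Proof.
split.
  move=> /nbhs_ballP[e /= e0 h].
  have er : ofR (complex.Re e) = e by rewrite /ofR RRe_real // gtr0_real.
  exists (complex.Re e); first by rewrite -ofR_lt er.
  by move=> t ht; apply: h; rewrite /ball /= normE -er ofR_lt nmC.
case=> d d0 h; apply/nbhs_ballP; exists (ofR d) => /=; first by rewrite -ofR0 ofR_lt.
by move=> t; rewrite /ball /= normE ofR_lt nmC; apply: h.
Qed.

Lemma nm_dnbhs (z0 : C) (P : set C) :
  (\forall t \near z0^', P t) <->
  exists2 d : R, 0 < d & forall t, t != z0 -> nm (t - z0) < d -> P t.
Proof.
rewrite /dnbhs /within /=; split.
  by move=> /nm_nbhs[d d0 h]; exists d => // t tz ht; exact: h.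
by case=> d d0 h; apply/nm_nbhs; exists d => // t ht tz; exact: h.
Qed.

Lemma nm_cvgP {T : Type} {F : set_system T} {FF : Filter F} (f : T -> C) (l : C) :
  f @ F --> l <-> forall e : R, 0 < e -> \forall t \near F, nm (f t - l) < e.
Proof.
split.
  move=> /cvgrPdist_lt h e e0.
  have /h : 0 < ofR e by rewrite -ofR0 ofR_lt.
  by apply: filterS => t; rewrite normE ofR_lt nmC.
move=> h; apply/cvgrPdist_lt => e e0.
have er : ofR (complex.Re e) = e by rewrite /ofR RRe_real // gtr0_real.
have /h : 0 < complex.Re e by rewrite -ofR_lt er.
by apply: filterS => t; rewrite normE -{2}er ofR_lt nmC.
Qed.

Lemma nm_continuous : continuous nm.
Proof.
move=> z; apply/(@cvgrPdist_lt R R^o _ (nbhs z)) => e e0.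
apply/nm_nbhs; exists e => // t ht /=.
apply: le_lt_trans ht; rewrite ler_norml; apply/andP; split.
  by rewrite lerNl opprB nmB_ge.
by rewrite nmC nmB_ge.
Qed.

End ComplexNorm.
#[export] Hint Extern 0 (is_true (0 <= nm _)) => apply: nm_ge0 : core.

(** * A maximum principle from second-order expansions *)

Section MaximumPrinciple.
Variable R : realType.
Local Notation C := (Cplx R).
Implicit Types (f g k : C -> C) (z t x : C).

(** The remainder is an exact term with a bounded factor [rho], so that the rules for products,
    inverses and square roots come down to ring identities and a bound on a new [rho]. *)
Definition expands2 f x0 := exists a1 a2 (rho : C -> C) (M : R),
  \forall t \near (0 : C),
    f (x0 + t) = f x0 + a1 * t + a2 * t ^+ 2 + rho t * t ^+ 3 /\ nm (rho t) <= M.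

Lemma nm_sqr z : nm z ^+ 2 = complex.Re z ^+ 2 + complex.Im z ^+ 2.
Proof.
case: z => a b; rewrite /nm normc_def /= sqr_sqrtr //.
by rewrite addr_ge0 ?sqr_ge0.
Qed.

Lemma nm_le_ReIm z : nm z <= `|complex.Re z| + `|complex.Im z|.
Proof.
rewrite -(@ler_pXn2r _ 2%N) ?nnegrE ?addr_ge0 // nm_sqr.
rewrite sqrrD !real_normK ?num_real //.
by rewrite addrAC lerDl mulrn_wge0 // mulr_ge0.
Qed.

Lemma Re_le_nm z : `|complex.Re z| <= nm z.
Proof.
rewrite -(@ler_pXn2r _ 2%N) ?nnegrE // nm_sqr real_normK ?num_real //.
by rewrite lerDl sqr_ge0.
Qed.

Lemma Im_le_nm z : `|complex.Im z| <= nm z.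
Proof.
rewrite -(@ler_pXn2r _ 2%N) ?nnegrE // nm_sqr real_normK ?num_real //.
by rewrite lerDr sqr_ge0.
Qed.

Lemma parallelogram z t : nm (z + t) ^+ 2 + nm (z - t) ^+ 2 = 2 * nm z ^+ 2 + 2 * nm t ^+ 2.
Proof. by rewrite !nm_sqr; case: z t => a b [c d] /=; ring. Qed.

(** The maximum is taken over a square, a product of two real segments: it contains the disc of
    radius [M] and lies in the disc of radius [2 M]. *)
Lemma max_on_square (u : C -> R) (M : R) : 0 <= M -> continuous u ->
  exists2 z0, nm z0 <= 2 * M &
    forall z, nm z <= M -> u z <= u z0.
Proof.
move=> M0 cu.
pose A : set (R * R) := `[-M, M] `*` `[-M, M].
pose j (ab : R * R) : C := (ab.1 +i* ab.2)%C.
have cj : continuous (u \o j).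
  move=> ab; apply: continuous_comp; last exact: cu.
  apply/nm_cvgP => e e0.
  have e2 : 0 < e / 2 by lra.
  have h1 : \forall x \near ab, `|x.1 - ab.1| < e / 2.
    have /cvgrPdist_lt /(_ _ e2) : fst @ ab --> ab.1 by exact: cvg_fst.
    by apply: filterS => x; rewrite distrC.
  have h2 : \forall x \near ab, `|x.2 - ab.2| < e / 2.
    have /cvgrPdist_lt /(_ _ e2) : snd @ ab --> ab.2 by exact: cvg_snd.
    by apply: filterS => x; rewrite distrC.
  apply: filterS2 h1 h2 => x h1 h2.
  apply: le_lt_trans (nm_le_ReIm _) _ => /=; lra.
have A0 : A !=set0.
  by exists (0, 0); split => /=; rewrite in_itv /= oppr_le0 M0.
have cA : compact A by apply: compact_setX; exact: segment_compact.
have [ab Aab abmax] := compact_EVT_max A0 cA (continuous_subspaceT cj).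
exists (j ab).
  move: Aab; rewrite inE => -[/=]; rewrite !in_itv /= => /andP[h1 h2] /andP[h3 h4].
  apply: le_trans (nm_le_ReIm _) _ => /=.
  have := ler_norml ab.1 M; have := ler_norml ab.2 M; rewrite h1 h2 h3 h4 /=.
  lra.
move=> z zM; have /abmax : (complex.Re z, complex.Im z) \in A.
  rewrite inE; split; rewrite /= in_itv /= -ler_norml.
  - exact: le_trans (Re_le_nm _) zM.
  - exact: le_trans (Im_le_nm _) zM.
by rewrite /= /j /=; case: z zM.
Qed.

(* Summing over the four points x0 + i^j s kills the first and second order
   terms and leaves the gain 4 eps s^2, so a local maximum is impossible. *)
Lemma no_local_max k x0 (eps : R) : 0 < eps -> expands2 k x0 ->
  ~ (\forall x \near x0, nm (k x) ^+ 2 + eps * nm x ^+ 2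
                      <= nm (k x0) ^+ 2 + eps * nm x0 ^+ 2).
Proof.
move=> eps0 [a1 [a2 [rho [M hk]]]] hmax.
have {}hmax : \forall t \near (0 : C), nm (k (x0 + t)) ^+ 2 + eps * nm (x0 + t) ^+ 2
     <= nm (k x0) ^+ 2 + eps * nm x0 ^+ 2.
  move/nm_nbhs: hmax => [d d0 h]; apply/nm_nbhs; exists d => // t.
  by rewrite subr0 => ht; apply: h; rewrite addrC addKr.
have [d d0 hd] := (nm_nbhs _ _).1 (filterI hk hmax).
pose B := nm (k x0) + nm a1 + nm a2.
pose M' := Num.max M 0.
have M'0 : 0 <= M' by rewrite /M' le_max lexx orbT.
have B0 : 0 <= B by rewrite /B !addr_ge0.
(* Within the range of the expansion, and so small that the cubic error [2 M' B s0^3] at each of the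
   four points stays below the gain [eps s0^2]. *)
pose s0 := Num.min (d / 2) (Num.min 1 (eps / (2 * (M' * B + 1)))).
have MB : 0 <= M' * B by rewrite mulr_ge0.
have s00 : 0 < s0.
  rewrite /s0 !lt_min ltr01 divr_gt0 //=.
  by rewrite divr_gt0 // mulr_gt0 //; lra.
have s0d : s0 < d.
  have : s0 <= d / 2 by rewrite /s0 ge_min lexx.
  lra.
have s01 : s0 <= 1 by rewrite /s0 !ge_min lexx orbT.
have s0e : 2 * M' * B * s0 < eps.
  have : s0 <= eps / (2 * (M' * B + 1)) by rewrite /s0 !ge_min lexx !orbT.
  rewrite ler_pdivlMr ?mulr_gt0 //; last lra.
  nra.
pose s : C := ofR s0.
pose i : C := 'i%C.
have i2 : i * i = -1 by rewrite -expr2 /i sqr_i.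
have nmi : nm i = 1.
  by apply/eqP; rewrite -(eqrXn2 (n := 2)) // ?ler01 // -nmX expr2 i2 nmN nm1 expr1n.
have nms : nm s = s0 by rewrite /s nm_ofR gtr0_norm.
pose P t := k x0 + a1 * t + a2 * t ^+ 2.
have key t : nm t = s0 -> nm (P t) ^+ 2 - 2 * M' * s0 ^+ 3 * B + eps * nm (x0 + t) ^+ 2
     <= nm (k x0) ^+ 2 + eps * nm x0 ^+ 2.
  move=> ht; have [|[ek hM] hm] := hd t; first by rewrite subr0 ht.
  apply: le_trans hm; rewrite lerD2r.
  have PB : nm (P t) <= B.
    apply: le_trans (nmD _ _) _; rewrite /B nmM nmX ht.
    have : nm (k x0 + a1 * t) <= nm (k x0) + nm a1 * s0.
      by apply: le_trans (nmD _ _) _; rewrite nmM ht.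
    have := nm_ge0 a1; have := nm_ge0 a2.
    have : s0 ^+ 2 <= 1 by rewrite expr_le1 // ltW.
    nra.
  have hr : nm (rho t * t ^+ 3) <= M' * s0 ^+ 3.
    rewrite nmM nmX ht; apply: ler_wpM2r; first by rewrite exprn_ge0 // ltW.
    by apply: le_trans hM _; rewrite le_max lexx.
  have : nm (P t) - M' * s0 ^+ 3 <= nm (k (x0 + t)).
    by rewrite ek; apply: le_trans _ (nmD_ge _ _); rewrite lerD2l lerN2.
  have : 0 <= M' * s0 ^+ 3 by rewrite mulr_ge0 // exprn_ge0 // ltW.
  have := nm_ge0 (P t); have := nm_ge0 (k (x0 + t)).
  have -> : 2 * M' * s0 ^+ 3 * B = 2 * (M' * s0 ^+ 3) * B by ring.
  move: (nm (P t)) (nm (k (x0 + t))) (M' * s0 ^+ 3) PB => p q m pB q0 p0 m0 hpq.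
  have mB : m * p <= m * B by rewrite ler_wpM2l.
  have [mp|pm] := leP m p.
    have h : 0 <= (q - (p - m)) * (q + (p - m)) by rewrite mulr_ge0 //; lra.
    by have := sqr_ge0 m; nra.
  have h : p * p <= p * m by rewrite ler_wpM2l // ltW.
  by have := sqr_ge0 q; nra.
have h1 := key s nms.
have h2 := key (- s) (etrans (nmN _) nms).
have nmis : nm (i * s) = s0 by rewrite nmM nmi nms mul1r.
have h3 := key (i * s) nmis.
have h4 := key (- (i * s)) (etrans (nmN _) nmis).
have g1 := parallelogram x0 s.
have g2 := parallelogram x0 (i * s).
(* Together these bound the sum of the four squares [nm (P t) ^+ 2] below by [4 nm (k x0) ^+ 2];
   [g1] and [g2] do the same for the term [eps |x|^2], with the gain. *)
have f1 := parallelogram (k x0 + a2 * s ^+ 2) (a1 * s).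
have f2 := parallelogram (k x0 - a2 * s ^+ 2) (a1 * (i * s)).
have f3 := parallelogram (k x0) (a2 * s ^+ 2).
have e1 : P s = k x0 + a2 * s ^+ 2 + a1 * s by rewrite /P; ring.
have e2 : P (- s) = k x0 + a2 * s ^+ 2 - a1 * s by rewrite /P; ring.
have is2 : (i * s) ^+ 2 = - s ^+ 2 by rewrite expr2 mulrACA i2 mulN1r expr2.
have e3 : P (i * s) = k x0 - a2 * s ^+ 2 + a1 * (i * s) by rewrite /P is2; ring.
have e4 : P (- (i * s)) = k x0 - a2 * s ^+ 2 - a1 * (i * s).
  by rewrite /P sqrrN is2; ring.
rewrite e1 in h1; rewrite e2 in h2; rewrite e3 in h3; rewrite e4 in h4.
rewrite nms in g1; rewrite nmis in g2.
have := sqr_ge0 (nm (a1 * s)); have := sqr_ge0 (nm (a1 * (i * s))).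
have := sqr_ge0 (nm (a2 * s ^+ 2)).
have e5 : 2 * M' * s0 ^+ 3 * B = (2 * M' * B * s0) * s0 ^+ 2 by ring.
have s20 : 0 < s0 ^+ 2 by rewrite exprn_gt0.
have s2e : (2 * M' * B * s0) * s0 ^+ 2 < eps * s0 ^+ 2 by rewrite ltr_pM2r.
rewrite e5 in h1 h2 h3 h4.
have eg1 : eps * (nm (x0 + s) ^+ 2 + nm (x0 - s) ^+ 2) = eps * (2 * nm x0 ^+ 2 + 2 * s0 ^+ 2) by rewrite g1.
have eg2 : eps * (nm (x0 + i * s) ^+ 2 + nm (x0 - i * s) ^+ 2) = eps * (2 * nm x0 ^+ 2 + 2 * s0 ^+ 2) by rewrite g2.
move: eg1 eg2; rewrite !mulrDr.
lra.
Qed.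

(** The function |k|^2 is perturbed by [eps |z|^2], for which [no_local_max] excludes interior
    maxima. Expansions are asked for only where [k] is nonzero, because in the application [k] is
    merely continuous at the exceptional points, where it vanishes. *)
Lemma maximum_principle k : continuous k ->
  (forall x, k x != 0 -> expands2 k x) ->
  (forall e : R, 0 < e -> exists M : R, forall x, M <= nm x -> nm (k x) <= e) ->
  forall x, k x = 0.
Proof.
move=> ck hk dk z1; apply/eqP/negPn/negP => kz1.
pose m := nm (k z1).
have m0 : 0 < m by rewrite nm_gt0.
have m20 : 0 < m / 2 by lra.
have [M0 hM0] := dk (m / 2) m20.
pose M := Num.max M0 (Num.max (nm z1) 1).
have M1 : 1 <= M by rewrite /M !le_max lexx !orbT.
have z1M : nm z1 <= M by rewrite /M !le_max lexx !orbT.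
have hM x : M <= nm x -> nm (k x) <= m / 2.
  by move=> xM; apply: hM0; apply: le_trans xM; rewrite /M le_max lexx.
(* On the disc of radius [2 M] the perturbation is at most [m^2 / 4]. So [nm (k z0) ^+ 2] is at
   least [3 m^2 / 4] at the maximiser, which forces [k z0] to be nonzero and, by [hM], [z0] to lie
   inside the disc of radius [M]. *)
pose eps := m ^+ 2 / (16 * M ^+ 2).
have M2 : 0 < M ^+ 2 by rewrite exprn_gt0 //; lra.
have eps0 : 0 < eps by apply: divr_gt0; [exact: exprn_gt0 | exact: mulr_gt0].
have eM : eps * M ^+ 2 = m ^+ 2 / 16 by rewrite /eps; field; lra.
pose u z := nm (k z) ^+ 2 + eps * nm z ^+ 2.
have cu : continuous u.
  move=> z.
  have h1 : (@nm R \o k) y @[y --> z] --> (nm (k z) : R^o).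
    exact: (@continuous_comp _ _ _ k (@nm R) z (ck z) (@nm_continuous R _)).
  have h2 : @nm R y @[y --> z] --> (nm z : R^o) by exact: nm_continuous.
  exact: (cvgD (cvgM h1 h1) (cvgM (cvg_cst (eps : R^o)) (cvgM h2 h2))).
have [z0 z0M zmax] := max_on_square (le_trans ler01 M1) cu.
have uz1 : m ^+ 2 <= u z1 by rewrite /u lerDl mulr_ge0 ?exprn_ge0 // ltW.
have uz0 : m ^+ 2 <= u z0 by apply: le_trans uz1 _; exact: zmax.
have ez0 : eps * nm z0 ^+ 2 <= m ^+ 2 / 4.
  have : nm z0 ^+ 2 <= (2 * M) ^+ 2.
    by rewrite ler_pXn2r ?nnegrE // mulr_ge0 //; lra.
  rewrite -(ler_pM2l eps0) => h; apply: le_trans h _.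
  by rewrite exprMn mulrCA eM; lra.
have m2 : 0 < m ^+ 2 by rewrite exprn_gt0.
have kz0 : k z0 != 0.
  by apply/negP => /eqP h; move: uz0; rewrite /u h nm0 expr0n /=; lra.
have z0M' : nm z0 < M.
  rewrite ltNge; apply/negP => /hM h.
  have : nm (k z0) ^+ 2 <= (m / 2) ^+ 2.
    by rewrite ler_pXn2r ?nnegrE //; lra.
  by rewrite expr_div_n; move: uz0; rewrite /u; lra.
apply: (no_local_max eps0 (hk _ kz0)).
apply/nm_nbhs; exists (M - nm z0); first by rewrite subr_gt0.
move=> x hx; apply: zmax; have := nmD (x - z0) z0; rewrite subrK; lra.
Qed.

End MaximumPrinciple.

(** * Calculus of second-order expansions and Liouville's theorem with exceptional points *)

Section Liouville.
Variable R : realType.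
Local Notation C := (Cplx R).
Implicit Types (f g k : C -> C) (z t x : C) (S : seq C).

Lemma cnearW (x0 : C) (P : set C) : (forall x, P x) -> \forall x \near x0, P x.
Proof. by move=> h; apply/nm_nbhs; exists 1. Qed.

Lemma cnearS (x0 : C) (P Q : set C) : (forall x, P x -> Q x) ->
  (\forall x \near x0, P x) -> \forall x \near x0, Q x.
Proof. by move=> h /nm_nbhs[d d0 hP]; apply/nm_nbhs; exists d => // x /hP/h. Qed.

Lemma cnearS2 (x0 : C) (P1 P2 Q : set C) : (forall x, P1 x -> P2 x -> Q x) ->
  (\forall x \near x0, P1 x) -> (\forall x \near x0, P2 x) -> \forall x \near x0, Q x.
Proof.
move=> h h1 h2; apply: cnearS (@filterI _ (nbhs x0) _ _ _ h1 h2) => x [p1 p2].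
exact: h.
Qed.

Lemma cnearS3 (x0 : C) (P1 P2 P3 Q : set C) : (forall x, P1 x -> P2 x -> P3 x -> Q x) ->
  (\forall x \near x0, P1 x) -> (\forall x \near x0, P2 x) ->
  (\forall x \near x0, P3 x) -> \forall x \near x0, Q x.
Proof.
move=> h h1 h2 h3; apply: cnearS2 (@filterI _ (nbhs x0) _ _ _ h1 h2) h3 => x [p1 p2].
exact: h.
Qed.

Lemma nm_continuousP f x0 : {for x0, continuous f} <->
  forall e : R, 0 < e -> \forall x \near x0, nm (f x - f x0) < e.
Proof. exact: (@nm_cvgP _ _ (nbhs x0) _ f (f x0)). Qed.

Lemma addKB x0 x : x0 + (x - x0) = x.
Proof. by rewrite addrC subrK. Qed.

Lemma expands2_cst (c x0 : C) : expands2 (fun=> c) x0.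
Proof.
by exists 0, 0, (fun=> 0), 0; apply: cnearW => t; rewrite nm0 !mul0r !addr0.
Qed.

Lemma expands2_id x0 : expands2 (@id C) x0.
Proof.
by exists 1, 0, (fun=> 0), 0; apply: cnearW => t; rewrite nm0 !mul0r !addr0 mul1r.
Qed.

Lemma expands2D f g x0 : expands2 f x0 -> expands2 g x0 ->
  expands2 (fun x => f x + g x) x0.
Proof.
move=> [a1 [a2 [r [M h]]]] [b1 [b2 [s [N h']]]].
exists (a1 + b1), (a2 + b2), (fun t => r t + s t), (M + N).
apply: cnearS2 h h' => t [-> rM] [-> sN]; split; first by ring.
by apply: le_trans (nmD _ _) _; exact: lerD.
Qed.

Lemma expands2_eq f g x0 : (\forall x \near x0, f x = g x) ->
  expands2 f x0 -> expands2 g x0.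
Proof.
move=> fg [a1 [a2 [r [M h]]]]; exists a1, a2, r, M.
move/nm_nbhs: fg => [d d0 fg].
have h0 : \forall t \near (0 : C), f (x0 + t) = g (x0 + t).
  by apply/nm_nbhs; exists d => // t; rewrite subr0 => ht; apply: fg; rewrite addrC addKr.
apply: cnearS2 h h0 => t [+ ?] <-; rewrite -fg; first by [].
by rewrite subrr nm0.
Qed.

Lemma near0_le (d : R) : 0 < d -> \forall t \near (0 : C), nm t <= d.
Proof. by move=> d0; apply/nm_nbhs; exists d => // t; rewrite subr0 => /ltW. Qed.

Lemma expands2M f g x0 : expands2 f x0 -> expands2 g x0 ->
  expands2 (fun x => f x * g x) x0.
Proof.
move=> [a1 [a2 [r [M h]]]] [b1 [b2 [s [N h']]]].
pose q t := (f x0 + a1 * t + a2 * t ^+ 2) * s t + r t * (g x0 + b1 * t + b2 * t ^+ 2 + s t * t ^+ 3)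
  + (a1 * b2 + a2 * b1 + a2 * b2 * t).
exists (f x0 * b1 + a1 * g x0), (f x0 * b2 + a1 * b1 + a2 * g x0), q.
exists ((nm (f x0) + nm a1 + nm a2) * N + M * (nm (g x0) + nm b1 + nm b2 + N)
  + (nm (a1 * b2) + nm (a2 * b1) + nm (a2 * b2))).
apply: cnearS3 h h' (near0_le ltr01) => t [-> rM] [-> sN] t1.
split; first by rewrite /q; ring.
have M0 : 0 <= M by apply: le_trans rM.
have N0 : 0 <= N by apply: le_trans sN.
have tn n : nm t ^+ n <= 1 by rewrite exprn_ile1.
have cn (c : C) n : nm (c * t ^+ n) <= nm c by rewrite nmM nmX ler_piMr.
have e (a b c : C) : nm (a + b * t + c * t ^+ 2) <= nm a + nm b + nm c.
  apply: le_trans (nmD _ _) _; apply: lerD; last exact: cn.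
  by apply: le_trans (nmD _ _) _; apply: lerD => //; exact: (cn _ 1%N).
rewrite /q; apply: le_trans (nmD _ _) _; apply: lerD.
  apply: le_trans (nmD _ _) _; apply: lerD; rewrite nmM; apply: ler_pM => //.
  apply: le_trans (nmD _ _) _; apply: lerD => //.
  exact: le_trans (cn _ _) sN.
apply: le_trans (nmD _ _) _; apply: lerD; last exact: (cn _ 1%N).
exact: nmD.
Qed.

Lemma expands2X f n x0 : expands2 f x0 -> expands2 (fun x => f x ^+ n) x0.
Proof.
move=> h; elim: n => [|n IH].
  by apply: expands2_eq (expands2_cst 1 x0); apply: cnearW => x; rewrite expr0.
by apply: expands2_eq (expands2M h IH); apply: cnearW => x; rewrite exprS.
Qed.

Lemma expands2N f x0 : expands2 f x0 -> expands2 (fun x => - f x) x0.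
Proof.
move=> h; apply: expands2_eq (expands2M (expands2_cst (-1) x0) h).
by apply: cnearW => x; rewrite mulN1r.
Qed.

Lemma expands2B f g x0 : expands2 f x0 -> expands2 g x0 ->
  expands2 (fun x => f x - g x) x0.
Proof. by move=> hf hg; exact: expands2D hf (expands2N hg). Qed.

Lemma expands2_bounded f x0 : expands2 f x0 ->
  exists a (M : R), \forall t \near (0 : C), nm (f (x0 + t) - f x0 - a * t) <= M * nm t ^+ 2.
Proof.
move=> [a1 [a2 [r [M h]]]]; exists a1, (nm a2 + M).
apply: cnearS2 h (near0_le ltr01) => t [-> rM] t1.
have -> : f x0 + a1 * t + a2 * t ^+ 2 + r t * t ^+ 3 - f x0 - a1 * t
   = (a2 + r t * t) * t ^+ 2 by ring.
rewrite nmM nmX ler_wpM2r ?exprn_ge0 //; apply: le_trans (nmD _ _) _; rewrite lerD2l.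
by apply: le_trans rM; rewrite nmM ler_piMr.
Qed.

Lemma expands2_continuous f x0 : expands2 f x0 -> {for x0, continuous f}.
Proof.
move=> /expands2_bounded [a [M /nm_nbhs[d d0 h]]]; apply/nm_continuousP => e e0.
pose K := nm a + `|M| + 1.
have K0 : 0 < K by rewrite /K; have := normr_ge0 M; have := nm_ge0 a; lra.
apply/nm_nbhs; exists (Num.min d (Num.min 1 (e / K))).
  by rewrite !lt_min d0 ltr01 divr_gt0.
move=> x; rewrite !lt_min => /and3P[xd x1 xe].
have := h (x - x0); rewrite subr0 addKB => /(_ xd) hx.
rewrite ltr_pdivlMr // in xe.
have := nmD (f x - f x0 - a * (x - x0)) (a * (x - x0)); rewrite subrK nmM.
have : M * nm (x - x0) ^+ 2 <= `|M| * nm (x - x0).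
  rewrite expr2 mulrA ler_wpM2r //; apply: le_trans (ler_norm _) _.
  by rewrite normrM ler_piMr // ger0_norm // ltW.
move: (nm (f x - f x0)) (nm (f x - f x0 - _)) hx => p q hx.
by have := nm_ge0 (x - x0); rewrite /K in xe; nra.
Qed.

Lemma expands2V f x0 : f x0 != 0 -> expands2 f x0 -> expands2 (fun x => (f x)^-1) x0.
Proof.
move=> f0 hf; have /nm_continuousP cf := expands2_continuous hf.
have e0 : 0 < nm (f x0) / 2 by rewrite divr_gt0 // nm_gt0.
have /nm_nbhs[d d0 hd] := cf _ e0.
have {cf}hd' : \forall t \near (0 : C), nm (f x0) / 2 <= nm (f (x0 + t)).
  apply/nm_nbhs; exists d => // t; rewrite subr0 => ht.
  have := hd (x0 + t); have -> : x0 + t - x0 = t by ring.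
  move=> /(_ ht); have := nmB_ge (f x0) (f (x0 + t)); rewrite (nmC (f x0)); lra.
move: hf => [a1 [a2 [r [M h]]]].
set c := f x0 in f0 e0 hd' h *.
pose b1 := - a1 / c ^+ 2; pose b2 := (a1 ^+ 2 / c - a2) / c ^+ 2.
(* [1 - (c + a1 t + a2 t^2)(c^-1 + b1 t + b2 t^2)] has no terms of order < 3 *)
pose N t := - (a1 * b2 + a2 * b1 + a2 * b2 * t) - r t * (c^-1 + b1 * t + b2 * t ^+ 2).
exists b1, b2, (fun t => N t / f (x0 + t)).
pose K := nm (a1 * b2 + a2 * b1) + nm (a2 * b2) + M * (nm c^-1 + nm b1 + nm b2).
exists (K / (nm c / 2)).
apply: cnearS3 h hd' (near0_le ltr01) => t [ht rM] hc t1.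
have ft0 : f (x0 + t) != 0 by rewrite -nm_gt0; apply: lt_le_trans hc.
split.
  rewrite -/c; set F := f (x0 + t) in ht ft0 hc *.
  apply: (mulfI ft0); rewrite mulfV //.
  have -> : F * (c^-1 + b1 * t + b2 * t ^+ 2 + N t / F * t ^+ 3)
    = F * (c^-1 + b1 * t + b2 * t ^+ 2) + N t * t ^+ 3 by field; rewrite f0.
  by rewrite ht /N /b1 /b2; field.
rewrite nmM nmV; apply: ler_pM => //; first by rewrite invr_ge0.
  have M0 : 0 <= M by apply: le_trans rM.
  have cn (u : C) n : nm (u * t ^+ n) <= nm u.
    by rewrite nmM nmX ler_piMr // exprn_ile1.
  rewrite /N /K; apply: le_trans (nmB _ _) _; rewrite nmN; apply: lerD.
    by apply: le_trans (nmD _ _) _; apply: lerD => //; exact: (cn _ 1%N).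
  rewrite nmM; apply: ler_pM => //.
  apply: le_trans (nmD _ _) _; apply: lerD; last exact: cn.
  by apply: le_trans (nmD _ _) _; apply: lerD => //; exact: (cn _ 1%N).
by rewrite lef_pV2 // ?posrE // nm_gt0.
Qed.

Lemma near_notin S x0 : \forall x \near x0^', x \notin S.
Proof.
elim: S => [|s S IH]; first exact: nearW.
apply: filterS2 IH (_ : \forall x \near x0^', x != s) => [x xS xs|].
  by rewrite inE negb_or xs.
have [->|xs] := eqVneq s x0; first by apply/nm_dnbhs; exists 1.
apply/nm_dnbhs; exists (nm (s - x0)); first by rewrite nm_gt0 subr_eq0.
by move=> x _ h; apply/negP => /eqP e; rewrite e ltxx in h.
Qed.

Lemma exists_notin S : exists z, z \notin S.
Proof.
exists (ofR (1 + \sum_(s <- S) nm s)); apply/negP => h.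
have : nm (ofR (1 + \sum_(s <- S) nm s)) <= \sum_(s <- S) nm s.
  by rewrite [leRHS](big_rem _ h) /= lerDl sumr_ge0.
rewrite nm_ofR ger0_norm; first by rewrite gerDr ler10.
by rewrite addr_ge0 // sumr_ge0.
Qed.

Definition bounded_at f x0 := exists M : R, \forall x \near x0^', nm (f x) <= M.

Lemma expands2_bounded_at f x0 : expands2 f x0 -> bounded_at f x0.
Proof.
move=> /expands2_continuous /nm_continuousP /(_ 1 ltr01) /nm_nbhs[d d0 h].
exists (nm (f x0) + 1); apply/nm_dnbhs; exists d => // x _ /h hx.
by have := nmD (f x - f x0) (f x0); rewrite subrK; lra.
Qed.

Lemma bounded_atM f g x0 : bounded_at f x0 -> bounded_at g x0 ->
  bounded_at (fun x => f x * g x) x0.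
Proof.
move=> [M hM] [N hN]; exists (M * N); apply: filterS2 hM hN => x hM hN.
by rewrite nmM ler_pM.
Qed.

Lemma bounded_atD f g x0 : bounded_at f x0 -> bounded_at g x0 ->
  bounded_at (fun x => f x + g x) x0.
Proof.
move=> [M hM] [N hN]; exists (M + N); apply: filterS2 hM hN => x hM hN.
by apply: le_trans (nmD _ _) _; rewrite lerD.
Qed.

(* The powers of h damp the growth of the product at infinity, and the product
   vanishes at the points of S, where h is only known to be bounded. *)
Lemma liouville_vanishing f S :
  (forall x, x \notin S -> expands2 f x) ->
  (forall s, s \in S -> bounded_at f s) ->
  (exists K M : R, forall x, M <= nm x -> x \notin S -> nm (f x) * nm x <= K) ->
  forall x, x \notin S -> f x = 0.
Proof.
move=> hf bf [K [M hK]].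
pose Q x := \prod_(s <- S) (x - s).
(* One more than the degree of [Q]: as [f] is O(1/x), [k] is O(1/x) too. *)
pose N := (size S).+1.
pose k x := f x ^+ N * Q x.
have Q0 x : (Q x == 0) = (x \in S).
  rewrite /Q; apply/idP/idP.
    rewrite prodf_seq_eq0 => /hasP[s sS]; rewrite /= subr_eq0 => /eqP -> //.
  by move=> xS; rewrite prodf_seq_eq0; apply/hasP; exists x; rewrite //= subrr.
have eQ x : expands2 Q x.
  rewrite /Q; elim: (S) => [|s S' IH].
    by apply: expands2_eq (expands2_cst 1 x); apply: cnearW => y; rewrite big_nil.
  apply: expands2_eq (expands2M (expands2B (expands2_id x) (expands2_cst s x)) IH).
  by apply: cnearW => y; rewrite big_cons.
have ek x : x \notin S -> expands2 k x.
  by move=> xS; apply: expands2M (eQ x); apply: expands2X; exact: hf.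
have ck : continuous k.
  move=> x; have [xS|] := boolP (x \in S); last by move=> /ek /expands2_continuous.
  have [B hB] := bf _ xS.
  have /nm_continuousP cQ := expands2_continuous (eQ x).
  have Qx : Q x = 0 by apply/eqP; rewrite Q0.
  have kx : k x = 0 by rewrite /k Qx mulr0.
  apply/nm_continuousP => e e0; pose B' := Num.max B 1.
  have B'0 : 0 < B' ^+ N by rewrite exprn_gt0 // lt_max ltr01 orbT.
  have /nm_nbhs[d d0 hd] := cQ (e / B' ^+ N) (divr_gt0 e0 B'0).
  move/nm_dnbhs: hB => [d' d'0 hd'].
  apply/nm_nbhs; exists (Num.min d d'); first by rewrite lt_min d0.
  move=> y; rewrite lt_min => /andP[yd yd'].
  have [->|yx] := eqVneq y x; first by rewrite subrr nm0.
  rewrite kx subr0 /k nmM nmX.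
  have := hd _ yd; rewrite Qx subr0 ltr_pdivlMr // mulrC; apply: le_lt_trans.
  rewrite ler_wpM2r // ler_pXn2r ?nnegrE // ?le_max ?ler01 ?orbT //.
  by rewrite hd'.
have dk (e : R) : 0 < e -> exists M : R, forall x, M <= nm x -> nm (k x) <= e.
  move=> e0; pose sS := \sum_(s <- S) nm s.
  have sS0 : 0 <= sS by rewrite sumr_ge0.
  pose K' := Num.max K 1.
  have K'1 : 1 <= K' by rewrite le_max lexx orbT.
  pose D := K' ^+ N * 2 ^+ size S.
  have D0 : 0 < D by rewrite mulr_gt0 // exprn_gt0 //; lra.
  exists (Num.max M (Num.max (sS + 1) (D / e))) => x.
  rewrite !ge_max => /and3P[xM xs xe].
  have [xS|xS] := boolP (x \in S).
    have /eqP Qx : Q x == 0 by rewrite Q0.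
    by rewrite /k Qx mulr0 nm0 ltW.
  have x0 : 0 < nm x by lra.
  have fx : nm (f x) <= K' / nm x.
    rewrite ler_pdivlMr //; apply: le_trans (hK _ xM xS) _.
    by rewrite le_max lexx.
  have Qx : nm (Q x) <= (2 * nm x) ^+ size S.
    have : forall s, s \in S -> nm s <= nm x.
      move=> s sS'; apply: le_trans (_ : sS <= _); last by lra.
      by rewrite /sS (big_rem _ sS') /= lerDl sumr_ge0.
    rewrite /Q; elim: (S) => [|s S' IH] hs; first by rewrite big_nil nm1 expr0.
    rewrite big_cons nmM /= exprS; apply: ler_pM => //.
      have := nmB x s; have := hs s (mem_head _ _); lra.
    by apply: IH => s' hs'; apply: hs; rewrite inE hs' orbT.
  rewrite /k nmM nmX; apply: le_trans (_ : (K' / nm x) ^+ N * (2 * nm x) ^+ size S <= _).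
    by apply: ler_pM => //; rewrite ?exprn_ge0 // ler_pXn2r ?nnegrE // divr_ge0 //; lra.
  have -> : (K' / nm x) ^+ N * (2 * nm x) ^+ size S = D / nm x.
    rewrite /D /N exprMn exprMn exprVn [(nm x) ^+ _.+1]exprS invfM.
    by field; rewrite expf_neq0 gt_eqF.
  by rewrite ler_pdivrMr // mulrC -ler_pdivrMr.
have kS x : k x != 0 -> x \notin S.
  by rewrite -Q0 /k mulf_eq0 negb_or => /andP[].
have k0 := maximum_principle ck (fun x kx => ek x (kS x kx)) dk.
move=> x xS; apply/eqP; have /eqP := k0 x.
by rewrite /k mulf_eq0 Q0 (negbTE xS) orbF expf_eq0 => /andP[].
Qed.

(** By induction on [n]: the difference quotient at a point [z] off [S] is bounded near [z], which
    joins the exceptional set, and grows by one order less. The factor [nm x] on the left of the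
    growth condition makes [n = 0] the case of decay, where the polynomial is 0. *)
Lemma liouville_polynomial n f S :
  (forall x, x \notin S -> expands2 f x) ->
  (forall s, s \in S -> bounded_at f s) ->
  (exists K M : R, forall x, M <= nm x -> x \notin S ->
     nm (f x) * nm x <= K * nm x ^+ n) ->
  exists2 A : {poly C}, (size A <= n)%N & forall x, x \notin S -> f x = A.[x].
Proof.
elim: n f S => [|n IH] f S hf bf [K [M hK]].
  exists 0; first by rewrite size_poly0.
  move=> x xS; rewrite horner0; apply: (liouville_vanishing hf bf) xS.
  by exists K, M => y yM yS; have := hK y yM yS; rewrite expr0 mulr1.
have [z zS] := exists_notin S.
pose h x := (f x - f z) / (x - z).
have eh1 x : x != z -> expands2 (fun x => (x - z)^-1) x.
  move=> xz; apply: expands2V; first by rewrite subr_eq0.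
  exact: expands2B (expands2_id x) (expands2_cst z x).
have [||| A sA hA] := IH h (z :: S).
- move=> x; rewrite inE negb_or => /andP[xz xS].
  exact: expands2M (expands2B (hf _ xS) (expands2_cst _ x)) (eh1 _ xz).
- move=> s; rewrite inE; have [-> _|sz sS] := eqVneq s z.
    have [a [B /nm_nbhs[d d0 hB]]] := expands2_bounded (hf _ zS).
    exists (nm a + `|B|); apply/nm_dnbhs; exists (Num.min d 1); first by rewrite lt_min d0 ltr01.
    move=> x xz; rewrite lt_min => /andP[xd x1].
    have := hB (x - z); rewrite subr0 addKB => /(_ xd) hx.
    have xz0 : 0 < nm (x - z) by rewrite nm_gt0 subr_eq0.
    rewrite /h nmM nmV ler_pdivrMr //.
    have := nmD (f x - f z - a * (x - z)) (a * (x - z)); rewrite subrK nmM.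
    have : B * nm (x - z) ^+ 2 <= `|B| * nm (x - z).
      rewrite expr2 mulrA ler_wpM2r //; apply: le_trans (ler_norm _) _.
      by rewrite normrM ler_piMr // ger0_norm // ltW.
    by nra.
  apply: bounded_atM (expands2_bounded_at (eh1 _ sz)).
  apply: bounded_atD; first exact: bf.
  exact/expands2_bounded_at/expands2_cst.
- exists (2 * (`|K| + nm (f z))), (Num.max M (Num.max 1 (2 * nm z))) => x.
  rewrite !ge_max inE negb_or => /and3P[xM x1 xz2] /andP[xz xS].
  have hx := hK x xM xS.
  have x0 : 0 < nm x by lra.
  have xz0 : 0 < nm (x - z) by rewrite nm_gt0 subr_eq0.
  have xz3 : nm x <= 2 * nm (x - z) by have := nmB_ge x z; lra.
  rewrite /h nmM nmV mulrAC ler_pdivrMr //.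
  have hx' : nm (f x) <= `|K| * nm x ^+ n.
    rewrite -(ler_pM2r x0); apply: le_trans hx _; rewrite exprSr mulrA.
    by rewrite !ler_wpM2r ?exprn_ge0 ?ler_norm.
  have xn1 : 1 <= nm x ^+ n by rewrite exprn_ege1.
  have h1 : nm (f x - f z) <= (`|K| + nm (f z)) * nm x ^+ n.
    apply: le_trans (nmB _ _) _; rewrite mulrDl lerD // ler_peMr //.
  have -> : 2 * (`|K| + nm (f z)) * nm x ^+ n * nm (x - z)
    = ((`|K| + nm (f z)) * nm x ^+ n) * (2 * nm (x - z)) by ring.
  exact: ler_pM.
exists ((f z)%:P + ('X - z%:P) * A).
  apply: leq_trans (size_polyD _ _) _; rewrite geq_max; apply/andP; split.
    by apply: leq_trans (size_polyC_leq1 _) _.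
  by apply: leq_trans (size_polyMleq _ _) _; rewrite size_XsubC.
move=> x xS; rewrite !hornerE; have [->|xz] := eqVneq x z.
  by rewrite subrr mul0r addr0.
rewrite -hA; first by rewrite /h mulrCA divff ?mulr1 ?subrKC ?subr_eq0 // addrC subrK.
by rewrite inE negb_or xz.
Qed.

End Liouville.

(** * Remainders of convergent Laurent series *)

Section Laurent.
Variable R : realType.
Local Notation C := (Cplx R).
Implicit Types (f : C -> C) (z t x : C).

Lemma eq_leR (x y : R) : x = y -> x <= y.
Proof. by move=> ->. Qed.

Lemma nmXz z (m : int) : nm (z ^ m) = nm z ^ m.
Proof. by case: m => n; rewrite ?NegzE -?exprnN -?exprnP ?nmV nmX. Qed.

Lemma geometric_tail (x : R) N n : 0 <= x -> x <= 1 / 2 ->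
  \sum_(N <= k < N + n) x ^+ k <= 2 * x ^+ N.
Proof.
move=> x0 x1; apply: le_trans (_ : 2 * x ^+ N - 2 * x ^+ (N + n) <= _); last first.
  by rewrite gerBl mulr_ge0 // exprn_ge0.
elim: n => [|n IH]; first by rewrite addn0 big_geq // subrr.
rewrite addnS big_nat_recr ?leq_addr //= exprSr.
have : 0 <= x ^+ (N + n) by rewrite exprn_ge0.
nra.
Qed.

(** Convergence at a single radius [r] bounds the terms there, and for [nm t <= r / 2] a geometric
    series of ratio at most 1/2 dominates the tail. *)
Lemma laurent_remainder (a : nat -> C) (m0 : int) f N :
  (\forall t \near (0 : C)^', series (fun k : nat => t ^ (m0 + k%:Z) * a k) @ \oo --> f t) ->
  exists M : R, \forall t \near (0 : C)^',
    nm (f t - \sum_(k < N) t ^ (m0 + k%:Z) * a k) <= M * nm t ^ (m0 + N%:Z).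
Proof.
move=> /nm_dnbhs[d d0 hd].
pose r : R := d / 2.
have r0 : 0 < r by rewrite divr_gt0.
pose t0 : C := ofR r.
have nt0 : nm t0 = r by rewrite nm_ofR gtr0_norm.
have t00 : t0 != 0 by rewrite -nm_gt0 nt0.
have /nm_cvgP /(_ 1 ltr01) [n0 _ hn0] : series (fun k : nat => t0 ^ (m0 + k%:Z) * a k) @ \oo --> f t0.
  by apply: hd => //; rewrite subr0 nt0 /r; lra.
have [B hB] : exists B : R, forall k, nm (a k) * r ^+ k <= B.
  pose u k := nm (t0 ^ (m0 + k%:Z) * a k).
  have [B hB] : exists B : R, forall k, u k <= B.
    (* From [n0] on, two consecutive partial sums are within 1 of the limit, so the term between
       them is at most 2. *)
    exists (2 + \sum_(k < n0) u k) => k; have [kn|kn] := ltnP k n0.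
      rewrite (bigD1 (Ordinal kn)) //= addrCA lerDl addr_ge0 // sumr_ge0 //.
      by move=> i _; exact: nm_ge0.
    apply: le_trans (_ : 2 <= _); last by rewrite lerDl sumr_ge0 // => i _; exact: nm_ge0.
    have h1 := hn0 _ kn; have h2 := hn0 k.+1 (leqW kn).
    have := nmB (series (fun k : nat => t0 ^ (m0 + k%:Z) * a k) k.+1 - f t0)
       (series (fun k : nat => t0 ^ (m0 + k%:Z) * a k) k - f t0).
    have -> : series (fun k : nat => t0 ^ (m0 + k%:Z) * a k) k.+1 - f t0 -
       (series (fun k : nat => t0 ^ (m0 + k%:Z) * a k) k - f t0) = t0 ^ (m0 + k%:Z) * a k.
      by rewrite /series /= big_nat_recr //=; ring.
    rewrite /= in h1 h2; rewrite -/(u k); lra.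
  exists (B / r ^ m0) => k.
  have rm : 0 < r ^ m0 by rewrite exprz_gt0.
  rewrite ler_pdivlMr //; apply: le_trans (hB k).
  by rewrite /u nmM nmXz nt0 expfzDr ?gt_eqF // -exprnP; apply: eq_leR; ring.
have B0 : 0 <= B by apply: le_trans (hB 0%N); rewrite mulr_ge0.
exists (2 * B / r ^+ N); apply/nm_dnbhs; exists (r / 2); first by rewrite divr_gt0.
move=> t tn; rewrite subr0 => ht.
have nt : 0 < nm t by rewrite nm_gt0.
have /nm_cvgP cf : series (fun k : nat => t ^ (m0 + k%:Z) * a k) @ \oo --> f t.
  by apply: hd => //; rewrite subr0; rewrite /r in ht; lra.
set S := \sum_(k < N) _.
set b := _ * nm t ^ _.
have tail n : nm (series (fun k : nat => t ^ (m0 + k%:Z) * a k) (N + n)%N - S) <= b.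
  rewrite /series /= /S -(big_mkord xpredT (fun k => t ^ (m0 + k%:Z) * a k)).
  rewrite (big_cat_nat _ (leq_addr n N)) //= addrAC subrr add0r.
  apply: le_trans (nm_sum _ _ _) _.
  have tr : nm t / r <= 1 / 2 by rewrite ler_pdivrMr //; lra.
  have tr0 : 0 <= nm t / r by rewrite divr_ge0 // ltW.
  apply: le_trans (_ : nm t ^ m0 * (B * (2 * (nm t / r) ^+ N)) <= _); last first.
    rewrite /b expfzDr ?gt_eqF // -exprnP expr_div_n; apply: eq_leR.
    by field; rewrite gt_eqF // exprn_gt0.
  apply: le_trans (_ : nm t ^ m0 * (B * \sum_(N <= k < N + n) (nm t / r) ^+ k) <= _); last first.
    rewrite ler_pM2l ?exprz_gt0 // ler_wpM2l //; exact: geometric_tail.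
  rewrite !mulr_sumr; apply: ler_sum => k _.
  rewrite nmM nmXz expfzDr ?gt_eqF // -exprnP -mulrA ler_pM2l ?exprz_gt0 //.
  rewrite expr_div_n mulrA ler_pdivlMr ?exprn_gt0 // -mulrA mulrC.
  by rewrite ler_wpM2r ?exprn_ge0.
apply/ler_addgt0Pr => e e0; have [n1 _ hn1] := cf e e0.
have h1 := hn1 (N + n1)%N (leq_addl _ _).
have h2 := tail n1.
set s := series _ (N + n1)%N in h2; rewrite /= -/s in h1.
have := nmB (s - S) (s - f t); have -> : s - S - (s - f t) = f t - S by ring.
lra.
Qed.

(** The OPE axiom starts its series at an unspecified [m0]. Shifting the index by [|J - m0|] makes
    it start at the order [J] below which the coefficients are known to vanish. *)
Lemma laurent_expansion (b : int -> C) (m0 J : int) f n :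
  (forall m, m < m0 -> b m = 0) -> (forall m, m < J -> b m = 0) ->
  (\forall t \near (0 : C)^',
     series (fun k : nat => t ^ (m0 + k%:Z) * b (m0 + k%:Z)) @ \oo --> f t) ->
  exists M : R, \forall t \near (0 : C)^',
    nm (f t - \sum_(k < n) t ^ (J + k%:Z) * b (J + k%:Z)) <= M * nm t ^ (J + n%:Z).
Proof.
move=> b0 bJ h; apply: (@laurent_remainder (fun k => b (J + k%:Z))).
have sh (u v : nat -> C) j : (forall k, (k < j)%N -> u k = 0) ->
    (forall k, u (j + k)%N = v k) -> forall k, series u (k + j)%N = series v k.
  move=> u0 uv k; rewrite series_addn [series u j]big_nat big1 ?add0r => [|i /andP[_ /u0] //].
  rewrite -{1}(add0n j) big_addn addnK; apply: eq_bigr => i _.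
  by rewrite addnC uv.
apply: filterS h => t h.
have [mJ|Jm] := leP m0 J.
  have e : m0 + `|J - m0|%N%:Z = J by lia.
  rewrite -(cvg_shiftn `|J - m0|%N) in h.
  rewrite (_ : series _ = (fun k => series (fun k : nat => t ^ (m0 + k%:Z) * b (m0 + k%:Z)) (k + `|J - m0|)%N)) //.
  apply/funext => k; apply/esym/sh => i.
    by move=> hi; rewrite bJ ?mulr0 //; lia.
  by rewrite PoszD addrA e.
have e : J + `|m0 - J|%N%:Z = m0 by lia.
rewrite -(cvg_shiftn `|m0 - J|%N).
rewrite (_ : [sequence _]_k = series (fun k : nat => t ^ (m0 + k%:Z) * b (m0 + k%:Z))) //.
apply/funext => k; apply/sh => i.
  by move=> hi; rewrite b0 ?mulr0 //; lia.
by rewrite PoszD addrA e.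
Qed.

End Laurent.

(** * Neighbourhoods on the surface and in charts *)

Section Charts.
Variable R : realType.
Local Notation C := (Cplx R).
Variable X : riemann_surface R.
Implicit Types (z w : chart R X) (P Q : X).

Lemma near_neq P0 Q : P0 <> Q -> \forall P \near P0, P <> Q.
Proof.
move=> PQ; have cQ : closed [set Q].
  exact/accessible_closed_set1/hausdorff_accessible/surf_hausdorff.
apply: (@open_nbhs_nbhs _ P0 (~` [set Q])); split; last by [].
by rewrite openC.
Qed.

Lemma near_notin_points P0 (s : seq X) : P0 \notin s -> \forall P \near P0, P \notin s.
Proof.
elim: s => [|Q s IH]; first by move=> _; apply: nearW.
rewrite inE negb_or => /andP[/eqP PQ /IH h].
near=> P; rewrite inE negb_or; apply/andP; split; last by near: P.
by apply/eqP; near: P; exact: near_neq.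
Unshelve. all: by end_near. Qed.

Lemma param_near z P0 (A : set X) : dom z P0 ->
  (\forall P \near P0, A P) ->
  \forall t \near coord z P0,
    [/\ A (param z t), dom z (param z t) & coord z (param z t) = t].
Proof.
move=> zP hA.
have im : (coord z @` dom z) (coord z P0) by exists P0.
have hc := param_cont im; rewrite /prop_for /continuous_at coordK // in hc.
have h1 := hc _ hA.
have h2 : \forall t \near coord z P0, (coord z @` dom z) t.
  by apply: (@open_nbhs_nbhs C _ (coord z @` dom z)); split; [exact: codom_open|].
apply: cnearS2 h1 h2 => t h1 [P zP' e]; split => //; rewrite -e ?coordK //.
Qed.

Lemma param_near0 z P0 (A : set X) : dom z P0 ->
  (\forall P \near P0, A P) ->
  \forall t \near (0 : C),
    [/\ A (param z (coord z P0 + t)), dom z (param z (coord z P0 + t))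
      & coord z (param z (coord z P0 + t)) = coord z P0 + t].
Proof.
move=> zP /(param_near zP) /nm_nbhs[d d0 h]; apply/nm_nbhs; exists d => // t.
by rewrite subr0 => ht; apply: h; rewrite addrC addKr.
Qed.

Lemma param_dnear0 z P0 (A : set X) : dom z P0 ->
  (\forall P \near P0^', A P) ->
  \forall t \near (0 : C)^', A (param z (coord z P0 + t)).
Proof.
move=> zP; rewrite {1}/dnbhs /within /= => /(param_near0 zP) /nm_nbhs[d d0 h].
apply/nm_dnbhs; exists d => // t t0 /h [+ _ e]; apply.
apply/negP => /eqP e'; move: e; rewrite e' => /eqP.
by rewrite addrC -subr_eq subrr eq_sym (negbTE t0).
Qed.

Lemma coord_near z P0 (A : set C) : dom z P0 ->
  (\forall t \near coord z P0, A t) -> \forall P \near P0, A (coord z P).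
Proof. by move=> zP hA; exact: (coord_cont zP). Qed.

Lemma dom_near z P0 : dom z P0 -> \forall P \near P0, dom z P.
Proof. by move=> zP; apply: (@open_nbhs_nbhs _ _ (dom z)); split; [exact: dom_open|]. Qed.

End Charts.

(** * Taylor and OPE expansions of correlation functions *)

Section StateExpansions.
Variable R : realType.
Local Notation C := (Cplx R).
Variables (F : cft R) (X : riemann_surface R) (B : field_bundle F X).
Variable corr : seq (insertion B) -> C.
Hypothesis hcorr : is_state corr.
Implicit Types (z w : chart R X) (P Q : X) (u v : F) (s : seq (insertion B)).

Lemma corr_ins0 z P s : uniq (P :: points s) -> corr (ins B z P 0 :: s) = 0.
Proof.
move=> us; rewrite /ins linear0.
have := state_linear hcorr 1 (0 : fib B P) 0 us.
rewrite scale1r addr0 mul1r => /eqP.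
by rewrite -subr_eq subrr => /eqP/esym.
Qed.

Lemma corr_insZ z P s (k : C) u : uniq (P :: points s) ->
  corr (ins B z P (k *: u) :: s) = k * corr (ins B z P u :: s).
Proof.
move=> us; rewrite /ins linearZ /=.
have := state_linear hcorr k (triv B z P u) 0 us.
rewrite addr0 => ->; have := corr_ins0 z us; rewrite /ins linear0 => ->.
by rewrite addr0.
Qed.

Lemma corr_swap (i j : insertion B) s : uniq (points (i :: j :: s)) ->
  corr (i :: j :: s) = corr (j :: i :: s).
Proof.
move=> us; apply: (state_sym hcorr us).
by apply/seq.permP => a /=; rewrite addnCA.
Qed.

Definition local_corr z u s (t : C) : C := corr (ins B z (param z t) u :: s).

Lemma local_corrE z u s P : dom z P -> local_corr z u s (coord z P) = corr (ins B z P u :: s).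
Proof. by move=> zP; rewrite /local_corr coordK. Qed.

Lemma local_corr_continuous z P0 u s : atlas z -> dom z P0 ->
  uniq (P0 :: points s) -> {for coord z P0, continuous (local_corr z u s)}.
Proof.
move=> az zP us; have [h _] := state_deriv hcorr u az zP us.
by apply: differentiable_continuous; exact/derivable1_diffP.
Qed.

(* The OPE of a field with the identity is its Taylor expansion. *)
Lemma local_corr_taylor z P0 u s : atlas z -> dom z P0 -> uniq (P0 :: points s) ->
  exists (a2 : C) (M : R), \forall t \near (0 : C)^',
    nm (local_corr z u s (coord z P0 + t)
      - (local_corr z u s (coord z P0) + t * corr (ins B z P0 (dfield u) :: s)
         + t ^+ 2 * a2)) <= M * nm t ^+ 3.
Proof.
move=> az zP us.
have /andP[Ps us'] : (P0 \notin points s) && uniq (points s) by [].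
have [m0 [hm0 hser]] := state_ope hcorr u (fone F) az zP us.
pose b m := corr (ins B z P0 (ope m u (fone F)) :: s).
have b0 m : m < 0 -> b m = 0.
  by move=> m0'; rewrite /b ope_fone // corr_ins0.
have bm0 m : m < m0 -> b m = 0.
  by move=> mm; rewrite /b hm0 // corr_ins0.
have hs : \forall t \near (0 : C)^',
   series (fun k : nat => t ^ (m0 + k%:Z) * b (m0 + k%:Z)) @ \oo
     --> local_corr z u s (coord z P0 + t).
  have h1 := param_dnear0 zP hser.
  have h2 := param_near0 zP (near_notin_points Ps).
  move/nm_dnbhs: h1 => [d d0 h1]; move/nm_nbhs: h2 => [d' d'0 h2].
  apply/nm_dnbhs; exists (Num.min d d'); first by rewrite lt_min d0.
  move=> t t0; rewrite lt_min => /andP[/(h1 _ t0) + /h2[Pt zt et]].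
  rewrite et (_ : coord z P0 + t - coord z P0 = t); last by ring.
  have tP : param z (coord z P0 + t) != P0.
    apply/negP => /eqP e'; move: et; rewrite e' => /eqP.
    by rewrite addrC -subr_eq subrr eq_sym (negbTE t0).
  rewrite corr_swap; last by rewrite /= inE negb_or tP Pt Ps us'.
  rewrite (state_fone hcorr az zP) //.
  by rewrite /= inE negb_or eq_sym tP Pt Ps us'.
have [M hM] := laurent_expansion 3 bm0 b0 hs.
have {}hM : \forall t \near (0 : C)^',
  nm (local_corr z u s (coord z P0 + t) - (b 0 + t * b 1 + t ^+ 2 * b 2)) <= M * nm t ^+ 3.
  apply: filterS hM => t; rewrite !big_ord_recr big_ord0 /= !add0r.
  by rewrite expr0z mul1r expr1z -!exprnP.
(* The series speaks of [t != 0] only, and its constant term involves [ope 0 u (fone F)]. Continuity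
   at [P0], a consequence of [state_deriv], identifies it with the value for [u] itself. *)
suff e0 : b 0 = local_corr z u s (coord z P0) by exists (b 2), M; rewrite -e0.
apply/eqP; rewrite -subr_eq0 -nm_eq0; apply/eqP/le_anti; rewrite nm_ge0 andbT.
apply/ler_addgt0Pr => e e_gt0; rewrite add0r.
have /nm_continuousP /(_ _ (divr_gt0 e_gt0 (ltr0n R 2))) /nm_nbhs[d d0 hd] :=
  @local_corr_continuous z P0 u s az zP us.
move/nm_dnbhs: hM => [d' d'0 hd'].
pose K := nm (b 1) + nm (b 2) + `|M| + 1.
have K0 : 0 < K by rewrite /K; have := normr_ge0 M; have := nm_ge0 (b 1); have := nm_ge0 (b 2); lra.
pose r := Num.min (Num.min d d' / 2) (Num.min 1 (e / 2 / K)).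
have dd : 0 < Num.min d d' by rewrite lt_min d0.
have r0 : 0 < r by rewrite /r !(lt_min _ (_ / 2)) lt_min ltr01 !divr_gt0.
have rd : r < Num.min d d'.
  have : r <= Num.min d d' / 2 by rewrite /r ge_min lexx.
  lra.
move: rd; rewrite lt_min => /andP[rd rd'].
have r1 : r <= 1 by rewrite /r !ge_min lexx orbT.
have rK : r * K <= e / 2 by rewrite -ler_pdivlMr // /r !ge_min lexx !orbT.
have nr : nm (ofR r : C) = r by rewrite nm_ofR gtr0_norm.
have t0 : (ofR r : C) != 0 by rewrite -nm_gt0 nr.
have h1 := hd (coord z P0 + ofR r); rewrite (_ : _ + _ - _ = ofR r) in h1; last by ring.
rewrite nr in h1; have {}h1 := h1 rd.
have h2 := hd' _ t0; rewrite subr0 nr in h2; have {}h2 := h2 rd'.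
set f1 := local_corr _ _ _ (_ + _) in h1 h2.
set f0 := local_corr _ _ _ _ in h1 *.
have -> : b 0 - f0 = (f1 - f0) - (f1 - (b 0 + ofR r * b 1 + ofR r ^+ 2 * b 2))
    - ofR r * b 1 - ofR r ^+ 2 * b 2 by ring.
have g1 := nmB (f1 - f0) (f1 - (b 0 + ofR r * b 1 + ofR r ^+ 2 * b 2)).
have g2 := nmB ((f1 - f0) - (f1 - (b 0 + ofR r * b 1 + ofR r ^+ 2 * b 2))) (ofR r * b 1).
apply: le_trans (nmB _ _) _; rewrite nmM nr in g2; rewrite nmM nmX nr.
have r2 : r ^+ 2 <= r by rewrite expr2 ler_piMr // ltW.
have r3 : M * r ^+ 3 <= `|M| * r.
  apply: le_trans (ler_norm _) _; rewrite normrM ler_wpM2l // (ger0_norm (exprn_ge0 3 (ltW r0))).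
  by rewrite exprS ler_piMr // ?(le_trans r2) // ltW.
have := ler_wpM2r (nm_ge0 (b 2)) r2.
by rewrite /K in rK; nra.
Qed.

Lemma local_corr_expands2 z P0 u s : atlas z -> dom z P0 -> uniq (P0 :: points s) ->
  expands2 (local_corr z u s) (coord z P0).
Proof.
move=> az zP us; have [a2 [M hM]] := local_corr_taylor u az zP us.
set f := local_corr _ _ _ in hM *; set x0 := coord _ _ in hM *.
set b1 := corr _ in hM *.
(* At [t = 0] this divides by zero and is 0, for which the expansion and the bound hold
   trivially. *)
pose rho t := (f (x0 + t) - (f x0 + t * b1 + t ^+ 2 * a2)) / t ^+ 3.
exists b1, a2, rho, (Num.max M 0).
move/nm_dnbhs: hM => [d d0 hM]; apply/nm_nbhs; exists d => // t ht.
have [->|t0] := eqVneq t 0.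
  split; first by rewrite addr0 !expr0n /= !mulr0 !addr0.
  by rewrite /rho !expr0n /= invr0 mulr0 nm0 le_max lexx orbT.
split; first by rewrite /rho; field; exact: t0.
have t3 : 0 < nm t ^+ 3 by rewrite exprn_gt0 // nm_gt0.
rewrite /rho nmM nmV nmX ler_pdivrMr //; apply: le_trans (hM _ t0 ht) _.
by apply: ler_wpM2r; [exact: ltW | rewrite le_max lexx].
Qed.

Lemma virasoro_local_ope (T : F) c z Q : is_virasoro T c -> atlas z -> dom z Q ->
  exists M : R, \forall t \near (0 : C)^',
    nm (local_corr z T [:: ins B z Q T] (coord z Q + t)
      - (c / 2 * corr [::] / t ^+ 4 + 2 * corr [:: ins B z Q T] / t ^+ 2
         + corr [:: ins B z Q (dfield T)] / t)) <= M.
Proof.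
move=> hT az zQ.
have us : uniq (Q :: points ([::] : seq (insertion B))) by [].
have [m0 [hm0 hser]] := state_ope hcorr T T az zQ us.
pose b m := corr [:: ins B z Q (ope m T T)].
have b0 m : m < - 4 -> b m = 0.
  move=> m4; rewrite /b (ope_degree_neg (vir_dim hT) (vir_dim hT)) ?corr_ins0 //.
  by lia.
have bm0 m : m < m0 -> b m = 0.
  by move=> mm; rewrite /b hm0 // corr_ins0.
have hs : \forall t \near (0 : C)^',
   series (fun k : nat => t ^ (m0 + k%:Z) * b (m0 + k%:Z)) @ \oo
     --> local_corr z T [:: ins B z Q T] (coord z Q + t).
  have h1 := param_dnear0 zQ hser.
  have h2 := param_near0 zQ (dom_near zQ).
  move/nm_dnbhs: h1 => [d d0 h1]; move/nm_nbhs: h2 => [d' d'0 h2].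
  apply/nm_dnbhs; exists (Num.min d d'); first by rewrite lt_min d0.
  move=> t t0; rewrite lt_min => /andP[/(h1 _ t0) + /h2[_ zt et]].
  by rewrite et (_ : coord z Q + t - coord z Q = t); last by ring.
have [M hM] := laurent_expansion 4 bm0 b0 hs.
exists M; apply: filterS hM => t.
rewrite !big_ord_recr big_ord0 /= !add0r.
rewrite (_ : -4 + 1%:Z = -3) // (_ : -4 + 2%:Z = -2) // (_ : -4 + 3%:Z = -1) //.
rewrite (_ : -4 + 0%:Z = -4) // (_ : -4 + 4%:Z = 0) // expr0z mulr1.
have -> : b (-4) = c / 2 * corr [::].
  by rewrite /b (vir_ope4 hT) corr_insZ // (state_fone hcorr az zQ).
have -> : b (-3) = 0 by rewrite /b (vir_ope3 hT) corr_ins0.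
have -> : b (-2) = 2 * corr [:: ins B z Q T] by rewrite /b (vir_ope2 hT) corr_insZ.
have -> : b (-1) = corr [:: ins B z Q (dfield T)] by rewrite /b (vir_ope1 hT).
rewrite mulr0 addr0 (_ : t ^ (-4) = t ^- 4) // (_ : t ^ (-2) = t ^- 2) //.
by rewrite (_ : t ^ (-1) = t^-1) // ![_^-1 * _]mulrC.
Qed.

End StateExpansions.

(** * Expansions of polynomials and of square roots *)

Section MoreExpansions.
Variable R : realType.
Local Notation C := (Cplx R).
Implicit Types (f g : C -> C) (x t : C).

Lemma expands2_poly (A : {poly C}) x0 : expands2 (fun x => A.[x]) x0.
Proof.
elim/poly_ind: A => [|A a IH].
  by apply: expands2_eq (expands2_cst 0 x0); apply: cnearW => x; rewrite horner0.
apply: expands2_eq (expands2D (expands2M IH (expands2_id x0)) (expands2_cst a x0)).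
by apply: cnearW => x; rewrite !hornerE.
Qed.

(** Let [s] be the quadratic polynomial whose square agrees with [g] up to order 2. Then (f - s)(f +
    s) is of third order, and [f + s] stays away from 0 because the continuity of [f] fixes the
    branch. *)
Lemma expands2_sqrt f g x0 : f x0 != 0 -> {for x0, continuous f} ->
  (\forall x \near x0, f x ^+ 2 = g x) -> expands2 g x0 -> expands2 f x0.
Proof.
move=> f0 /nm_continuousP cf fg [a1 [a2 [r [M h]]]].
have n0 : 0 < nm (f x0) by rewrite nm_gt0.
have f00 : f x0 ^+ 2 = g x0.
  by move/nm_nbhs: fg => [d d0]; apply; rewrite subrr nm0.
pose b := a1 / (2 * f x0); pose c := (a2 - b ^+ 2) / (2 * f x0).
pose s t := f x0 + b * t + c * t ^+ 2.
pose rho t := (r t - 2 * b * c - c ^+ 2 * t) / (f (x0 + t) + s t).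
exists b, c, rho, ((M + nm (2 * b * c) + nm (c ^+ 2)) / nm (f x0)).
have /nm_nbhs[d d0 hd] := cf _ (divr_gt0 n0 (ltr0n R 2)).
have h1 : \forall t \near (0 : C), nm (f (x0 + t) - f x0) < nm (f x0) / 2.
  apply/nm_nbhs; exists d => // t; rewrite subr0 => ht; apply: hd.
  by rewrite (_ : x0 + t - x0 = t) //; ring.
have h2 : \forall t \near (0 : C), f (x0 + t) ^+ 2 = g (x0 + t).
  move/nm_nbhs: fg => [d' d'0 fg]; apply/nm_nbhs; exists d' => // t; rewrite subr0 => ht; apply: fg.
  by rewrite (_ : x0 + t - x0 = t) //; ring.
have k0 : 0 < nm (f x0) / 2 / (nm b + nm c + 1).
  by rewrite !divr_gt0 //; have := nm_ge0 b; have := nm_ge0 c; lra.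
apply: cnearS3 (@filterI _ (nbhs (0 : C)) _ _ _ h h1) h2
  (@filterI _ (nbhs (0 : C)) _ _ _ (near0_le k0) (near0_le ltr01)) => t [[gt rM] ft] ff [tk t1].
have hs : nm (s t - f x0) <= nm (f x0) / 2.
  rewrite (_ : s t - f x0 = b * t + c * t ^+ 2); last by rewrite /s; ring.
  apply: le_trans (nmD _ _) _; rewrite 2!nmM nmX.
  have t2 : nm t ^+ 2 <= nm t by rewrite expr2 ler_piMr.
  move: tk; rewrite ler_pdivlMr; last by have := nm_ge0 b; have := nm_ge0 c; lra.
  have := ler_wpM2l (nm_ge0 c) t2; have := nm_ge0 t; nra.
have hfs : nm (f x0) <= nm (f (x0 + t) + s t).
  have := nmB_ge (2 * f x0) ((f x0 - f (x0 + t)) + (f x0 - s t)).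
  have := nmD (f x0 - f (x0 + t)) (f x0 - s t).
  rewrite (nmC _ (f (x0 + t))) (nmC _ (s t)) nmM nm_nat.
  rewrite (_ : 2 * f x0 - _ = f (x0 + t) + s t); last by ring.
  lra.
have fs0 : f (x0 + t) + s t != 0 by rewrite -nm_gt0; apply: lt_le_trans hfs.
have e : (f (x0 + t) - s t) * (f (x0 + t) + s t) = (r t - 2 * b * c - c ^+ 2 * t) * t ^+ 3.
  have -> : (f (x0 + t) - s t) * (f (x0 + t) + s t) = f (x0 + t) ^+ 2 - s t ^+ 2 by ring.
  by rewrite ff gt -f00 /s /c /b; field.
split.
  rewrite (_ : f x0 + b * t + c * t ^+ 2 = s t) // -[LHS](subrK (s t)) addrC; congr (_ + _).
  by apply: (mulIf fs0); rewrite e /rho; field.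
rewrite /rho nmM nmV; apply: ler_pM => //; first by rewrite invr_ge0.
  have ct : nm (c ^+ 2 * t) <= nm (c ^+ 2) by rewrite nmM ler_piMr.
  have := nmB (r t - 2 * b * c) (c ^+ 2 * t); have := nmB (r t) (2 * b * c); lra.
by rewrite lef_pV2 // posrE // nm_gt0.
Qed.

End MoreExpansions.

(** * The affine curve: sheets, conjugate points, traces and properness of x *)

Section Curve.
Variable R : realType.
Local Notation C := (Cplx R).
Variables (X : riemann_surface R) (p : {poly C}) (H : hyperelliptic X p).
Implicit Types (P Q : X) (phi : X -> C).
Local Notation x := (xcoord H).
Local Notation y := (ycoord H).
Local Notation oo := (infpt H).

Definition pt (a b : C) : X := xget oo [set P | [/\ P <> oo, x P = a & y P = b]].

Lemma ptP a b : b ^+ 2 = p.[a] -> [/\ pt a b <> oo, x (pt a b) = a & y (pt a b) = b].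
Proof. by move=> /(curve_surj H)[P hP]; rewrite /pt; case: xgetP => [Q _ //|/(_ P)]. Qed.

Lemma pt_eq P a b : P <> oo -> x P = a -> y P = b -> pt a b = P.
Proof.
move=> Pf xP yP; have [|h1 h2 h3] := @ptP a b; first by rewrite -yP curve_eq // xP.
by apply: (curve_inj (h := H)) => //; rewrite ?h2 ?h3.
Qed.

Definition invol P := pt (x P) (- y P).

Lemma involP P : P <> oo -> [/\ invol P <> oo, x (invol P) = x P & y (invol P) = - y P].
Proof. by move=> Pf; apply: ptP; rewrite sqrrN curve_eq. Qed.

Lemma same_x P Q : P <> oo -> Q <> oo -> x P = x Q -> P = Q \/ P = invol Q.
Proof.
move=> Pf Qf e; have /eqP : y P ^+ 2 = y Q ^+ 2 by rewrite !curve_eq // e.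
rewrite eqf_sqr => /orP[/eqP h|/eqP h]; first by left; exact: curve_inj e h.
by right; apply/esym/pt_eq.
Qed.

Lemma y_eq0 P : P <> oo -> (y P == 0) = (p.[x P] == 0).
Proof. by move=> Pf; rewrite -(curve_eq Pf) expf_eq0. Qed.

Lemma generic_invol P : generic H P -> generic H (invol P).
Proof. by move=> [Pf px]; have [h1 h2 _] := involP Pf; split; rewrite ?h2. Qed.

(** [sqrtC] chooses one of the two points over [a], possibly discontinuously; the sum does not
    depend on the choice. *)
Definition trace phi (a : C) : C :=
  phi (pt a (sqrtC p.[a])) + phi (pt a (- sqrtC p.[a])).

Lemma traceE phi P : P <> oo -> trace phi (x P) = phi P + phi (invol P).
Proof.
move=> Pf; have /eqP : y P ^+ 2 = (sqrtC p.[x P]) ^+ 2 by rewrite sqrtCK curve_eq.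
rewrite eqf_sqr /trace /invol => /orP[/eqP e|/eqP e].
  by rewrite -e (pt_eq Pf).
by rewrite addrC -e (pt_eq Pf) // e opprK.
Qed.

Lemma pt_over a : exists P, P <> oo /\ x P = a.
Proof.
have [|h1 h2 _] := @ptP a (sqrtC p.[a]); first exact: sqrtCK.
by exists (pt a (sqrtC p.[a])).
Qed.

Lemma x_near P0 (A : set C) : P0 <> oo -> (\forall t \near x P0, A t) ->
  \forall P \near P0, A (x P).
Proof. by move=> Pf hA; exact: (xcoord_cont Pf). Qed.

Lemma y_near P0 (A : set C) : P0 <> oo -> (\forall t \near y P0, A t) ->
  \forall P \near P0, A (y P).
Proof. by move=> Pf hA; exact: (ycoord_cont Pf). Qed.

Lemma nm_near (a : C) (e : R) : 0 < e -> \forall t \near a, nm (t - a) < e.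
Proof. by move=> e0; apply/nm_nbhs; exists e. Qed.

Lemma x_large (M : R) : \forall P \near oo, P <> oo -> M < nm (x P).
Proof.
have [z [az zo z0 hz]] := infchartP H.
pose K := Num.max M 1.
have K1 : 1 <= K by rewrite le_max lexx orbT.
have K0 : 0 < K by lra.
have Ki : 0 < K^-1 by rewrite invr_gt0.
have h1 := coord_near zo (nm_near (coord z oo) Ki); rewrite z0 in h1.
apply: filterS2 (dom_near zo) h1 => P zP; rewrite /= subr0 => hP Pf; have [xP e] := hz P zP Pf.
have e1 : nm (coord z P) ^+ 2 = (nm (x P))^-1 by rewrite -nmX e nmV.
have : (nm (x P))^-1 < K^-1.
  rewrite -e1 expr2; have := nm_ge0 (coord z P); have : K^-1 <= 1 by rewrite invf_le1.
  nra.
rewrite ltf_pV2 ?posrE ?nm_gt0 //; apply: le_lt_trans.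
by rewrite le_max lexx.
Qed.

(** By compactness of [X]: near any finite point [x] is bounded, so there the claim for [N] is
    vacuous once [N] is large, and the point at infinity is covered by the hypothesis. *)
Lemma proper_at_infty (A : set X) : (\forall P \near oo, A P) ->
  exists M : R, forall P, P <> oo -> M <= nm (x P) -> A P.
Proof.
move=> hA.
have /compact_near_coveringP cov := curve_compact H.
have [] := @cov nat \oo (fun N P => P <> oo -> N%:R <= nm (x P) -> A P) _.
  move=> P _; have [->|/eqP Pf] := eqVneq P oo.
    exists (A, setT) => /=; first by split; [exact: hA|exact: filterT].
    by move=> [Q N] [/= hQ _].
  exists ([set Q | nm (x Q - x P) < 1], [set N | (Num.bound (nm (x P) + 1) <= N)%N]) => /=.
    split; first by exact: (x_near Pf (nm_near (x P) (@ltr01 R))).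
    by exists (Num.bound (nm (x P) + 1)).
  move=> [Q N] [/= hQ hN] Qf hx; exfalso.
  have b : nm (x P) + 1 < (Num.bound (nm (x P) + 1))%:R.
    by apply: archi_boundP; rewrite addr_ge0.
  have : (Num.bound (nm (x P) + 1))%:R <= N%:R :> R by rewrite ler_nat.
  by have := nmB_ge (x Q) (x P); lra.
move=> N _ hN; exists N%:R => P Pf hP.
by apply: (hN N) => //=.
Qed.

(** Compactness again: at a point outside the fibre, including infinity, |x - x0| is locally bounded
    below by some [d], and the claim for [N] is vacuous there once [N > 1/d]. *)
Lemma proper_at (x0 : C) (A : set X) :
  (forall P0, P0 <> oo -> x P0 = x0 -> \forall P \near P0, A P) ->
  \forall t \near x0, forall P, P <> oo -> x P = t -> A P.
Proof.
move=> hA.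
have /compact_near_coveringP cov := curve_compact H.
have [] := @cov nat \oo (fun N P => P <> oo -> nm (x P - x0) * N%:R < 1 -> A P) _.
  have far (d : R) P : 0 < d -> (\forall Q \near P, Q <> oo -> d <= nm (x Q - x0)) ->
     \forall Q \near P & N \near \oo, Q <> oo -> nm (x Q - x0) * N%:R < 1 -> A Q.
    move=> d0 hd.
    exists ([set Q | Q <> oo -> d <= nm (x Q - x0)], [set N | (Num.bound d^-1 <= N)%N]) => /=.
      by split => //; exists (Num.bound d^-1).
    move=> [Q N] [/= hQ hN] Qf hx; exfalso.
    have b : d^-1 < (Num.bound d^-1)%:R by apply: archi_boundP; rewrite invr_ge0 ltW.
    have b2 : (Num.bound d^-1)%:R <= N%:R :> R by rewrite ler_nat.
    have : 1 < d * N%:R by rewrite -ltr_pdivrMl // mulr1; lra.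
    by have := hQ Qf; have : 0 <= N%:R :> R by []; nra.
  move=> P _; have [->|/eqP Pf] := eqVneq P oo.
    apply: (far 1) => //; apply: filterS (x_large (nm x0 + 1)) => Q hQ Qf.
    by have := nmB_ge (x Q) x0; have := hQ Qf; lra.
  have [e|xP] := eqVneq (x P) x0.
    exists (A, setT) => /=; first by split; [exact: hA|exact: filterT].
    by move=> [Q N] [/= hQ _].
  have d0 : 0 < nm (x P - x0) / 2 by rewrite divr_gt0 // nm_gt0 subr_eq0.
  apply: (far _ _ d0); apply: filterS (x_near Pf (nm_near (x P) d0)) => Q hQ _.
  have := nmB_ge (x P - x0) (x P - x Q); rewrite (nmC (x P) (x Q)).
  by rewrite (_ : x P - x0 - (x P - x Q) = x Q - x0); [lra|ring].
move=> N _ hN; apply/nm_nbhs; exists (N.+1%:R^-1); first by rewrite invr_gt0.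
move=> t ht P Pf xP; apply: (hN N.+1) => //=.
by rewrite xP mulrC -ltr_pdivlMl // mulr1.
Qed.

(** The local inverse of [x] through a generic point [P0], that is, the sheet of [P0]. *)
Definition sect P0 (t : C) : X := param (xchart H P0) t.

Lemma coord_xchart P0 : generic H P0 -> coord (xchart H P0) P0 = x P0.
Proof. by move=> [Pf px]; have [_ zP /(_ _ zP)[]] := xchartP Pf px. Qed.

Lemma sect_near P0 (A : set X) : generic H P0 -> (\forall P \near P0, A P) ->
  \forall t \near x P0, [/\ A (sect P0 t), dom (xchart H P0) (sect P0 t),
     sect P0 t <> oo & x (sect P0 t) = t].
Proof.
move=> gP hA; have [Pf px] := gP; have [az zP hz] := xchartP Pf px.
have := param_near zP hA; rewrite coord_xchart //.
apply: cnearS => t [At zt et]; split => //; first by have [] := hz _ zt.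
by have [_ <-] := hz _ zt.
Qed.

Lemma sectK P0 : generic H P0 -> sect P0 (x P0) = P0.
Proof.
move=> gP; have [Pf px] := gP; have [az zP hz] := xchartP Pf px.
by rewrite /sect -(coord_xchart gP) coordK.
Qed.

Lemma sect_y_expands2 P0 : generic H P0 -> expands2 (fun t => y (sect P0 t)) (x P0).
Proof.
move=> gP; have [Pf px] := gP.
apply: (@expands2_sqrt _ _ (fun t => p.[t])).
- by rewrite sectK // y_eq0.
- apply/nm_continuousP => e e0; rewrite sectK //.
  have := sect_near gP (y_near Pf (nm_near (y P0) e0)).
  by apply: cnearS => t [].
- apply: cnearS (sect_near gP (nearW _ (fun=> I))) => t [_ _ sf st].
  by rewrite curve_eq // st.
- exact: expands2_poly.
Qed.

(** The two sections have [y] close to [y P0] and to [- y P0]. So they differ, and over each [t]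
    they make up the whole fibre. *)
Lemma trace_sect phi P0 : generic H P0 ->
  \forall t \near x P0, trace phi t = phi (sect P0 t) + phi (sect (invol P0) t).
Proof.
move=> gP; have [Pf px] := gP; have gI := generic_invol gP.
have [If xI yI] := involP Pf.
have y0 : 0 < nm (y P0) by rewrite nm_gt0 y_eq0.
have h1 := sect_near gP (y_near Pf (nm_near (y P0) y0)).
have h2 := sect_near gI (y_near If (nm_near (y (invol P0)) y0)).
rewrite xI yI in h2.
apply: cnearS2 h1 h2 => t [h1 _ sf st] [h2 _ sf' st'].
have [e|e] := same_x sf sf' (etrans st (esym st')).
  rewrite e in h1; exfalso.
  have := nmB (y (sect (invol P0) t) - - y P0) (y (sect (invol P0) t) - y P0).
  rewrite (_ : _ - _ - (_ - _) = 2 * y P0) ?nmM ?nm_nat; last by ring.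
  lra.
by rewrite -[in LHS]st' traceE // -e addrC.
Qed.

Lemma trace_expands2 phi P0 : generic H P0 ->
  expands2 (fun t => phi (sect P0 t)) (x P0) ->
  expands2 (fun t => phi (sect (invol P0) t)) (x P0) ->
  expands2 (trace phi) (x P0).
Proof.
move=> gP h1 h2; apply: expands2_eq (expands2D h1 h2).
by apply: cnearS (trace_sect phi gP) => t ->.
Qed.

(** By properness, the points over [t] close to [x0] are close to [P0] or to its conjugate; bounds
    near these two points suffice. *)
Lemma trace_bounded_at phi (x0 : C) :
  (forall P0, P0 <> oo -> x P0 = x0 ->
     exists M : R, \forall P \near P0, P <> oo -> x P <> x0 -> nm (phi P) <= M) ->
  bounded_at (trace phi) x0.
Proof.
move=> hb; have [P0 [Pf xP]] := pt_over x0.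
have [If xI yI] := involP Pf.
have [M hM] := hb _ Pf xP; have [N hN] := hb _ If (etrans xI xP).
have M0 : M <= Num.max M N by rewrite le_max lexx.
have N0 : N <= Num.max M N by rewrite le_max lexx orbT.
pose A P := x P <> x0 -> nm (phi P) <= Num.max M N.
have /nm_nbhs[d d0 hd] : \forall t \near x0, forall P, P <> oo -> x P = t -> A P \/ P = oo.
  apply: (@proper_at x0 (fun P => A P \/ P = oo)) => Q Qf xQ.
  have [->|->] := same_x Qf Pf (etrans xQ (esym xP)).
    apply: filterS hM => P h; have [->|/eqP Pf'] := eqVneq P oo; [by right|left].
    by move=> /(h Pf') /le_trans; apply.
  apply: filterS hN => P h; have [->|/eqP Pf'] := eqVneq P oo; [by right|left].
  by move=> /(h Pf') /le_trans; apply.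
exists (Num.max M N + Num.max M N); apply/nm_dnbhs; exists d => // t t0 ht.
have [Q [Qf xQ]] := pt_over t; have [IQ xIQ _] := involP Qf.
rewrite -xQ traceE //; apply: le_trans (nmD _ _) _.
apply: lerD.
  by case: (hd t ht Q Qf xQ) => [h|//]; apply: h; rewrite xQ; exact/eqP.
by case: (hd t ht (invol Q) IQ (etrans xIQ xQ)) => [h|//]; apply: h; rewrite xIQ xQ; exact/eqP.
Qed.

End Curve.

Lemma nearI (Y : topologicalType) (y0 : Y) (A B : set Y) :
  (\forall t \near y0, A t) -> (\forall t \near y0, B t) -> \forall t \near y0, A t /\ B t.
Proof. exact: filterI. Qed.

(** * Complex derivatives and Schwarzians *)

Section ComplexDerivatives.
Variable R : realType.
Local Notation C := (Cplx R).
Implicit Types (f g : C -> C) (u t : C).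

Definition has_deriv f u (l : C) := is_derive u (1 : C) f l.

Lemma has_deriv_cst (a u : C) : has_deriv (fun=> a) u 0.
Proof. exact: is_derive_cst. Qed.

Lemma has_deriv_id u : has_deriv id u 1.
Proof. exact: is_derive_id. Qed.

Lemma has_derivD f g u a b : has_deriv f u a -> has_deriv g u b ->
  has_deriv (fun t => f t + g t) u (a + b).
Proof. by move=> hf hg; exact: (is_deriveD hf hg). Qed.

Lemma has_derivM f g u a b : has_deriv f u a -> has_deriv g u b ->
  has_deriv (fun t => f t * g t) u (f u * b + g u * a).
Proof. by move=> hf hg; exact: (is_deriveM hf hg). Qed.

Lemma has_derivV f u a : f u != 0 -> has_deriv f u a ->
  has_deriv (fun t => (f t)^-1) u (- a / f u ^+ 2).
Proof.
move=> fu [df fa]; apply: DeriveDef; first exact: derivableV.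
by rewrite deriveV // fa /GRing.scale /= mulrC mulrN mulNr.
Qed.

Lemma has_deriv_near f g u a : (\forall t \near u, f t = g t) ->
  has_deriv f u a -> has_deriv g u a.
Proof. exact: near_eq_is_derive. Qed.

Lemma has_deriv_horner (A : {poly C}) f u a : has_deriv f u a ->
  has_deriv (fun t => A.[f t]) u (A^`().[f u] * a).
Proof.
move=> hf; elim/poly_ind: A => [|A c IH].
  rewrite deriv0 horner0 mul0r.
  by apply: has_deriv_near (has_deriv_cst 0 u); apply: cnearW => t; rewrite horner0.
have := has_derivD (has_derivM IH hf) (has_deriv_cst c u).
move=> h; rewrite derivMXaddC !hornerE.
have -> : (A.[f u] + A^`().[f u] * f u) * a = A.[f u] * a + f u * (A^`().[f u] * a) + 0 by ring.
by apply: has_deriv_near h; apply: cnearW => t; rewrite !hornerE.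
Qed.

Lemma has_deriv_pow n u : has_deriv (fun t => t ^+ n) u (n%:R * u ^+ n.-1).
Proof.
have := has_deriv_horner 'X^n (has_deriv_id u).
rewrite derivXn hornerMn hornerXn mulr1 -mulr_natl => h; apply: has_deriv_near h.
by apply: cnearW => t; rewrite hornerXn.
Qed.

Lemma has_deriv_invpow n u : u != 0 ->
  has_deriv (fun t => t ^- n.+1) u (- n.+1%:R * u ^- n.+2).
Proof.
move=> u0; have := @has_derivV (fun t => t ^+ n.+1) u _ (expf_neq0 n.+1 u0) (has_deriv_pow n.+1 u).
have -> // : - (n.+1%:R * u ^+ n.+1.-1) / (u ^+ n.+1) ^+ 2 = - n.+1%:R * u ^- n.+2.
by rewrite /= !exprS; field; rewrite u0 expf_neq0.
Qed.

Lemma has_derivE f u a : has_deriv f u a -> derive1 f u = a.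
Proof. by move=> [_ <-]; rewrite derive1E. Qed.

Lemma has_deriv_continuous f u a : has_deriv f u a -> {for u, continuous f}.
Proof. by move=> [h _]; apply: differentiable_continuous; exact/derivable1_diffP. Qed.

Lemma derivable_has_deriv f u : derivable f u 1 -> has_deriv f u (derive1 f u).
Proof. by move=> h; rewrite derive1E; exact/derivableP. Qed.

Lemma has_deriv_unique f u a b : has_deriv f u a -> has_deriv f u b -> a = b.
Proof. by move=> /has_derivE <- /has_derivE. Qed.

Lemma near_nbhs_near u (A : set C) : (\forall t \near u, A t) ->
  \forall t \near u, \forall s \near t, A s.
Proof.
move=> /nm_nbhs[d d0 h]; apply/nm_nbhs; exists d => // t ht.
apply/nm_nbhs; exists (d - nm (t - u)); first by rewrite subr_gt0.
move=> s hs; apply: h; have := nmD (s - t) (t - u).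
by rewrite addrA subrK; lra.
Qed.

Lemma derive1_near f g u : (\forall t \near u, f t = g t) -> derive1 f u = derive1 g u.
Proof. by move=> fg; rewrite !derive1E; exact: near_eq_derive. Qed.

Lemma derive1n_near n f g u : (\forall t \near u, f t = g t) ->
  derive1n n f u = derive1n n g u.
Proof.
elim: n f g u => [|n IH] f g u fg.
  by move/nm_nbhs: fg => [d d0]; apply; rewrite subrr nm0.
rewrite !derive1nS; apply: derive1_near; apply: cnearS (near_nbhs_near fg) => t.
exact: IH.
Qed.

Lemma schwarzian_near f g u : (\forall t \near u, f t = g t) ->
  schwarzian f u = schwarzian g u.
Proof. by move=> fg; rewrite /schwarzian !(derive1n_near _ fg) (derive1_near fg). Qed.

Lemma schwarzian_id u : schwarzian id u = 0.
Proof.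
have d1 t : derive1 (@id C) t = 1 by exact/has_derivE/has_deriv_id.
have d2 t : derive1n 2 (@id C) t = 0.
  rewrite derive1nS (_ : derive1n 1 id = fun=> 1); last by apply/funext => s; exact: d1.
  exact/has_derivE/has_deriv_cst.
rewrite /schwarzian d2 derive1nS (_ : derive1n 2 id = fun=> 0); last exact/funext.
rewrite (has_derivE (has_deriv_cst 0 u)) /=.
by rewrite mul0r expr0n /= mulr0 mul0r subr0.
Qed.

(** This is the transition from the coordinate u at infinity to x = u^-2. *)
Lemma schwarzian_invsqr u : u != 0 ->
  schwarzian (fun t => t ^- 2) u = - (3 / 2) * u ^- 2.
Proof.
move=> u0.
have nz : \forall t \near u, t != 0.
  apply/nm_nbhs; exists (nm u); first by rewrite nm_gt0.
  move=> t ht; apply/negP => /eqP e; move: ht.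
  by rewrite e sub0r nmN ltxx.
have step n (a : C) : {in [pred t : C | t != 0], forall t,
    derive1 (fun s : C => a * s ^- n.+1) t = a * (- n.+1%:R * t ^- n.+2)}.
  move=> t; rewrite inE => t0; apply: has_derivE.
  by have := has_derivM (has_deriv_cst a t) (has_deriv_invpow n t0); rewrite mulr0 addr0.
have d1 t : t != 0 -> derive1 (fun t : C => t ^- 2) t = - 2 * t ^- 3.
  by move=> t0; exact: (has_derivE (has_deriv_invpow 1 t0)).
have d2 t : t != 0 -> derive1n 2 (fun t : C => t ^- 2) t = 6 * t ^- 4.
  move=> t0; rewrite derive1nS.
  rewrite (@derive1_near _ (fun t : C => - 2 * t ^- 3)); first by rewrite (step 2%N) //; ring.
  apply/nm_nbhs; exists (nm t); first by rewrite nm_gt0.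
  move=> s hs; rewrite derive1n1 d1 //; apply/negP => /eqP e; move: hs.
  by rewrite e sub0r nmN ltxx.
have d3 : derive1n 3 (fun t : C => t ^- 2) u = - 24 * u ^- 5.
  rewrite derive1nS.
  rewrite (@derive1_near _ (fun t : C => 6 * t ^- 4)); first by rewrite (step 3%N) //; ring.
  by apply: cnearS nz => t; exact: d2.
rewrite /schwarzian d3 d2 // d1 //.
by field.
Qed.

End ComplexDerivatives.

(** * Local behaviour of the one-point and the connected two-point functions *)

Section TwoPoint.
Variable R : realType.
Local Notation C := (Cplx R).
Variables (X : riemann_surface R) (p : {poly C}) (H : hyperelliptic X p).
Variables (F : cft R) (T : F) (c : C) (hT : is_virasoro T c).
Variables (B : field_bundle F X) (corr : seq (insertion B) -> C).
Hypothesis hcorr : is_state corr.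
Hypothesis hcov : virasoro_covariant T c corr.
Hypothesis h1 : corr [::] <> 0.
Implicit Types (P Q : X) (s : seq (insertion B)) (z w : chart R X).
Local Notation x := (xcoord H).
Local Notation y := (ycoord H).
Local Notation oo := (infpt H).
Local Notation e := (corr [::]).

Definition T1 P := corr [:: Tx H B T P].
Definition T2 P Q := corr [:: Tx H B T P; Tx H B T Q].

(* The transition from a chart around P to the coordinate x, which near P is
   independent of the choice of [xchart H P]. *)
Lemma transition_x z P : atlas z -> dom z P -> generic H P ->
  [/\ derivable (transition z (xchart H P)) (coord z P) 1,
      transition z (xchart H P) (coord z P) = x P &
      \forall t \near coord z P, [/\ dom z (param z t), coord z (param z t) = t,
         param z t <> oo & transition z (xchart H P) t = x (param z t)]].
Proof.
move=> az zP gP; have [Pf px] := gP; have [aw wP hw] := xchartP Pf px.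
split.
- by have [] := atlas_compatible az aw zP wP.
- by rewrite /transition /= coordK // coord_xchart.
- have := param_near zP (dom_near wP).
  by apply: cnearS => t [/hw[tf xt] zt et].
Qed.

(** Both charts have coordinate [x], so their transition is locally the identity, of derivative 1
    and Schwarzian 0. *)
Lemma Tx_chart P0 P s : generic H P0 -> generic H P -> dom (xchart H P0) P ->
  uniq (P :: points s) ->
  corr (Tx H B T P :: s) = corr (ins B (xchart H P0) P T :: s).
Proof.
move=> gP0 gP zP us; have [Pf px] := gP; have [aw wP hw] := xchartP Pf px.
have [Pf0 px0] := gP0; have [az zP0 hz] := xchartP Pf0 px0.
have [_ _ tr] := transition_x az zP gP.
have {}tr : \forall t \near coord (xchart H P0) P, t = transition (xchart H P0) (xchart H P) t.
  apply: cnearS tr => t [zt et tf ->]; rewrite -{1}et.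
  by have [_ ->] := hz _ zt.
have := hcov az aw zP wP us.
rewrite -(schwarzian_near tr) -(derive1_near tr) schwarzian_id.
by rewrite (has_derivE (has_deriv_id _)) expr1n mulr1 mulr0 mul0r subr0.
Qed.

Lemma generic_near P0 : generic H P0 -> \forall P \near P0, generic H P.
Proof.
move=> gP; have [Pf px] := gP; have [az zP hz] := xchartP Pf px.
have h : \forall t \near x P0, p.[t] != 0.
  have /expands2_continuous /nm_continuousP := expands2_poly p (x P0).
  have n0 : 0 < nm p.[x P0] by rewrite nm_gt0.
  move=> /(_ _ n0); apply: cnearS => t ht; apply/negP => /eqP pt0; move: ht.
  by rewrite pt0 sub0r nmN ltxx.
apply: filterS2 (dom_near zP) (x_near Pf h) => P zP' px'.
by split => //; have [] := hz _ zP'.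
Qed.

Lemma corr_sect s P0 : generic H P0 -> uniq (P0 :: points s) ->
  \forall t \near x P0, corr (Tx H B T (sect H P0 t) :: s) = local_corr corr (xchart H P0) T s t.
Proof.
move=> gP /andP[Ps us].
have h := sect_near gP (nearI (generic_near gP) (near_notin_points Ps)).
apply: cnearS h => t [[gt nt] zt _ _].
by rewrite (Tx_chart gP gt zt) //; apply/andP.
Qed.

Lemma corr_sect_expands2 s P0 : generic H P0 -> uniq (P0 :: points s) ->
  expands2 (fun t => corr (Tx H B T (sect H P0 t) :: s)) (x P0).
Proof.
move=> gP us; have [Pf px] := gP; have [az zP hz] := xchartP Pf px.
have := local_corr_expands2 hcorr T az zP us; rewrite coord_xchart //.
by apply: expands2_eq; apply: cnearS (corr_sect gP us) => t ->.
Qed.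

Lemma TTc_expands2 P0 Q : generic H P0 -> P0 <> Q ->
  expands2 (fun t => TTc H T corr (sect H P0 t) Q) (x P0).
Proof.
move=> gP PQ; rewrite /TTc.
apply: expands2B; apply: expands2M; try exact: expands2_cst.
  by apply: corr_sect_expands2 => //=; rewrite inE andbT; apply/eqP.
apply: expands2M; last exact: expands2_cst.
exact: corr_sect_expands2.
Qed.

Definition connected_ins i Q := e^-1 * corr [:: i; Tx H B T Q] - e ^- 2 * (corr [:: i] * T1 Q).

(* The Schwarzian terms cancel in connected correlators. *)
Lemma connected_covariant z P Q : atlas z -> dom z P -> generic H P -> P <> Q ->
  TTc H T corr P Q * derive1 (transition z (xchart H P)) (coord z P) ^+ 2
  = connected_ins (ins B z P T) Q.
Proof.
move=> az zP gP PQ; have [Pf px] := gP; have [aw wP hw] := xchartP Pf px.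
have us : uniq (P :: points [:: Tx H B T Q]) by rewrite /= inE andbT; apply/eqP.
have := hcov az aw zP wP us; have := hcov az aw zP wP (isT : uniq (P :: points [::])).
set d2 := _ ^+ 2 => c1 c2.
have e0 : e != 0 by apply/eqP.
rewrite /connected_ins /TTc -/(T1 Q).
transitivity (e^-1 * (corr [:: Tx H B T P; Tx H B T Q] * d2)
   - e ^- 2 * ((corr [:: Tx H B T P] * d2) * T1 Q)); first by ring.
by rewrite c1 c2 -/(T1 Q); field.
Qed.

Lemma connected_bounded z P0 Q : atlas z -> dom z P0 -> P0 <> Q ->
  exists M : R, \forall P \near P0, nm (connected_ins (ins B z P T) Q) <= M.
Proof.
move=> az zP PQ.
have k1 : {for coord z P0, continuous (local_corr corr z T [::])}.
  exact: local_corr_continuous.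
have k2 : {for coord z P0, continuous (local_corr corr z T [:: Tx H B T Q])}.
  by apply: local_corr_continuous => //=; rewrite inE andbT; apply/eqP.
have l1 := coord_near zP ((nm_continuousP _ _).1 k1 1 ltr01).
have l2 := coord_near zP ((nm_continuousP _ _).1 k2 1 ltr01).
set a := local_corr corr z T [::] (coord z P0) in l1.
set b := local_corr corr z T [:: Tx H B T Q] (coord z P0) in l2.
exists (nm e^-1 * (nm b + 1) + nm (e ^- 2) * ((nm a + 1) * nm (T1 Q))).
apply: filterS3 l1 l2 (dom_near zP) => P; rewrite /= => l1 l2 zP'.
rewrite !local_corrE // in l1 l2.
apply: le_trans (nmB _ _) _; rewrite nmM (nmM (e ^- 2)) (nmM (corr _)).
apply: lerD; first apply: ler_wpM2l => //.
  by have := nmD (corr [:: ins B z P T; Tx H B T Q] - b) b; rewrite subrK; lra.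
apply: ler_wpM2l => //; apply: ler_wpM2r => //.
by have := nmD (corr [:: ins B z P T] - a) a; rewrite subrK; lra.
Qed.

(** Near a branch point y is a coordinate, and y^2 = p(x) gives p'(x) dx/dy = 2 y, hence (dx/dy)^2 =
    4 p / p'^2. Covariance thus turns the product with p into [p'^2 / 4] times the connected
    correlator in the coordinate y, which is bounded. *)
Lemma TTc_bounded_branch P0 Q : P0 <> oo -> p.[x P0] = 0 -> p^`().[x P0] != 0 ->
  generic H Q ->
  exists M : R, \forall P \near P0, generic H P ->
    nm (TTc H T corr P Q * p.[x P]) <= M.
Proof.
move=> Pf p0 dp0 gQ.
have [z [az zP hz]] := ychartP Pf dp0.
have PQ : P0 <> Q by move=> PQ; move: gQ => [_]; rewrite -PQ p0 eqxx.
have [M hM] := connected_bounded az zP PQ.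
have /expands2_continuous /nm_continuousP /(_ 1 ltr01) := expands2_poly p^`() (x P0).
move=> /(x_near Pf) hd.
have n0 : 0 < nm p^`().[x P0] by rewrite nm_gt0.
have /expands2_continuous /nm_continuousP /(_ _ n0) := expands2_poly p^`() (x P0).
move=> /(x_near Pf) hd0.
exists (Num.max M 0 * (nm p^`().[x P0] + 1) ^+ 2).
apply: filterS3 (nearI hM (near_neq PQ)) (nearI hd hd0) (dom_near zP).
move=> P [hM' PQ'] [hd' hd0'] zP' gP.
have [Pf' px] := gP; rewrite /= in hd' hd0'.
have dp : p^`().[x P] != 0.
  by apply/negP => /eqP h; move: hd0'; rewrite h sub0r nmN ltxx.
have [dt te tr] := transition_x az zP' gP.
have yP : y P != 0 by rewrite y_eq0.
have D := derivable_has_deriv dt; set d := derive1 _ _ in D.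
have eD : p^`().[x P] * d = 2 * y P.
  have h2 := has_deriv_horner p D; rewrite te in h2.
  have h3 := has_deriv_pow 2 (coord z P); rewrite expr1 in h3.
  have [_ yE] := hz _ zP'; rewrite yE in h3.
  apply: (has_deriv_unique h2); rewrite yE; apply: has_deriv_near h3.
  rewrite -yE; apply: cnearS tr => t [zt et tf ->].
  by rewrite -curve_eq //; have [_ <-] := hz _ zt; rewrite et.
have dE : d = 2 * y P / p^`().[x P] by rewrite -eD; field.
have := connected_covariant az zP' gP PQ'; rewrite -/d => cc.
have -> : TTc H T corr P Q * p.[x P] = connected_ins (ins B z P T) Q * (p^`().[x P] ^+ 2 / 4).
  by rewrite -cc dE -(curve_eq Pf'); field.
rewrite nmM; apply: ler_pM => //; first by apply: le_trans hM' _; rewrite le_max lexx.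
rewrite nmM nmV nm_nat nmX.
have : nm p^`().[x P] <= nm p^`().[x P0] + 1.
  by have := nmD (p^`().[x P] - p^`().[x P0]) p^`().[x P0]; rewrite subrK; lra.
move=> h; have := ler_pM (nm_ge0 _) (nm_ge0 _) h h; rewrite -!expr2.
by have := sqr_ge0 (nm p^`().[x P]); lra.
Qed.

Lemma infinity_chart : exists z, [/\ atlas z, dom z oo &
  \forall P \near oo, generic H P ->
    [/\ dom z P, coord z P != 0, x P = coord z P ^- 2,
      derive1 (transition z (xchart H P)) (coord z P) = - 2 * coord z P ^- 3 &
      schwarzian (transition z (xchart H P)) (coord z P) = - (3 / 2) * coord z P ^- 2]].
Proof.
have [z [az zo z0 hz]] := infchartP H; exists z; split => //.
apply: filterS (dom_near zo) => P zP gP; have [Pf px] := gP.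
have [xP ex] := hz P zP Pf.
have u0 : coord z P != 0.
  by apply/negP => /eqP h; move: ex; rewrite h expr0n /= => /esym/eqP; rewrite invr_eq0 (negbTE xP).
have xE : x P = coord z P ^- 2 by rewrite ex invrK.
have [dt te tr] := transition_x az zP gP.
have {}tr : \forall t \near coord z P, t ^- 2 = transition z (xchart H P) t.
  apply: cnearS tr => t [zt et tf ->].
  by have [_] := hz _ zt tf; rewrite et => ->; rewrite invrK.
split => //.
  rewrite -(derive1_near tr); exact: (has_derivE (has_deriv_invpow 1 u0)).
by rewrite -(schwarzian_near tr) schwarzian_invsqr.
Qed.

(** For x = u^-2 the square of dx/du is 4 x^3. *)
Lemma TTc_infinity Q : generic H Q ->
  exists K : R, \forall P \near oo, generic H P ->
    nm (TTc H T corr P Q) <= K * nm (x P) ^- 3.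
Proof.
move=> [Qf qx]; have [z [az zo hz]] := infinity_chart.
have oQ : oo <> Q by move=> h; apply: Qf.
have [M hM] := connected_bounded az zo oQ.
exists (Num.max M 0).
apply: filterS3 hz hM (near_neq oQ) => P hz hM' PQ gP.
have [zP u0 xE dE _] := hz gP.
have := connected_covariant az zP gP PQ; rewrite dE => cc.
have -> : TTc H T corr P Q = connected_ins (ins B z P T) Q * (x P ^- 3 / 4).
  by rewrite -cc xE; field.
rewrite nmM; apply: ler_pM => //; first by apply: le_trans hM' _; rewrite le_max lexx.
rewrite nmM nmV nmX nmV nm_nat; have : 0 <= (nm (x P) ^+ 3)^-1 by rewrite invr_ge0 exprn_ge0.
lra.
Qed.

(** In the one-point function the Schwarzian survives: - (c/12) times - (3/2) u^-2, divided by
    (dx/du)^2 = 4 u^-6, is c/32 x^-2. *)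
Lemma T1_infinity :
  exists K : R, \forall P \near oo, generic H P ->
    nm (T1 P - c / 32 * e * x P ^- 2) <= K * nm (x P) ^- 3.
Proof.
have [z [az zo hz]] := infinity_chart.
have k1 : {for coord z oo, continuous (local_corr corr z T [::])}.
  exact: local_corr_continuous.
have l1 := coord_near zo ((nm_continuousP _ _).1 k1 1 ltr01).
set a := local_corr corr z T [::] (coord z oo) in l1.
exists (nm a + 1).
apply: filterS3 hz l1 (dom_near zo) => P hz; rewrite /= => l2 zP' gP.
rewrite local_corrE // in l2.
have [zP u0 xE dE sE] := hz gP.
have [Pf px] := gP; have [aw wP hw] := xchartP Pf px.
have := hcov az aw zP wP (_ : uniq (P :: points [::])).
rewrite dE sE => /(_ isT) cc.
have -> : T1 P - c / 32 * e * x P ^- 2 = corr [:: ins B z P T] * (x P ^- 3 / 4).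
  have -> : corr [:: ins B z P T] = T1 P * (- 2 * coord z P ^- 3) ^+ 2
     + c / 12 * (- (3 / 2) * coord z P ^- 2) * e by rewrite cc; ring.
  by rewrite xE; field.
rewrite nmM; apply: ler_pM => //.
  by have := nmD (corr [:: ins B z P T] - a) a; rewrite subrK; lra.
rewrite nmM nmV nmX nmV nm_nat; have : 0 <= (nm (x P) ^+ 3)^-1 by rewrite invr_ge0 exprn_ge0.
lra.
Qed.

(** Taylor expansion of the one-point function at [Q] turns the terms 2 T(w) / d^2 and T'(w) / d of
    the OPE into the symmetric (T(z) + T(w)) / d^2 up to a bounded error. The disconnected part is
    bounded near [Q]. *)
Lemma TTc_ope Q : generic H Q ->
  exists M : R, \forall t \near (x Q)^',
    nm (e * TTc H T corr (sect H Q t) Q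
        - (c / 2 * e / (t - x Q) ^+ 4 + (T1 (sect H Q t) + T1 Q) / (t - x Q) ^+ 2)) <= M.
Proof.
move=> gQ; have [Qf qx] := gQ; have [az zQ hz] := xchartP Qf qx.
have [M1 hM1] := virasoro_local_ope hcorr hT az zQ.
have [a2 [M2 hM2]] := local_corr_taylor hcorr T az zQ (isT : uniq (Q :: points [::])).
have hs := corr_sect gQ (isT : uniq (Q :: points [::])).
have hb := expands2_bounded_at (corr_sect_expands2 gQ (isT : uniq (Q :: points [::]))).
have hn := sect_near gQ (generic_near gQ).
move: hb => [M3 /nm_dnbhs[d3 d30 hb]].
move/nm_nbhs: hs => [d4 d40 hs]; move/nm_nbhs: hn => [d5 d50 hn].
move/nm_dnbhs: hM1 => [d1 d10 hM1]; move/nm_dnbhs: hM2 => [d2 d20 hM2].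
pose M := M1 + (nm a2 + `|M2|) + nm e^-1 * M3 * nm (T1 Q).
exists M; apply/nm_dnbhs.
exists (Num.min (Num.min 1 d1) (Num.min (Num.min d2 d3) (Num.min d4 d5))).
  by rewrite !lt_min ltr01 d10 d20 d30 d40 d50.
move=> t tQ; rewrite !lt_min => /andP[/andP[t1 td1] /andP[/andP[td2 td3] /andP[td4 td5]]].
set d := t - x Q in t1 td1 td2 *.
have d0 : d != 0 by rewrite subr_eq0.
have xd : x Q + d = t by rewrite /d addKB.
have := hM1 d d0; rewrite subr0 => /(_ td1) {}hM1.
have := hM2 d d0; rewrite subr0 => /(_ td2) {}hM2.
have {hb} := hb t tQ td3; rewrite -/(T1 _) => hb.
have {hs} := hs t td4; rewrite -/(T1 _) => hs.
have [gt zt tf xt] := hn t td5.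
rewrite coord_xchart // xd in hM1 hM2.
rewrite -(coord_xchart gQ) local_corrE // -hs in hM2.
rewrite -/(Tx H B T Q) -/(T1 Q) in hM1 hM2.
have st : local_corr corr (xchart H Q) T [:: Tx H B T Q] t = T2 (sect H Q t) Q.
  rewrite /T2 (Tx_chart gQ gt zt) //= inE andbT; apply/negP => /eqP h.
  by move: xt; rewrite h => e'; rewrite /d e' subrr eqxx in d0.
rewrite -/(Tx H B T Q) st in hM1.
set D := corr [:: _ ] in hM1 hM2.
set U := T1 (sect H Q t) in hb hM2 *.
set V := T2 _ _ in hM1.
have e0 : e != 0 by apply/eqP.
have -> : e * TTc H T corr (sect H Q t) Q - (c / 2 * e / d ^+ 4 + (U + T1 Q) / d ^+ 2)
  = (V - (c / 2 * e / d ^+ 4 + 2 * T1 Q / d ^+ 2 + D / d))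
    - ((U - (T1 Q + d * D + d ^+ 2 * a2)) / d ^+ 2 + a2) - e^-1 * U * T1 Q.
  rewrite /TTc -/(T2 (sect H Q t) Q) -/V -/(T1 (sect H Q t)) -/U -/(T1 Q).
  by field; rewrite d0 e0.
apply: le_trans (nmB _ _) _; apply: lerD; last first.
  by rewrite nmM nmM ler_wpM2r // ler_wpM2l.
apply: le_trans (nmB _ _) _; apply: lerD => //.
apply: le_trans (nmD _ _) _; rewrite addrC lerD2l nmM nmV nmX.
have nd : 0 < nm d by rewrite nm_gt0.
rewrite ler_pdivrMr ?exprn_gt0 //; apply: le_trans hM2 _.
rewrite exprS mulrA; apply: ler_wpM2r; first by rewrite exprn_ge0.
apply: le_trans (ler_norm _) _; rewrite normrM ler_piMr // ger0_norm // ltW //.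
Qed.

End TwoPoint.

(** * Algebra of the singular part on the diagonal *)

Section SingularPart.
Variable R : realType.
Local Notation C := (Cplx R).
Implicit Types (A D p q : {poly C}) (b x t : C).

(* The polynomial in x1 obtained from [A(x1 x2) + (x1 + x2)/2 D(x1 x2)] by
   setting x2 = b. *)
Definition mix b A D : {poly C} :=
  (A \Po (b *: 'X)) + 2^-1 *: (('X + b%:P) * (D \Po (b *: 'X))).

Lemma mix_horner b A D x :
  (mix b A D).[x] = A.[b * x] + 2^-1 * ((x + b) * D.[b * x]).
Proof. by rewrite /mix !(hornerE, horner_comp). Qed.

Lemma deriv_mix b A D :
  (mix b A D)^`() = mix b (b *: A^`() + 2^-1 *: D) (b *: D^`()).
Proof.
rewrite /mix derivD derivZ derivM derivD derivX derivC addr0 !deriv_comp.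
rewrite derivZ derivX comp_polyD !comp_polyZ mul1r.
by rewrite -!mul_polyC; ring.
Qed.

Definition splitp A D : {poly C} := (A \Po 'X^2) + (D \Po 'X^2) * 'X.

Lemma splitp_horner A D x : (splitp A D).[x] = A.[x ^+ 2] + D.[x ^+ 2] * x.
Proof. by rewrite /splitp !(hornerE, horner_comp). Qed.

Lemma deriv_splitp A D :
  (splitp A D)^`() = splitp (D + 2 *: ('X * D^`())) (2 *: A^`()).
Proof.
rewrite /splitp derivD derivM !deriv_comp derivXn derivX comp_polyD !comp_polyZ.
rewrite comp_polyM comp_polyX -!mul_polyC polyC_natr /=; ring.
Qed.

(** As a function of x, the factor of y1 y2 in the pole of order 4. At [b] its value is p(b) and its
    derivative p'(b)/2, the same as for y(x) y(b) on the same sheet. *)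
Definition qmix p b := mix b (even_poly p) (odd_poly p).

(** Collects all terms of [Rsing] with factor (c/32) y1 y2 <1>. For an even polynomial A(x^2), first
    derivative over x and second derivative add up to 4 (A' + t A'') at t = x^2; for the part D
    multiplied by (x1 + x2)/2, the weight 3 of the first derivative gives 4 (2 D' + t D''). *)
Definition rmix p b :=
  mix b (4 *: ((even_poly p)^`() + 'X * (even_poly p)^`(2)))
    (4 *: (2 *: (odd_poly p)^`() + 'X * (odd_poly p)^`(2))).

Lemma even_poly_compX2 A : even_poly (A \Po 'X^2) = A.
Proof.
apply/polyP => i; rewrite coef_even_poly coef_comp_poly_Xn //.
by rewrite dvdn2 odd_double /= -muln2 mulnK.
Qed.

Lemma at_sqrt_comp A t : at_sqrt (A \Po 'X^2) t = A.[t].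
Proof. by rewrite /at_sqrt even_poly_compX2. Qed.

Lemma at_sqrt_deriv_over_x A t : at_sqrt (deriv_over_x (A \Po 'X^2)) t = 2 * A^`().[t].
Proof.
rewrite /deriv_over_x deriv_comp derivXn /=.
have -> : (A^`() \Po 'X^2) * ('X *+ 2) = ((2 *: A^`()) \Po 'X^2) * 'X.
  by rewrite comp_polyZ -mul_polyC polyC_natr; ring.
by rewrite mulpK ?polyX_eq0 // at_sqrt_comp hornerZ.
Qed.

Lemma at_sqrt_deriv2 A t :
  at_sqrt (A \Po 'X^2)^`(2) t = 2 * A^`().[t] + 4 * t * A^`(2).[t].
Proof.
have -> : (A \Po 'X^2)^`(2) = (2 *: A^`() + 4 *: ('X * A^`(2))) \Po 'X^2.
  rewrite comp_polyD !comp_polyZ comp_polyM comp_polyX !derivnS !derivn0.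
  rewrite deriv_comp derivM deriv_comp derivXn derivMn /= expr1 derivX -!mul_polyC.
  by rewrite !polyC_natr; ring.
by rewrite at_sqrt_comp !hornerE /=; ring.
Qed.

Lemma RsingE p Th1 Thy (c e x1 y1 x2 y2 : C) :
  Rsing p Th1 Thy c e x1 y1 x2 y2 =
  c / 4 * e * ((p.[x1] * p.[x2] + y1 * y2 * (qmix p x2).[x1]) / (x1 - x2) ^+ 4)
  + c / 32 * e * ((p^`().[x1] * p^`().[x2] + y1 * y2 * (rmix p x2).[x1]) / (x1 - x2) ^+ 2)
  + 1 / 8 * ((p.[x1] * Theta Th1 Thy x2 y2 + p.[x2] * Theta Th1 Thy x1 y1) / (x1 - x2) ^+ 2)
  + 1 / 8 * (y1 * Thy.[x2] + y2 * Thy.[x1]) * ((qmix p x2).[x1] / (x1 - x2) ^+ 2)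
  + 1 / 4 * (y1 * y2) * ((qmix Th1 x2).[x1] / (x1 - x2) ^+ 2).
Proof.
rewrite /Rsing /evenpart /xpart !at_sqrt_comp !at_sqrt_deriv_over_x !at_sqrt_deriv2.
rewrite /qmix /rmix !mix_horner !hornerZ !hornerD !hornerZ !hornerM !hornerX.
rewrite (mulrC x2 x1).
move: (even_poly p)^`().[_] (even_poly p)^`(2).[_] (odd_poly p)^`().[_]
  (odd_poly p)^`(2).[_] (even_poly p).[_] (odd_poly p).[_] (even_poly Th1).[_]
  (odd_poly Th1).[_] p.[x1] p.[x2] p^`().[x1] p^`().[x2] (Theta _ _ x1 y1)
  (Theta _ _ x2 y2) Thy.[x1] Thy.[x2].
move=> A1 A2 D1 D2 A0 D0 A0' D0' p1 p2 p1' p2' t1 t2 g1 g2.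
(* On the diagonal both sides are 0, by division by zero. *)
have [->|ne] := eqVneq x1 x2; first by rewrite subrr !expr0n /= invr0; ring.
have : x1 - x2 != 0 by rewrite subr_eq0.
by move: (x1 - x2) => d d0; field.
Qed.

Lemma double_root A b : A.[b] = 0 -> A^`().[b] = 0 ->
  exists D, A = ('X - b%:P) ^+ 2 * D.
Proof.
move=> A0 A1; have /factor_theorem[D AE] : root A b by apply/rootP.
have D0 : D.[b] = 0.
  by move: A1; rewrite AE derivM derivXsubC !hornerE subrr mulr0 add0r.
have /factor_theorem[D' DE] : root D b by apply/rootP.
by exists D'; rewrite AE DE; ring.
Qed.

Lemma polysplit p : p = splitp (even_poly p) (odd_poly p).
Proof. by rewrite /splitp poly_even_odd. Qed.

Lemma qmix_diag p b : (qmix p b).[b] = p.[b].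
Proof. by rewrite {2}(polysplit p) mix_horner splitp_horner -expr2; field. Qed.

Lemma deriv_qmix_diag p b : (qmix p b)^`().[b] = p^`().[b] / 2.
Proof.
rewrite {2}(polysplit p) /qmix deriv_mix deriv_splitp mix_horner splitp_horner.
by rewrite !hornerE /= -expr2; field.
Qed.

Lemma deriv2M A D : (A * D)^`(2) = A^`(2) * D + 2 *: (A^`() * D^`()) + A * D^`(2).
Proof. by rewrite !derivnS !derivn0 !(derivD, derivM) -mul_polyC polyC_natr; ring. Qed.

Lemma deriv3M A D : (A * D)^`(3) =
  A^`(3) * D + 3 *: (A^`(2) * D^`()) + 3 *: (A^`() * D^`(2)) + A * D^`(3).
Proof.
by rewrite !derivnS !derivn0 !(derivD, derivM) -!mul_polyC !polyC_natr; ring.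
Qed.

(** [p.[b] *: p - q ^+ 2] has a double zero at [b]. The second and third derivatives of (x - b)^2 K
    at [b] are 2 K(b) and 6 K'(b), so K is known there to first order, which is what [qr_factor]
    requires. *)
Lemma sqr_factor p q b : q.[b] = p.[b] -> q^`().[b] = p^`().[b] / 2 ->
  exists K : {poly C},
  [/\ p.[b] *: p - q ^+ 2 = ('X - b%:P) ^+ 2 * K,
      2 * K.[b] = p^`(2).[b] * p.[b] - 2 * (p^`().[b] / 2) ^+ 2
                  - 2 * p.[b] * q^`(2).[b] &
      6 * K^`().[b] = p^`(3).[b] * p.[b] - 3 * p^`().[b] * q^`(2).[b]
                  - 2 * p.[b] * q^`(3).[b]].
Proof.
move=> q0 q1.
have [||K KE] := @double_root (p.[b] *: p - q ^+ 2) b.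
- by rewrite !hornerE /= q0; ring.
- by rewrite derivB derivZ expr2 derivM !hornerE /= q0 q1; field.
have g0 : ('X - b%:P).[b] = 0 by rewrite hornerXsubC subrr.
have g2 : ('X - b%:P)^`(2) = 0 by rewrite derivnS derivn1 derivXsubC -polyC1 derivC.
have g3 : ('X - b%:P)^`(3) = 0 by rewrite derivnS g2 deriv0.
move: ('X - b%:P) g0 (derivXsubC b) g2 g3 KE => g g0 g1 g2 g3 KE.
exists K; split => //.
  have : (p.[b] *: p - q * q)^`(2).[b] = (g * (g * K))^`(2).[b].
    by rewrite -expr2 KE expr2 mulrA.
  rewrite derivnB derivnZ !deriv2M derivM g2 g1.
  rewrite !(hornerD, hornerN, hornerM, hornerZ, hornerC, horner0) g0 q0 q1 => h.
  apply/eqP; rewrite -subr_eq0; move/eqP: h; rewrite -subr_eq0 => /eqP h.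
  by apply/eqP; rewrite -[RHS]oppr0 -h; field.
have : (p.[b] *: p - q * q)^`(3).[b] = (g * (g * K))^`(3).[b].
  by rewrite -expr2 KE expr2 mulrA.
rewrite derivnB derivnZ !deriv3M !deriv2M derivM g3 g2 g1.
rewrite !(hornerD, hornerN, hornerM, hornerZ, hornerC, horner0) g0 q0 q1 => h.
apply/eqP; rewrite -subr_eq0; move/eqP: h; rewrite -subr_eq0 => /eqP h.
by apply/eqP; rewrite -[RHS]oppr0 -h; field.
Qed.

Lemma qmix_deriv2 p b : (qmix p b)^`(2).[b] =
  b ^+ 2 * (even_poly p)^`(2).[b ^+ 2] + b * (odd_poly p)^`().[b ^+ 2]
  + b ^+ 3 * (odd_poly p)^`(2).[b ^+ 2].
Proof.
rewrite /qmix !derivnS !derivn0 !deriv_mix mix_horner.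
rewrite !(derivD, derivZ) !(hornerD, hornerZ) /= -expr2.
by field.
Qed.

Lemma qmix_deriv3 p b : (qmix p b)^`(3).[b] =
  b ^+ 3 * (even_poly p)^`(3).[b ^+ 2] + 3 / 2 * b ^+ 2 * (odd_poly p)^`(2).[b ^+ 2]
  + b ^+ 4 * (odd_poly p)^`(3).[b ^+ 2].
Proof.
rewrite /qmix !derivnS !derivn0 !deriv_mix mix_horner.
rewrite !(derivD, derivZ) !(hornerD, hornerZ) /= -expr2.
by field.
Qed.

(** On the opposite sheet y1 y2 is close to - q. There the pole of order 4 leaves about (c/8) K /
    d^2, and with (c/32)(p1' p2' - q r) / d^2 the numerator becomes c/32 times the polynomial below.
    Its double zero is the reason for the derivative terms of [Rsing]. *)
Lemma qr_factor p b (K : {poly C}) :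
  2 * K.[b] = p^`(2).[b] * p.[b] - 2 * (p^`().[b] / 2) ^+ 2
              - 2 * p.[b] * (qmix p b)^`(2).[b] ->
  6 * K^`().[b] = p^`(3).[b] * p.[b] - 3 * p^`().[b] * (qmix p b)^`(2).[b]
              - 2 * p.[b] * (qmix p b)^`(3).[b] ->
  exists U : {poly C},
    4 *: K + p^`().[b] *: p^`() - qmix p b * rmix p b = ('X - b%:P) ^+ 2 * U.
Proof.
rewrite qmix_deriv2 qmix_deriv3.
have := qmix_diag p b; have := deriv_qmix_diag p b.
have r0 : (rmix p b).[b] = 4 * (even_poly p)^`().[b ^+ 2]
   + 4 * b ^+ 2 * (even_poly p)^`(2).[b ^+ 2] + 8 * b * (odd_poly p)^`().[b ^+ 2]
   + 4 * b ^+ 3 * (odd_poly p)^`(2).[b ^+ 2].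
  rewrite /rmix mix_horner !hornerE /= -expr2; by field.
have r1 : (rmix p b)^`().[b] = 8 * b * (even_poly p)^`(2).[b ^+ 2]
   + 4 * b ^+ 3 * (even_poly p)^`(3).[b ^+ 2] + 4 * (odd_poly p)^`().[b ^+ 2]
   + 14 * b ^+ 2 * (odd_poly p)^`(2).[b ^+ 2] + 4 * b ^+ 4 * (odd_poly p)^`(3).[b ^+ 2].
  rewrite /rmix deriv_mix mix_horner !derivnS !derivn0.
  rewrite !(derivD, derivZ, derivM, derivX, mul1r).
  rewrite !(hornerZ, hornerX, hornerM, hornerD) /= -expr2; by field.
move: (qmix p b) (rmix p b) r0 r1 => q r r0 r1 q1 q0 K0 K1.
have e0 : p.[b] = (even_poly p).[b ^+ 2] + b * (odd_poly p).[b ^+ 2].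
  by rewrite {1}(polysplit p) splitp_horner mulrC.
have e1 : p^`().[b] = 2 * b * (even_poly p)^`().[b ^+ 2] + (odd_poly p).[b ^+ 2]
    + 2 * b ^+ 2 * (odd_poly p)^`().[b ^+ 2].
  rewrite {1}(polysplit p) deriv_splitp splitp_horner !hornerE /=; by ring.
have e2 : p^`(2).[b] = 2 * (even_poly p)^`().[b ^+ 2] + 4 * b ^+ 2 * (even_poly p)^`(2).[b ^+ 2]
    + 6 * b * (odd_poly p)^`().[b ^+ 2] + 4 * b ^+ 3 * (odd_poly p)^`(2).[b ^+ 2].
  rewrite {1}(polysplit p) !derivnS !derivn0 !deriv_splitp splitp_horner.
  rewrite !(derivD, derivZ, derivM, derivX, mul1r).
  rewrite !(hornerZ, hornerX, hornerM, hornerD) /=; by ring.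
have e3 : p^`(3).[b] = 12 * b * (even_poly p)^`(2).[b ^+ 2] + 8 * b ^+ 3 * (even_poly p)^`(3).[b ^+ 2]
    + 6 * (odd_poly p)^`().[b ^+ 2] + 24 * b ^+ 2 * (odd_poly p)^`(2).[b ^+ 2]
    + 8 * b ^+ 4 * (odd_poly p)^`(3).[b ^+ 2].
  rewrite {1}(polysplit p) !derivnS !derivn0 !deriv_splitp splitp_horner.
  rewrite !(derivD, derivZ, derivM, derivX, mul1r).
  rewrite !(hornerZ, hornerX, hornerM, hornerD) /=; by ring.
have K0' : K.[b] = (2 * K.[b]) / 2 by field.
have K1' : K^`().[b] = (6 * K^`().[b]) / 6 by field.
apply: double_root.
  rewrite !hornerE /= K0' K0 q0 r0 e2 e1 e0; by field.
rewrite !(derivB, derivD, derivZ, derivM) -[p^`()^`()]/(p^`(2)) !hornerE /= K1' K1.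
rewrite q0 q1 r0 r1 e3 e2 e1 e0; by field.
Qed.

(** The OPE produces p2 p1'^2 / p1 + p1 p2'^2 / p2 where [Rsing] on the same sheet gives 2 p1' p2'.
    The difference is the square of this polynomial over p1 p2, and so is divisible by d^2. *)
Lemma wronskian_factor p b : exists L : {poly C},
  p.[b] *: p^`() - p^`().[b] *: p = ('X - b%:P) * L.
Proof.
have /factor_theorem[L LE] : root (p.[b] *: p^`() - p^`().[b] *: p) b.
  by apply/rootP; rewrite !hornerE /=; ring.
by exists L; rewrite LE mulrC.
Qed.

(** The same mechanism for the terms linear in Theta^[1]: on the opposite sheet, y1 y2 times the
    mixed polynomial of [A] cancels the sum of the two diagonal terms to second order. *)
Lemma theta_factor p A b : exists K : {poly C},
  A.[b] *: p + p.[b] *: A - 2 *: (qmix p b * qmix A b) = ('X - b%:P) ^+ 2 * K.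
Proof.
have := qmix_diag p b; have := deriv_qmix_diag p b.
have := qmix_diag A b; have := deriv_qmix_diag A b.
move: (qmix p b) (qmix A b) => q t t1 t0 q1 q0.
apply: double_root; first by rewrite !hornerE /= q0 t0; ring.
rewrite !(derivB, derivD, derivZ, derivM) !hornerE /= q0 q1 t0 t1; by field.
Qed.

End SingularPart.

(** Recursion on the syntax of the function; [h] settles its one non-polynomial constituent, and the
    denominators leave goals that they do not vanish. *)
Ltac expand2 h := lazymatch goal with
  | |- expands2 (fun t => @GRing.add _ (@?f t) (@?g t)) _ =>
      apply (@expands2D _ f g); expand2 h
  | |- expands2 (fun t => @GRing.opp _ (@?f t)) _ => apply (@expands2N _ f); expand2 h
  | |- expands2 (fun t => @GRing.mul _ (@?f t) (@?g t)) _ =>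
      apply (@expands2M _ f g); expand2 h
  | |- expands2 (fun t => @GRing.inv _ (@?f t)) _ =>
      first [exact (expands2_cst _ _) | apply (@expands2V _ f); [|expand2 h]]
  | |- expands2 (fun t => @GRing.exp _ (@?f t) ?k) _ => apply (@expands2X _ f k); expand2 h
  | |- expands2 (fun t => horner ?q t) _ => exact (expands2_poly q _)
  | |- expands2 (fun t => t) _ => exact (expands2_id _)
  | |- _ => first [exact (expands2_cst _ _) | exact h]
  end.

(** * Boundedness near the two points over x2 *)

Section RsingBounded.
Variable R : realType.
Local Notation C := (Cplx R).
Variables (p Th1 Thy : {poly C}) (c e : C).
Implicit Types (b t : C).

(* The singular part of <1> <T(x1) T(x2)>_c p1 p2 given by the OPE. *)
Definition ope_part (x1 y1 x2 y2 : C) : C :=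
  c / 2 * e * (p.[x1] * p.[x2]) / (x1 - x2) ^+ 4
  + c / 32 * e * (p.[x2] * (p^`().[x1] ^+ 2 / p.[x1]) + p.[x1] * (p^`().[x2] ^+ 2 / p.[x2]))
     / (x1 - x2) ^+ 2
  + 1 / 4 * (p.[x2] * Theta Th1 Thy x1 y1 + p.[x1] * Theta Th1 Thy x2 y2) / (x1 - x2) ^+ 2.

(** Near the diagonal [y1 y2 + q] tends to 2 p(b), so y1 y2 - q = d^2 K / (y1 y2 + q) is of second
    order. The right-hand side contains no negative power of [d]. *)
Lemma same_sheet_identity (d y1 y2 s1 s2 q r K L U V th t1 t2 g1 g2 : C) :
  d != 0 -> y1 != 0 -> y2 != 0 -> y1 * y2 + q != 0 ->
  y2 ^+ 2 * y1 ^+ 2 - q ^+ 2 = d ^+ 2 * K ->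
  4 * K + s2 * s1 - q * r = d ^+ 2 * U ->
  y2 ^+ 2 * s1 - s2 * y1 ^+ 2 = d * L ->
  t2 * y1 ^+ 2 + y2 ^+ 2 * t1 - 2 * (q * th) = d ^+ 2 * V ->
  c / 4 * e * ((y1 ^+ 2 * y2 ^+ 2 + y1 * y2 * q) / d ^+ 4)
  + c / 32 * e * ((s1 * s2 + y1 * y2 * r) / d ^+ 2)
  + 1 / 8 * ((y1 ^+ 2 * (t2 + y2 * g2) + y2 ^+ 2 * (t1 + y1 * g1)) / d ^+ 2)
  + 1 / 8 * (y1 * g2 + y2 * g1) * (q / d ^+ 2)
  + 1 / 4 * (y1 * y2) * (th / d ^+ 2)
  - (c / 2 * e * (y1 ^+ 2 * y2 ^+ 2) / d ^+ 4
    + c / 32 * e * (y2 ^+ 2 * (s1 ^+ 2 / y1 ^+ 2) + y1 ^+ 2 * (s2 ^+ 2 / y2 ^+ 2)) / d ^+ 2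
    + 1 / 4 * (y2 ^+ 2 * (t1 + y1 * g1) + y1 ^+ 2 * (t2 + y2 * g2)) / d ^+ 2)
  = c / 32 * e * (r * K / (y1 * y2 + q) - U - 4 * K ^+ 2 / (y1 * y2 + q) ^+ 2
                  - L ^+ 2 / (y1 * y2) ^+ 2)
    - 1 / 8 * (K / (y1 * y2 + q)) * (y1 * g2 + y2 * g1)
    - 1 / 8 * V + 1 / 4 * (th * K / (y1 * y2 + q)).
Proof.
move=> d0 y10 y20 w0 hK hU hL hV.
(* Eliminating V, U, L and then K, on which U depends, leaves an identity of rational functions in
   free variables. *)
have -> : V = (t2 * y1 ^+ 2 + y2 ^+ 2 * t1 - 2 * (q * th)) / d ^+ 2 by rewrite hV; field.
have -> : U = (4 * K + s2 * s1 - q * r) / d ^+ 2 by rewrite hU; field.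
have -> : L = (y2 ^+ 2 * s1 - s2 * y1 ^+ 2) / d by rewrite hL; field.
have -> : K = (y2 ^+ 2 * y1 ^+ 2 - q ^+ 2) / d ^+ 2 by rewrite hK; field.
by field; rewrite d0 y10 y20 w0.
Qed.

(** Here [y1 y2 - q] tends to - 2 p(b), and the small factor is y1 y2 + q = d^2 K / (y1 y2 - q). No
    OPE part is subtracted. *)
Lemma opposite_sheet_identity (d y1 y2 s1 s2 q r K U V th t1 t2 g1 g2 : C) :
  d != 0 -> y1 != 0 -> y2 != 0 -> y1 * y2 - q != 0 ->
  y2 ^+ 2 * y1 ^+ 2 - q ^+ 2 = d ^+ 2 * K ->
  4 * K + s2 * s1 - q * r = d ^+ 2 * U ->
  t2 * y1 ^+ 2 + y2 ^+ 2 * t1 - 2 * (q * th) = d ^+ 2 * V ->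
  c / 4 * e * ((y1 ^+ 2 * y2 ^+ 2 + y1 * y2 * q) / d ^+ 4)
  + c / 32 * e * ((s1 * s2 + y1 * y2 * r) / d ^+ 2)
  + 1 / 8 * ((y1 ^+ 2 * (t2 + y2 * g2) + y2 ^+ 2 * (t1 + y1 * g1)) / d ^+ 2)
  + 1 / 8 * (y1 * g2 + y2 * g1) * (q / d ^+ 2)
  + 1 / 4 * (y1 * y2) * (th / d ^+ 2)
  = c / 32 * e * (r * K / (y1 * y2 - q) + U + 4 * K ^+ 2 / (y1 * y2 - q) ^+ 2)
    + 1 / 8 * (K / (y1 * y2 - q)) * (y1 * g2 + y2 * g1)
    + 1 / 8 * V + 1 / 4 * (th * K / (y1 * y2 - q)).
Proof.
move=> d0 y10 y20 w0 hK hU hV.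
have -> : V = (t2 * y1 ^+ 2 + y2 ^+ 2 * t1 - 2 * (q * th)) / d ^+ 2 by rewrite hV; field.
have -> : U = (4 * K + s2 * s1 - q * r) / d ^+ 2 by rewrite hU; field.
have -> : K = (y2 ^+ 2 * y1 ^+ 2 - q ^+ 2) / d ^+ 2 by rewrite hK; field.
by field; rewrite d0 w0.
Qed.

Lemma eval_sqr_factor (k : C) (f q K : {poly C}) (b t : C) :
  k *: f - q ^+ 2 = ('X - b%:P) ^+ 2 * K ->
  k * f.[t] - q.[t] ^+ 2 = (t - b) ^+ 2 * K.[t].
Proof.
by move=> /(congr1 (horner^~ t)); rewrite !(horner_exp, hornerXsubC, hornerD, hornerN, hornerZ, hornerM).
Qed.

Lemma eval_qr_factor (k : C) (f q r K U : {poly C}) (b t : C) :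
  4 *: K + k *: f - q * r = ('X - b%:P) ^+ 2 * U ->
  4 * K.[t] + k * f.[t] - q.[t] * r.[t] = (t - b) ^+ 2 * U.[t].
Proof.
by move=> /(congr1 (horner^~ t)); rewrite !(horner_exp, hornerXsubC, hornerD, hornerN, hornerZ, hornerM).
Qed.

Lemma eval_wronskian_factor (k k' : C) (f f' L : {poly C}) (b t : C) :
  k *: f' - k' *: f = ('X - b%:P) * L ->
  k * f'.[t] - k' * f.[t] = (t - b) * L.[t].
Proof.
by move=> /(congr1 (horner^~ t)); rewrite !(hornerXsubC, hornerD, hornerN, hornerZ, hornerM).
Qed.

Lemma eval_theta_factor (k k' : C) (f f' q q' V : {poly C}) (b t : C) :
  k *: f + k' *: f' - 2 *: (q * q') = ('X - b%:P) ^+ 2 * V ->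
  k * f.[t] + k' * f'.[t] - 2 * (q.[t] * q'.[t]) = (t - b) ^+ 2 * V.[t].
Proof.
by move=> /(congr1 (horner^~ t)); rewrite !(horner_exp, hornerXsubC, hornerD, hornerN, hornerZ, hornerM).
Qed.

Variables (b y2 : C) (Y : C -> C).
Hypotheses (y20 : y2 != 0) (y2E : y2 ^+ 2 = p.[b]).
Hypotheses (hY : expands2 Y b) (YE : \forall t \near b, Y t ^+ 2 = p.[t]).

Lemma near_dnear (A : set C) : (\forall t \near b, A t) -> \forall t \near b^', A t.
Proof. by move=> /nm_nbhs[d d0 h]; apply/nm_dnbhs; exists d => // t _; exact: h. Qed.

Lemma near_neq0 (f : C -> C) : f b != 0 -> expands2 f b -> \forall t \near b, f t != 0.
Proof.
move=> fb /expands2_continuous /nm_continuousP; have n0 : 0 < nm (f b) by rewrite nm_gt0.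
move=> /(_ _ n0); apply: cnearS => t ht; apply/negP => /eqP h; move: ht.
by rewrite h sub0r nmN ltxx.
Qed.

Lemma bounded_at_near (f g : C -> C) : (\forall t \near b^', f t = g t) ->
  bounded_at g b -> bounded_at f b.
Proof. by move=> fg [M hM]; exists M; apply: filterS2 fg hM => t ->. Qed.

Lemma dnear_neq : \forall t \near b^', t != b.
Proof. by apply/nm_dnbhs; exists 1. Qed.

Lemma Rsing_bounded_same_sheet : Y b = y2 ->
  bounded_at (fun t => Rsing p Th1 Thy c e t (Y t) b y2 - ope_part t (Y t) b y2) b.
Proof.
move=> Yb.
have [K [hK K0 K1]] := sqr_factor (qmix_diag p b) (deriv_qmix_diag p b).
have [U hU] := qr_factor K0 K1.
have [L hL] := wronskian_factor p b; have [V hV] := theta_factor p Th1 b.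
have w0 : Y b * y2 + (qmix p b).[b] != 0.
  by rewrite qmix_diag -y2E Yb -expr2 -mulr2n -mulr_natr mulf_neq0 ?expf_neq0 // pnatr_eq0.
have ew : expands2 (fun t => Y t * y2 + (qmix p b).[t]) b by expand2 hY.
have yy0 : Y b * y2 != 0 by rewrite Yb mulf_neq0.
have eyy : expands2 (fun t => Y t * y2) b by expand2 hY.
have Y0 : Y b != 0 by rewrite Yb.
apply: (@bounded_at_near _ (fun t => c / 32 * e * ((rmix p b).[t] * K.[t] / (Y t * y2 + (qmix p b).[t])
      - U.[t] - 4 * K.[t] ^+ 2 / (Y t * y2 + (qmix p b).[t]) ^+ 2
                  - L.[t] ^+ 2 / (Y t * y2) ^+ 2)
    - 1 / 8 * (K.[t] / (Y t * y2 + (qmix p b).[t])) * (Y t * Thy.[b] + y2 * Thy.[t])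
    - 1 / 8 * V.[t] + 1 / 4 * ((qmix Th1 b).[t] * K.[t] / (Y t * y2 + (qmix p b).[t])))).
  have n1 := near_dnear YE; have n2 := near_dnear (near_neq0 w0 ew).
  have n3 := near_dnear (near_neq0 Y0 hY).
  apply: filterS2 (filterI n1 n2) (filterI n3 dnear_neq) => t [Yt wt] [Yt0 tb].
  rewrite RsingE /ope_part /Theta -Yt -y2E.
  apply: same_sheet_identity => //; first by rewrite subr_eq0.
  - by have := eval_sqr_factor t hK; rewrite -y2E -Yt.
  - exact: eval_qr_factor t hU.
  - by have := eval_wronskian_factor t hL; rewrite -y2E -Yt.
  - by have := eval_theta_factor t hV; rewrite -y2E -Yt.
by apply: expands2_bounded_at; expand2 hY; rewrite ?expf_neq0.
Qed.

Lemma Rsing_bounded_opposite_sheet : Y b = - y2 ->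
  bounded_at (fun t => Rsing p Th1 Thy c e t (Y t) b y2) b.
Proof.
move=> Yb.
have [K [hK K0 K1]] := sqr_factor (qmix_diag p b) (deriv_qmix_diag p b).
have [U hU] := qr_factor K0 K1.
have [V hV] := theta_factor p Th1 b.
have w0 : Y b * y2 - (qmix p b).[b] != 0.
  rewrite qmix_diag -y2E Yb mulNr -expr2 -opprD oppr_eq0 -mulr2n -mulr_natr.
  by rewrite mulf_neq0 ?expf_neq0 // pnatr_eq0.
have ew : expands2 (fun t => Y t * y2 - (qmix p b).[t]) b by expand2 hY.
have Y0 : Y b != 0 by rewrite Yb oppr_eq0.
apply: (@bounded_at_near _ (fun t => c / 32 * e * ((rmix p b).[t] * K.[t] / (Y t * y2 - (qmix p b).[t])
      + U.[t] + 4 * K.[t] ^+ 2 / (Y t * y2 - (qmix p b).[t]) ^+ 2)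
    + 1 / 8 * (K.[t] / (Y t * y2 - (qmix p b).[t])) * (Y t * Thy.[b] + y2 * Thy.[t])
    + 1 / 8 * V.[t] + 1 / 4 * ((qmix Th1 b).[t] * K.[t] / (Y t * y2 - (qmix p b).[t])))).
  have n1 := near_dnear YE; have n2 := near_dnear (near_neq0 w0 ew).
  have n3 := near_dnear (near_neq0 Y0 hY).
  apply: filterS2 (filterI n1 n2) (filterI n3 dnear_neq) => t [Yt wt] [Yt0 tb].
  rewrite RsingE /Theta -Yt -y2E.
  apply: opposite_sheet_identity => //; first by rewrite subr_eq0.
  - by have := eval_sqr_factor t hK; rewrite -y2E -Yt.
  - exact: eval_qr_factor t hU.
  - by have := eval_theta_factor t hV; rewrite -y2E -Yt.
by apply: expands2_bounded_at; expand2 hY; rewrite ?expf_neq0.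
Qed.

Lemma Rsing_expands2 x0 (Z : C -> C) : x0 != b -> expands2 Z x0 ->
  expands2 (fun t => Rsing p Th1 Thy c e t (Z t) b y2) x0.
Proof.
move=> x0b hZ.
apply: (@expands2_eq _ (fun t => c / 4 * e * ((p.[t] * p.[b] + Z t * y2 * (qmix p b).[t]) / (t - b) ^+ 4)
  + c / 32 * e * ((p^`().[t] * p^`().[b] + Z t * y2 * (rmix p b).[t]) / (t - b) ^+ 2)
  + 1 / 8 * ((p.[t] * Theta Th1 Thy b y2 + p.[b] * (Th1.[t] + Z t * Thy.[t])) / (t - b) ^+ 2)
  + 1 / 8 * (Z t * Thy.[b] + y2 * Thy.[t]) * ((qmix p b).[t] / (t - b) ^+ 2)
  + 1 / 4 * (Z t * y2) * ((qmix Th1 b).[t] / (t - b) ^+ 2))).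
  by apply: cnearW => t; rewrite RsingE.
have n0 n : (x0 - b) ^+ n != 0 by rewrite expf_neq0 // subr_eq0.
by expand2 hZ; exact: n0.
Qed.

End RsingBounded.

(** * Orders of growth at infinity *)

Section Growth.
Variable R : realType.
Local Notation C := (Cplx R).

Lemma size_growth_arith n k s : (0 < s)%N ->
  ((n.+1 + (s + s).-1).-1 <= (2 * k).+1)%N -> (2 * s + n <= 2 * k + 2)%N.
Proof. lia. Qed.

Lemma poly_eq_everywhere (A D : {poly C}) (S : seq C) :
  (forall a, a \notin S -> A.[a] = D.[a]) -> A = D.
Proof.
move=> AD; apply/eqP; rewrite -subr_eq0; apply/negPn/negP => n0.
pose Q := (A - D) * \prod_(s <- S) ('X - s%:P).
have Q0 : Q != 0.
  rewrite mulf_neq0 // prodf_seq_neq0; apply/allP => s _ /=; by rewrite polyXsubC_eq0.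
have Qa a : root Q a.
  apply/rootP; rewrite hornerM horner_prod; have [aS|/AD e] := boolP (a \in S).
    by rewrite (big_rem _ aS) /= hornerXsubC subrr mul0r mulr0.
  by rewrite hornerD hornerN e subrr mul0r.
have : (size [seq i%:R : C | i <- iota 0 (size Q)] < size Q)%N.
  apply: max_poly_roots => //; first by apply/allP => a _; exact: Qa.
  by rewrite map_inj_uniq ?iota_uniq // => i j /eqP; rewrite eqr_nat => /eqP.
by rewrite size_map size_iota ltnn.
Qed.

(** Liouville's theorem yields a polynomial of the required size with the same values as [A]. *)
Lemma poly_size_growth (A : {poly C}) k (K M : R) :
  (forall a, M <= nm a -> nm A.[a] <= K * nm a ^+ k) -> (size A <= k.+1)%N.
Proof.
move=> h.
have [||| D sD hD] := @liouville_polynomial R k.+1 (fun a => A.[a]) [::].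
- by move=> a _; exact: expands2_poly.
- by [].
- by exists K, M => a aM _; rewrite exprSr mulrA ler_wpM2r // h.
by rewrite (@poly_eq_everywhere A D [::]).
Qed.

Lemma poly_upper_bound (A : {poly C}) k : (size A <= k.+1)%N ->
  exists K : R, forall a, 1 <= nm a -> nm A.[a] <= K * nm a ^+ k.
Proof.
move=> sA; exists (\sum_(i < k.+1) nm A`_i) => a a1.
rewrite (horner_coef_wide _ sA) mulr_suml; apply: le_trans (nm_sum _ _ _) _.
apply: ler_sum => i _; rewrite nmM nmX ler_wpM2l //.
by rewrite ler_weXn2l // -ltnS.
Qed.

Variables (X : riemann_surface R) (p : {poly C}) (H : hyperelliptic X p).
Implicit Types (P Q : X) (phi psi : X -> C).
Local Notation x := (xcoord H).
Local Notation y := (ycoord H).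
Local Notation oo := (infpt H).

(* With weights 2 for x and n for y: phi is O(|x|^(k/2)) at infinity. *)
Definition growth (k : int) phi := exists K M : R,
  forall P, P <> oo -> M <= nm (x P) -> nm (phi P) ^+ 2 <= K * nm (x P) ^ k.

Lemma exprz_double (r : R) k : r ^ (2 * k%:Z) = (r ^+ k) ^+ 2.
Proof. by rewrite -PoszM -exprnP mulnC exprM. Qed.

Lemma exprz_doubleN (r : R) k : r ^ (- (2 * k%:Z)) = (r ^+ k) ^- 2.
Proof. by rewrite -PoszM -exprnN mulnC exprM. Qed.

Lemma growth_eq k phi psi : (forall P, P <> oo -> phi P = psi P) ->
  growth k phi -> growth k psi.
Proof. by move=> e [K [M h]]; exists K, M => P Pf PM; rewrite -e // h. Qed.

Lemma growth_large k phi psi (N : R) :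
  (forall P, P <> oo -> N <= nm (x P) -> phi P = psi P) ->
  growth k phi -> growth k psi.
Proof.
move=> e [K [M h]]; exists K, (Num.max M N) => P Pf.
by rewrite ge_max => /andP[PM PN]; rewrite -e // h.
Qed.

Lemma growthW k k' phi : growth k phi -> (k <= k')%R -> growth k' phi.
Proof.
move=> [K [M h]] kk; exists `|K|, (Num.max M 1) => P Pf.
rewrite ge_max => /andP[PM P1]; apply: le_trans (h _ Pf PM) _.
apply: le_trans (_ : `|K| * nm (x P) ^ k <= _).
  by rewrite ler_wpM2r ?ler_norm // exprz_ge0.
by rewrite ler_wpM2l // ler_weXz2l.
Qed.

Lemma growthD k phi psi : growth k phi -> growth k psi ->
  growth k (fun P => phi P + psi P).
Proof.
move=> [K [M h]] [K' [M' h']]; exists (2 * K + 2 * K'), (Num.max M M') => P Pf.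
rewrite ge_max => /andP[/(h _ Pf) {}h /(h' _ Pf) {}h'].
have := parallelogram (phi P) (psi P); have := sqr_ge0 (nm (phi P - psi P)).
rewrite (_ : (2 * K + 2 * K') * _ = 2 * (K * nm (x P) ^ k) + 2 * (K' * nm (x P) ^ k)); last by ring.
lra.
Qed.

Lemma growthM k k' phi psi : growth k phi -> growth k' psi ->
  growth (k + k') (fun P => phi P * psi P).
Proof.
move=> [K [M h]] [K' [M' h']]; exists (K * K'), (Num.max (Num.max M M') 1) => P Pf.
rewrite !ge_max => /andP[/andP[/(h _ Pf) {}h /(h' _ Pf) {}h'] P1].
have x0 : nm (x P) != 0 by rewrite gt_eqF //; lra.
rewrite nmM exprMn expfzDr //.
rewrite (_ : K * K' * _ = (K * nm (x P) ^ k) * (K' * nm (x P) ^ k')); last by ring.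
by apply: ler_pM => //; rewrite exprn_ge0.
Qed.

Lemma growth_cst (a : C) : growth 0 (fun=> a).
Proof. by exists (nm a ^+ 2), 0 => P _ _; rewrite expr0z mulr1. Qed.

Lemma growthZ k (a : C) phi : growth k phi -> growth k (fun P => a * phi P).
Proof. by move=> h; have := growthM (growth_cst a) h; rewrite add0r. Qed.

Lemma growthN k phi : growth k phi -> growth k (fun P => - phi P).
Proof. by move=> [K [M h]]; exists K, M => P Pf PM; rewrite nmN h. Qed.

Lemma growthB k phi psi : growth k phi -> growth k psi ->
  growth k (fun P => phi P - psi P).
Proof. by move=> h h'; exact: growthD h (growthN h'). Qed.

Lemma growth_poly (A : {poly C}) k : (size A <= k.+1)%N ->
  growth (2 * k%:Z) (fun P => A.[x P]).
Proof.
move=> /poly_upper_bound[K hK]; exists (K ^+ 2), 1 => P Pf P1.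
rewrite exprz_double -exprMn; have := hK _ P1; have := nm_ge0 A.[x P].
by rewrite !expr2 => h1 h2; apply: ler_pM.
Qed.

Lemma growth_inv (b : C) : growth (-2) (fun P => (x P - b)^-1).
Proof.
exists 4, (Num.max 1 (2 * nm b)) => P Pf; rewrite ge_max => /andP[P1 Pb].
have x0 : 0 < nm (x P) by lra.
have xb : nm (x P) <= 2 * nm (x P - b) by have := nmB_ge (x P) b; lra.
have xb0 : 0 < nm (x P - b) by lra.
rewrite (_ : nm (x P) ^ (-2) = (nm (x P) ^+ 2)^-1) // nmV exprVn.
rewrite ler_pdivlMr ?exprn_gt0 // mulrC ler_pdivrMr ?exprn_gt0 //.
by rewrite !expr2; nra.
Qed.

Lemma growth_invol k phi : growth k phi -> growth k (fun P => phi (invol H P)).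
Proof.
move=> [K [M h]]; exists K, M => P Pf PM; have [If xI _] := involP Pf.
by rewrite -xI; apply: h; rewrite ?xI.
Qed.

Lemma size_growth (A : {poly C}) k : growth (2 * k%:Z) (fun P => A.[x P]) -> (size A <= k.+1)%N.
Proof.
move=> [K [M h]]; apply: (@poly_size_growth A k (`|K| + 1) M) => a aM.
have [P [Pf xP]] := pt_over H a; have := h P Pf; rewrite xP => /(_ aM).
rewrite exprz_double => hP.
rewrite -(@ler_pXn2r _ 2%N) ?nnegrE // ?mulr_ge0 ?addr_ge0 ?exprn_ge0 //.
apply: le_trans hP _; rewrite exprMn ler_wpM2r ?exprn_ge0 ?exprn_ge0 //.
by apply: le_trans (ler_norm K) _; have := normr_ge0 K; nra.
Qed.

Variables (m n : nat) (sp : size p = n.+1) (nE : n = (2 * m).+1%N).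

Lemma growth_y : growth n y.
Proof.
have [K hK] := poly_upper_bound (eq_leq sp); exists K, 1 => P Pf P1.
by rewrite -nmX curve_eq // hK.
Qed.

Lemma growth_y_inv (B : {poly C}) k :
  growth (2 * k%:Z) (fun P => y P * B.[x P]) -> (2 * size B + n <= 2 * k + 2)%N || (B == 0).
Proof.
move=> h; have [->|B0] := eqVneq B 0; first by rewrite orbT.
have : growth (2 * (2 * k)%N%:Z) (fun P => (p * B ^+ 2).[x P]).
  apply: growth_eq (growthW (growthM h h) _); last by lia.
  move=> P Pf; rewrite hornerM horner_exp -(curve_eq Pf); ring.
move=> /size_growth; have p0 : p != 0 by rewrite -size_poly_gt0 sp.
rewrite size_mul ?expf_neq0 // sp expr2 size_mul //.
have : (0 < size B)%N by rewrite size_poly_gt0.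
by rewrite orbF; exact: size_growth_arith.
Qed.

Local Notation lc := (lead_coef p).

Lemma lcE : lc = nth 0 p n.
Proof. by rewrite lead_coefE sp. Qed.

Lemma lead_neq0 : lc != 0.
Proof. by rewrite lead_coef_eq0 -size_poly_gt0 sp. Qed.

Lemma size_lower : (size (p - lc *: 'X^n)%R <= n)%N.
Proof.
apply/leq_sizeP => j nj; rewrite coefB coefZ coefXn.
move: nj; rewrite leq_eqVlt => /orP[/eqP <-|nj]; first by rewrite eqxx mulr1 lcE subrr.
rewrite [X in X - _]nth_default ?sp //.
by rewrite gtn_eqF // mulr0 subrr.
Qed.

Lemma p_lower_bound : exists2 M : R, 1 <= M &
  forall a, M <= nm a -> nm lc / 2 * nm a ^+ n <= nm p.[a].
Proof.
have [k nk] : exists k, n = k.+1 by exists (2 * m)%N.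
have sl := size_lower; rewrite {2}nk in sl.
have [K hK] := poly_upper_bound sl.
have a0 : 0 < nm lc by rewrite nm_gt0 lead_neq0.
exists (Num.max 1 (2 * K / nm lc)); first by rewrite le_max lexx.
move=> a; rewrite ge_max => /andP[a1]; rewrite ler_pdivrMr // => aK.
have := hK _ a1; rewrite hornerD hornerN hornerZ hornerXn => h.
have := nmD_ge (lc * a ^+ n) (p.[a] - lc * a ^+ n); rewrite addKB nmM nmX.
rewrite [in X in _ -> X]nk exprS [in nm a ^+ n]nk exprS.
have : 0 <= nm a ^+ k by rewrite exprn_ge0.
move: (nm (_ - _)) (nm a ^+ k) h => u v h v0.
by nra.
Qed.

Lemma growth_p_inv : growth (- (2 * n%:Z)) (fun P => p.[x P]^-1).
Proof.
have [M M1 hM] := p_lower_bound.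
have a0 : 0 < nm lc by rewrite nm_gt0 lead_neq0.
exists ((nm lc / 2) ^- 2), M => P Pf PM; have := hM _ PM => h.
have x0 : 0 < nm (x P) by lra.
have l0 : 0 < nm lc / 2 * nm (x P) ^+ n by rewrite mulr_gt0 ?exprn_gt0 // divr_gt0.
rewrite exprz_doubleN.
rewrite nmV exprVn -invfM -exprMn lef_pV2 ?posrE ?exprn_gt0 //; last exact: lt_le_trans h.
by rewrite ler_pXn2r ?nnegrE // ltW.
Qed.

Lemma large_generic : exists M : R, forall P, P <> oo -> M <= nm (x P) -> generic H P.
Proof.
have [M M1 hM] := p_lower_bound; exists M => P Pf PM; split => //.
have a0 : 0 < nm lc by rewrite nm_gt0 lead_neq0.
rewrite -nm_gt0; apply: lt_le_trans (hM _ PM).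
by rewrite mulr_gt0 ?divr_gt0 // exprn_gt0 //; lra.
Qed.

End Growth.

Lemma arith_n3 (k : nat) : (0 < k)%N -> (2 * ((2 * k).+1 - 3)%N%:Z = 4 * k%:Z - 4)%R.
Proof. lia. Qed.

(** * Leading behaviour of Theta *)

Section ThetaGrowth.
Variable R : realType.
Local Notation C := (Cplx R).
Variables (X : riemann_surface R) (p : {poly C}) (H : hyperelliptic X p).
Variables (m n : nat) (sp : size p = n.+1) (nE : n = (2 * m).+1%N) (m1 : (0 < m)%N).
Local Notation x := (xcoord H).
Local Notation y := (ycoord H).
Local Notation oo := (infpt H).
Local Notation lc := (lead_coef p).

Variables (T1 : X -> C) (Th1 Thy : {poly C}) (c e : C).
Hypothesis hT1 : growth H (-6) (fun P => T1 P - c / 32 * e * x P ^- 2).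
Hypothesis hTheta : forall P, generic H P ->
  p.[x P] * T1 P = c / 32 * (p^`().[x P] ^+ 2 / p.[x P]) * e + 1 / 4 * Theta Th1 Thy (x P) (y P).

(** The coefficient of x^(n-2) in Theta = 4 p <T> - (c/8)(p'^2 / p) <1>: the first term gives (c/8)
    <1> lc by the asymptotics of <T>, the second - (c/8) <1> n^2 lc, where lc is the leading
    coefficient of p. *)
Definition theta_lead : C := - (c / 8 * e * (n%:R ^+ 2 - 1) * lc).

Lemma size_derivX (l : {poly C}) k : (size l <= k)%N -> (size (l^`() * 'X)%R <= k)%N.
Proof.
have [->|l0] := eqVneq l 0; first by rewrite deriv0 mul0r size_poly0.
move=> lk; apply: leq_trans lk; apply: leq_trans (size_polyMleq _ _) _.
by rewrite size_polyX addn2 /=; exact: lt_size_deriv.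
Qed.

(** x p' has leading term n lc x^n. The subtracted term therefore removes the top degree of the
    square, and it is a multiple of p so as to control p'^2 / p. *)
Lemma size_log_deriv : (size ((p^`() * 'X) ^+ 2 - (n%:R ^+ 2 * lc) *: ('X^n * p))%R <= 2 * n)%N.
Proof.
pose l := p - lc *: 'X^n.
have sl : (size l <= n)%N := size_lower sp.
have pE : p = lc *: 'X^n + l by rewrite /l addrC subrK.
have n0 : (0 < n)%N by rewrite nE.
have dpE : p^`() * 'X = (n%:R * lc) *: 'X^n + l^`() * 'X.
  rewrite {1}pE derivD derivZ derivXn mulrDl -scaler_nat -!scalerAl -exprSr prednK //.
  by rewrite scalerA mulrC.
move: (l^`() * 'X) (size_derivX sl) dpE => D sD ->.
have -> : ((n%:R * lc) *: 'X^n + D) ^+ 2 - (n%:R ^+ 2 * lc) *: ('X^n * p)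
    = (2 * n%:R * lc) *: ('X^n * D) + D ^+ 2 - (n%:R ^+ 2 * lc) *: ('X^n * l).
  by rewrite [in 'X^n * p]pE -!mul_polyC !(rmorphM, rmorphXn, rmorph_nat) /=; ring.
have s1 (f : {poly C}) : (size f <= n)%N -> (size ('X^n * f)%R <= 2 * n)%N.
  move=> sf; apply: leq_trans (size_polyMleq _ _) _; rewrite size_polyXn addSn /=.
  by rewrite mul2n -addnn leq_add2l.
apply: leq_trans (size_polyD _ _) _; rewrite geq_max size_polyN; apply/andP; split.
  apply: leq_trans (size_polyD _ _) _; rewrite geq_max; apply/andP; split.
    by apply: leq_trans (size_scale_leq _ _) _; exact: s1.
  rewrite expr2; apply: leq_trans (size_polyMleq _ _) _; apply: leq_trans (leq_pred _) _.
  by rewrite mul2n -addnn leq_add.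
by apply: leq_trans (size_scale_leq _ _) _; exact: s1.
Qed.

Lemma Theta_growth : growth H (2 * (n - 3)%N%:Z)
  (fun P => Theta Th1 Thy (x P) (y P) - theta_lead * x P ^+ (n - 2)).
Proof.
have wE : 2 * (n - 3)%N%:Z = 4 * m%:Z - 4 by rewrite nE arith_n3.
have nm2 : n%:Z = 2 * m%:Z + 1 by rewrite nE; clear; lia.
have [N hN] := large_generic H sp nE.
have i1 := growth_inv H 0; have i2 := growthM i1 i1.
have g1 := growthM (growth_poly H (eq_leq sp)) hT1.
have sl := size_lower sp; rewrite {2}nE in sl.
have g2 := growthM (growth_poly H sl) i2.
have s3 : (size ((p^`() * 'X) ^+ 2 - (n%:R ^+ 2 * lc) *: ('X^n * p))%R <= (4 * m).+1.+1)%N.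
  by apply: leq_trans size_log_deriv _; rewrite nE; clear; lia.
have g3 := growthM (growthM (growth_poly H s3) (growth_p_inv H sp nE)) i2.
have k1 := growthW g1 (_ : _ <= 2 * (n - 3)%N%:Z).
have k2 := growthW g2 (_ : _ <= 2 * (n - 3)%N%:Z).
have k3 := growthW g3 (_ : _ <= 2 * (n - 3)%N%:Z).
(* Three errors: 4 p times the remainder of <T>, and, with factor (c/8) <1>, p / x^2 and p'^2 / p
   without their leading terms. *)
have := growthB (growthD (growthZ 4 (k1 _)) (growthZ (4 * (c / 32 * e)) (k2 _)))
  (growthZ (4 * (c / 32 * e)) (k3 _)).
have {k1 k2 k3} h1 : 2 * n%:Z + -6 <= 2 * (n - 3)%N%:Z by rewrite wE nm2; clear; lia.
have h2 : 2 * (2 * m)%N%:Z + (-2 + -2) <= 2 * (n - 3)%N%:Z by rewrite wE; clear; lia.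
have h3 : 2 * (4 * m).+1%N%:Z + - (2 * n%:Z) + (-2 + -2) <= 2 * (n - 3)%N%:Z.
  by rewrite wE nm2; clear; lia.
move=> /(_ h1 h2 h3); apply: (@growth_large _ _ _ _ _ _ _ (Num.max N 1)).
move=> P Pf; rewrite ge_max => /andP[/(hN _ Pf) gP P1]; have [_ px] := gP.
have xP : x P != 0 by rewrite -nm_gt0; lra.
have -> : Theta Th1 Thy (x P) (y P) = 4 * (p.[x P] * T1 P - c / 32 * (p^`().[x P] ^+ 2 / p.[x P]) * e).
  by rewrite hTheta //; field.
rewrite subr0 /theta_lead.
have -> : (p - lc *: 'X^n).[x P] = p.[x P] - lc * (x P ^+ (n - 2) * x P ^+ 2).
  rewrite hornerD hornerN hornerZ hornerXn -exprD subnK // nE; clear -m1; lia.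
have -> : ((p^`() * 'X) ^+ 2 - (n%:R ^+ 2 * lc) *: ('X^n * p)).[x P] =
   (p^`().[x P] * x P) ^+ 2 - (n%:R ^+ 2 * lc) * (x P ^+ (n - 2) * x P ^+ 2 * p.[x P]).
  rewrite hornerD hornerN hornerZ horner_exp !hornerM hornerX hornerXn -exprD subnK //.
  by rewrite nE; clear -m1; lia.
by field; rewrite px.
Qed.

Lemma size_Th1 : (size (Th1 - theta_lead *: 'X^(n - 2))%R <= n - 2)%N.
Proof.
have h := Theta_growth; have h' := growth_invol h.
have n3 : (n - 2 = (n - 3).+1)%N by rewrite nE; clear -m1; lia.
rewrite {2}n3; apply: (@size_growth _ _ _ H).
have := growthZ (2^-1) (growthD h h'); apply: growth_eq => P Pf.
have [_ xI yI] := involP Pf.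
by rewrite xI yI /Theta hornerD hornerN hornerZ hornerXn; field.
Qed.

Lemma size_Thy : (2 * size Thy + n <= 2 * (n - 3) + 2)%N || (Thy == 0).
Proof.
have h := Theta_growth; have h' := growth_invol h.
apply: (growth_y_inv (H := H) sp nE); have := growthZ (2^-1) (growthB h h').
apply: growth_eq => P Pf; have [_ xI yI] := involP Pf.
by rewrite xI yI /Theta; field.
Qed.

End ThetaGrowth.

(** * Cancellation of leading terms in R *)

Section RcorrGrowth.
Variable R : realType.
Local Notation C := (Cplx R).
Implicit Types (A D : {poly C}).

Lemma coef_comp_scale A (b : C) i : (A \Po (b *: 'X))`_i = A`_i * b ^+ i.
Proof.
elim/poly_ind: A i => [|A a IH] i; first by rewrite comp_poly0 !coef0 mul0r.
rewrite comp_poly_MXaddC coefD coefC mulrC -scalerAl coefZ (mulrC 'X) coefMX.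
rewrite coefD coefMX coefC; case: i => [|i] /=; first by rewrite mulr0 !add0r expr0 mulr1.
by rewrite IH !addr0 exprS; ring.
Qed.

Lemma coef_mix A D (b : C) i : (mix b A D)`_i =
  A`_i * b ^+ i + 2^-1 * ((if i is j.+1 then D`_j * b ^+ j else 0) + b * (D`_i * b ^+ i)).
Proof.
rewrite /mix coefD coefZ coef_comp_scale mulrDl coefD mul_polyC coefZ coef_comp_scale.
by congr (_ + _ * (_ + _)); rewrite mulrC coefMX; case: i => [//|i] /=; rewrite coef_comp_scale.
Qed.

Lemma size_qmix A (b : C) k : (size A <= (2 * k).+2)%N -> (size (qmix A b) <= k.+2)%N.
Proof.
move=> sA; apply/leq_sizeP => j jk; rewrite coef_mix.
have z i : ((2 * k).+2 <= i)%N -> A`_i = 0 by move=> ?; rewrite nth_default // (leq_trans sA).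
case: j jk => [//|j] jk; rewrite !coef_even_poly !coef_odd_poly !z ?(mul0r, mulr0, addr0) //.
all: move: jk; clear; lia.
Qed.

Lemma coef_X_deriv2 A i : ('X * A^`(2))`_i = A`_i.+1 *+ (i.+1 * i).
Proof.
rewrite coefXM; case: i => [|i] /=; first by rewrite muln0 mulr0n.
by rewrite !coef_deriv mulrnA.
Qed.

Lemma size_rmix A (b : C) k : (size A <= (2 * k).+2)%N -> (0 < k)%N ->
  (forall i, (k < i)%N -> (rmix A b)`_i = 0) /\
  (rmix A b)`_k = 2 * k%:R * k.+1%:R * A`_(2 * k).+1 * b ^+ k.-1.
Proof.
move=> sA k0.
have z i : ((2 * k).+2 <= i)%N -> A`_i = 0 by move=> ?; rewrite nth_default // (leq_trans sA).
pose E := 4 *: ((even_poly A)^`() + 'X * (even_poly A)^`(2)).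
pose D := 4 *: (2 *: (odd_poly A)^`() + 'X * (odd_poly A)^`(2)).
have E0 i : (k <= i)%N -> E`_i = 0.
  move=> ki; rewrite coefZ coefD coef_deriv coef_X_deriv2 coef_even_poly z ?mul0rn ?addr0 ?mulr0 //.
  by move: ki; clear; lia.
have Di i : D`_i = 4 * (2 * (A`_i.+1.*2.+1 *+ i.+1) + A`_i.+1.*2.+1 *+ (i.+1 * i)).
  by rewrite coefZ coefD coefZ coef_deriv coef_X_deriv2 coef_odd_poly.
have D0 i : (k <= i)%N -> D`_i = 0.
  move=> ki; rewrite Di z ?mul0rn ?mulr0 ?addr0 ?mulr0 //.
  by move: ki; clear; lia.
have rE : rmix A b = mix b E D by [].
move: E D rE E0 Di D0 => E D -> E0 Di D0.
split.
  move=> [//|i] ki; rewrite coef_mix E0 ?D0 ?(mul0r, mulr0, addr0) //; exact: ltnW.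
case: k k0 {sA} z E0 D0 => [//|k] _ z E0 D0.
rewrite coef_mix E0 // (D0 k.+1) // (Di k).
rewrite (_ : k.+1.*2 = (2 * k.+1)%N) ?mul2n //= -[in A`_ _ *+ k.+1]mulr_natr.
rewrite -[in A`_ _ *+ (k.+1 * k)]mulr_natr natrM.
rewrite !mul0r mulr0 addr0 add0r -!natr1.
by move: (A`_ _) (b ^+ k) (k%:R) => u v w; field.
Qed.

Variables (X : riemann_surface R) (p : {poly C}) (H : hyperelliptic X p).
Variables (m n : nat) (sp : size p = n.+1) (nE : n = (2 * m).+1%N) (m1 : (0 < m)%N).
Local Notation x := (xcoord H).
Local Notation y := (ycoord H).
Local Notation oo := (infpt H).
Local Notation lc := (lead_coef p).
Variables (Th1 Thy : {poly C}) (c e : C) (a : nat -> C).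
Hypothesis pa : forall k, (k <= n)%N -> p`_(n - k) = a k.
Hypothesis sTh1 : (size (Th1 - theta_lead p n c e *: 'X^(n - 2))%R <= n - 2)%N.
Hypothesis sThy : (2 * size Thy + n <= 2 * (n - 3) + 2)%N || (Thy == 0).
Hypothesis gTh : growth H (2 * (n - 3)%N%:Z)
  (fun P => Theta Th1 Thy (x P) (y P) - theta_lead p n c e * x P ^+ (n - 2)).
Variables (b y2 : C).

(** Both summands have a term in x^m, which after multiplication by y and division by d^2 would
    exceed the order n - 3. Its coefficients, (c/16) m (m+1) <1> lc b^(m-1) and (1/8) [theta_lead]
    b^(m-1), cancel because n^2 - 1 = 4 m (m+1). *)
Lemma size_mix_part :
  (size ((c / 32 * e) *: rmix p b + 4^-1 *: qmix Th1 b)%R <= m)%N.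
Proof.
have [th thE] : exists th, th = theta_lead p n c e by eexists.
have sTh := sTh1; rewrite -thE in sTh.
have sp' : (size p <= (2 * m).+2)%N by rewrite sp nE.
have [r0 r1] := size_rmix b sp' m1.
have lcE' : p`_(2 * m).+1 = lc by rewrite lead_coefE sp nE.
have Thj j : (n - 2 <= j)%N -> Th1`_j = if j == (n - 2)%N then th else 0.
  move=> hj; have := nth_default 0 (leq_trans sTh hj).
  by rewrite coefB coefZ coefXn => /eqP; rewrite subr_eq0 => /eqP ->; case: eqP; rewrite ?mulr1 ?mulr0.
apply/leq_sizeP => i mi; rewrite coefD !coefZ.
have ev j : (m <= j)%N -> (even_poly Th1)`_j = 0.
  move=> mj; rewrite coef_even_poly Thj; last by rewrite nE; move: mj; clear; lia.
  by case: eqP => // e0; exfalso; move: e0 mj m1; rewrite nE; clear; lia.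
have od j : (m <= j)%N -> (odd_poly Th1)`_j = 0.
  move=> mj; rewrite coef_odd_poly Thj; last by rewrite nE; move: mj; clear; lia.
  by case: eqP => // e0; exfalso; move: e0 mj m1; rewrite nE; clear; lia.
have od1 : (odd_poly Th1)`_m.-1 = th.
  rewrite coef_odd_poly Thj; last by rewrite nE; move: m1; clear; lia.
  by case: eqP => // -[]; rewrite nE; move: m1; clear; lia.
have qv : (qmix Th1 b)`_i = 2^-1 * (if i is j.+1 then (odd_poly Th1)`_j * b ^+ j else 0).
  by rewrite coef_mix ev // od // !mul0r mulr0 addr0 add0r.
rewrite qv; move: mi; rewrite leq_eqVlt => /orP[/eqP <-|mi].
  rewrite r1 lcE'; case: m m1 nE od1 => [//|k] _ nE' /= ->.
  rewrite thE /theta_lead nE' mulnS !addSn add0n -!natr1 natrM.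
  by move: (b ^+ k) (k%:R) => u v; field.
rewrite r0 // mulr0 add0r; case: i mi {qv} => [//|i] mi.
by rewrite od // mul0r !mulr0.
Qed.

(** After division by (x - b)^2, the correction term - (1/8) a0 x1^(n-2) Theta2 leaves (1/8) p1
    Theta2 / d^2 of order n - 3. *)
Lemma size_lead_part : (size (p - (lc *: 'X^(n - 2)) * ('X - b%:P) ^+ 2)%R <= n)%N.
Proof.
have -> : p - (lc *: 'X^(n - 2)) * ('X - b%:P) ^+ 2
   = (p - lc *: 'X^n) + lc *: ('X^(n - 2) * ((2 * b) *: 'X - (b ^+ 2)%:P)).
  have -> : 'X^n = 'X^(n - 2) * 'X^2 :> {poly C}.
    by rewrite -exprD subnK // nE; move: m1; clear; lia.
  by rewrite -!mul_polyC !(rmorphM, rmorphXn, rmorph_nat) /=; ring.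
apply: leq_trans (size_polyD _ _) _; rewrite geq_max size_lower //=.
apply: leq_trans (size_scale_leq _ _) _; apply: leq_trans (size_polyMleq _ _) _.
rewrite size_polyXn.
have : (size ((2 * b) *: 'X - (b ^+ 2)%:P)%R <= 2)%N.
  apply: leq_trans (size_polyD _ _) _; rewrite geq_max size_polyN.
  apply/andP; split; first by apply: leq_trans (size_scale_leq _ _) _; rewrite size_polyX.
  by apply: leq_trans (size_polyC_leq1 _) _.
by move: (size _) => s; rewrite nE; move: m1; clear; lia.
Qed.

(** The two leading terms of q / (x - b)^2 at infinity, in x^(m-1) and x^(m-2): multiplied by y they
    exceed the order n - 3. One eighth of their coefficients are those of the correction terms with
    y1 Theta2^[y]. *)
Definition asym_part : {poly C} :=
  (a 1%N * b ^+ m + 3 / 2 * a 0%N * b ^+ m.+1 + 2^-1 * a 2%N * b ^+ m.-1) *: 'X^(m - 2)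
  + (2^-1 * a 0%N * b ^+ m) *: 'X^(m.-1).

Lemma size_asym_part : (2 < m)%N ->
  (size (qmix p b - asym_part * ('X - b%:P) ^+ 2)%R <= m)%N.
Proof.
move=> m3; rewrite /asym_part; have [k mE] : exists k, m = k.+2.
  by exists (m - 2)%N; move: m3; clear; lia.
have z i : (n < i)%N -> p`_i = 0 by move=> ni; rewrite nth_default // sp.
set K := a 1%N * b ^+ m + _ + _; set L := 2^-1 * a 0%N * b ^+ m.
have -> : (K *: 'X^(m - 2) + L *: 'X^(m.-1)) * ('X - b%:P) ^+ 2 =
  (L *: 'X^3 + (K - 2 * b * L) *: 'X^2 + (b ^+ 2 * L - 2 * b * K) *: 'X + (K * b ^+ 2)%:P) * 'X^k.
  rewrite mE /= subn2 /= exprSr -!mul_polyC !(rmorphM, rmorphXn, rmorph_nat, rmorphB) /=; ring.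
apply/leq_sizeP => i mi; rewrite coefB /qmix coef_mix coefMXn ltnNge; have ki : (k <= i)%N by move: mi; rewrite mE; clear; lia.
rewrite ki /= !coef_even_poly coef_odd_poly !coefD !coefZ coefX coefC !coefXn.
have pE j : (j <= n)%N -> p`_j = a (n - j)%N by move=> jn; rewrite -pa ?subKn // leq_subr.
have [j iE] : exists j, i = (k + j.+2)%N by exists (i - k.+2)%N; move: mi; rewrite mE; clear; lia.
rewrite iE addKn !addnS coef_odd_poly.
case: j iE => [|[|j]] iE; rewrite ?addn0.
- rewrite (pE k.+2.*2); last by rewrite nE mE; clear; lia.
  rewrite (pE k.+2.*2.+1); last by rewrite nE mE; clear; lia.
  rewrite (pE k.+1.*2.+1); last by rewrite nE mE; clear; lia.
  rewrite (_ : n - k.+2.*2 = 1)%N; last by rewrite nE mE; clear; lia.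
  rewrite (_ : n - k.+2.*2.+1 = 0)%N; last by rewrite nE mE; clear; lia.
  rewrite (_ : n - k.+1.*2.+1 = 2)%N; last by rewrite nE mE; clear; lia.
  by rewrite /K /L mE /= !exprS; field.
- rewrite addn1 (z k.+3.*2); last by rewrite nE mE; clear; lia.
  rewrite (z k.+3.*2.+1); last by rewrite nE mE; clear; lia.
  rewrite (pE k.+2.*2.+1); last by rewrite nE mE; clear; lia.
  rewrite (_ : n - k.+2.*2.+1 = 0)%N; last by rewrite nE mE; clear; lia.
  by rewrite /K /L mE /= !exprS; field.
rewrite !z /=; try by (rewrite nE mE; clear; lia).
by rewrite !(mul0r, mulr0, addr0, subr0).
Qed.

End RcorrGrowth.

(** * Order at infinity of R with the correction terms *)

Section SingularGrowth.
Variable R : realType.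
Local Notation C := (Cplx R).
Variables (X : riemann_surface R) (p : {poly C}) (H : hyperelliptic X p).
Variables (m n : nat) (sp : size p = n.+1) (nE : n = (2 * m).+1%N) (m1 : (0 < m)%N).
Local Notation x := (xcoord H).
Local Notation y := (ycoord H).
Local Notation oo := (infpt H).
Local Notation lc := (lead_coef p).
Variables (Th1 Thy : {poly C}) (c e : C) (a : nat -> C).
Hypothesis pa : forall k, (k <= n)%N -> nth 0 p (n - k) = a k.
Hypothesis sTh1 : (size (Th1 - theta_lead p n c e *: 'X^(n - 2))%R <= n - 2)%N.
Hypothesis sThy : (2 * size Thy + n <= 2 * (n - 3) + 2)%N || (Thy == 0).
Hypothesis gTh : growth H (2 * (n - 3)%N%:Z)
  (fun P => Theta Th1 Thy (x P) (y P) - theta_lead p n c e * x P ^+ (n - 2)).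
Variables (b y2 : C).

(** Either the terms with Theta^[y] are absent, or m is at least 3 and no exponent in [Rcorr] is
    truncated. *)
Lemma Thy_cases : Thy = 0 \/ (2 < m)%N /\ (size Thy <= (m - 3).+1)%N.
Proof.
move: sThy => /orP[|/eqP]; last by left.
have [->|h] := eqVneq Thy 0; first by left.
have : (0 < size Thy)%N by rewrite size_poly_gt0.
move: (size Thy) m1 => s; rewrite nE => k1 k2 k3; right; clear -k1 k2 k3; lia.
Qed.

(** The factor of Theta1^[y] in the correction terms with y2, present by symmetry. It has degree at
    most m + 1 in x1, and Theta^[y] at most m - 3, so the product just reaches the admissible 2m - 2
    = n - 3. *)
Definition cross_part : {poly C} :=
  (- (1 / 8 * a 1%N * y2 * b ^+ (m - 2) + 1 / 16 * a 0%N * y2 * b ^+ m.-1)) *: 'X^m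
  - (3 / 16 * a 0%N * y2 * b ^+ (m - 2)) *: 'X^(m.+1)
  - (1 / 16 * a 2%N * y2 * b ^+ (m - 2)) *: 'X^(m.-1).

Lemma size_cross_part : (size cross_part <= m.+2)%N.
Proof.
have s k (u : C) : (k <= m.+1)%N -> (size (u *: 'X^k) <= m.+2)%N.
  by move=> km; apply: leq_trans (size_scale_leq _ _) _; rewrite size_polyXn.
rewrite /cross_part.
apply: leq_trans (size_polyD _ _) _; rewrite geq_max size_polyN s ?andbT; last first.
  exact: leq_trans (leq_pred _) _.
apply: leq_trans (size_polyD _ _) _; rewrite geq_max size_polyN !s //.
Qed.

Lemma singular_growth : growth H (2 * (n - 3)%N%:Z)
  (fun P => Rsing p Th1 Thy c e (x P) (y P) b y2 + Rcorr n a Th1 Thy c e (x P) (y P) b y2).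
Proof.
have wE : 2 * (n - 3)%N%:Z = 4 * m%:Z - 4 by rewrite nE arith_n3.
have nm2 : n%:Z = 2 * m%:Z + 1 by rewrite nE; clear; lia.
have [m' mE] : exists m', m = m'.+1 by exists m.-1; rewrite prednK.
have mE' : m%:Z = m'%:Z + 1 by rewrite mE; clear; lia.
have sp' : (size p <= (2 * m).+2)%N by rewrite sp nE.
have i1 := growth_inv H b; have i2 := growthM i1 i1; have i4 := growthM i2 i2.
have gy := growth_y H sp.
have gq := growth_poly H (size_qmix b sp').
have dp : (size p^`() <= (2 * m).+1)%N.
  rewrite -ltnS; apply: leq_trans (lt_size_deriv _) _; rewrite -?size_poly_gt0 ?sp // nE.
  by [].
have sW := size_mix_part sp nE m1 sTh1 b; rewrite [X in (_ <= X)%N]mE in sW.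
have sV := size_lead_part sp nE m1 b; rewrite [X in (_ <= X)%N]nE in sV.
set W := _ + _ in sW; set V := p - _ in sV.
pose T k f := growth H k f -> k <= 4 * m%:Z - 4 -> growth H (2 * (n - 3)%N%:Z) f.
have W0 k f : T k f by rewrite /T wE; exact: growthW.
have t1 := W0 _ _ (growthZ (c / 4 * e * p.[b]) (growthM (growth_poly H (eq_leq sp)) i4)).
have t2 := W0 _ _ (growthZ (c / 4 * e * y2) (growthM (growthM gy gq) i4)).
have t3 := W0 _ _ (growthZ (c / 32 * e * p^`().[b]) (growthM (growth_poly H dp) i2)).
have t4 := W0 _ _ (growthZ y2 (growthM (growthM gy (growth_poly H sW)) i2)).
have t5 := W0 _ _ (growthZ (1 / 8 * Theta Th1 Thy b y2) (growthM (growth_poly H sV) i2)).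
have g7 : growth H (4 * m%:Z - 2) (fun P => Theta Th1 Thy (x P) (y P)).
  have sX : (size (theta_lead p n c e *: 'X^(n - 2)) <= (n - 2).+1)%N.
    by apply: leq_trans (size_scale_leq _ _) _; rewrite size_polyXn.
  have k1 : 2 * (n - 2)%N%:Z <= 4 * m%:Z - 2 by rewrite nE mE; clear; lia.
  have k2 : 2 * (n - 3)%N%:Z <= 4 * m%:Z - 2 by rewrite wE; clear; lia.
  have := growthD (growthW gTh k2) (growthW (growth_poly H sX) k1).
  by apply: growth_eq => P _; rewrite hornerZ hornerXn subrK.
have t6 := W0 _ _ (growthZ (1 / 8 * p.[b]) (growthM g7 i2)).
(* The term with [c / 64 (n^2 - 1) a0^2] serves here: it removes the leading part of Theta1 from -
   (1/8) a0 x2^(n-2) Theta1. *)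
have t7 := growthZ (- (1 / 8 * lc * b ^+ (n - 2))) gTh.
have g8 : growth H (2 * (n - 3)%N%:Z) (fun P => (1 / 8 * y2) *
     ((Thy.[x P] * (qmix p b).[x P]) * ((x P - b)^-1 * (x P - b)^-1))
   + (1 / 8 * Thy.[b]) * ((y P * (qmix p b - asym_part m a b * ('X - b%:P) ^+ 2).[x P])
       * ((x P - b)^-1 * (x P - b)^-1))
   + Thy.[x P] * cross_part.[x P]).
  case: Thy_cases => [->|[m3 sT]].
    apply: (growth_eq (phi := fun=> 0)) => [P _|]; first by rewrite !horner0 !(mul0r, mulr0) !addr0.
    apply: growthW (growth_cst _ _) _; rewrite wE mE'; clear; lia.
  have mE3 : (m - 3)%N%:Z = m%:Z - 3 by move: m3; clear; lia.
  have sY := size_asym_part sp nE pa b m3; rewrite [X in (_ <= X)%N]mE in sY.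
  have gT := growth_poly H sT; have gYm := growth_poly H sY.
  have t8 := W0 _ _ (growthZ (1 / 8 * y2) (growthM (growthM gT gq) i2)).
  have t9 := W0 _ _ (growthZ (1 / 8 * Thy.[b]) (growthM (growthM gy gYm) i2)).
  have t10 := W0 _ _ (growthM gT (growth_poly H size_cross_part)).
  apply: growthD; first apply: growthD.
  - by apply: t8; rewrite mE3; clear; lia.
  - by apply: t9; rewrite nm2 mE'; clear; lia.
  - by apply: t10; rewrite mE3; clear; lia.
have k1 : 2 * n%:Z + (-2 + -2 + (-2 + -2)) <= 4 * m%:Z - 4 by rewrite nm2; clear; lia.
have k2 : n%:Z + 2 * m.+1%:Z + (-2 + -2 + (-2 + -2)) <= 4 * m%:Z - 4.
  by rewrite nm2 mE; clear; lia.
have k3 : 2 * (2 * m)%N%:Z + (-2 + -2) <= 4 * m%:Z - 4 by clear; lia.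
have k4 : n%:Z + 2 * m'%:Z + (-2 + -2) <= 4 * m%:Z - 4 by rewrite nm2 mE'; clear; lia.
have k6 : 4 * m%:Z - 2 + (-2 + -2) <= 4 * m%:Z - 4 by clear; lia.
have := growthD (growthD (growthD (growthD (t1 k1) (t2 k2)) (growthD (t3 k3) (t4 k4)))
  (growthD (growthD (t5 k3) (t6 k6)) t7)) g8.
apply: (growth_large (N := nm b + 1)) => P Pf PM.
have d0 : x P - b != 0.
  by rewrite -nm_gt0; have := nmB_ge (x P) b; lra.
have lcE' : lc = a 0%N by rewrite lead_coefE sp -pa // subn0.
have e5 : ((n - 5)./2 = m - 2)%N by rewrite nE; clear; lia.
have e3 : ((n - 3)./2 = m.-1)%N by rewrite nE; clear; lia.
have e1 : ((n - 1)./2 = m)%N by rewrite nE; clear; lia.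
have e'1 : ((n + 1)./2 = m.+1)%N by rewrite nE; clear; lia.
rewrite RsingE /Rcorr e5 e3 e1 e'1 /W /V /asym_part /cross_part /theta_lead lcE'.
move: (qmix p b) (rmix p b) (qmix Th1 b) => q r t.
rewrite !(hornerXsubC, hornerXn, hornerX, horner_exp, hornerD, hornerN, hornerZ, hornerM).
rewrite /Theta; move: p.[x P] p.[b] q.[x P] r.[x P] t.[x P]
  p^`().[x P] p^`().[b] Thy.[x P] Thy.[b] Th1.[x P] Th1.[b].
move: (x P ^+ (n - 2)) (b ^+ (n - 2)) (x P ^+ (m - 2)) (b ^+ (m - 2))
 (x P ^+ m.-1) (b ^+ m.-1) (x P ^+ m.+1) (b ^+ m.+1) (x P ^+ m) (b ^+ m) (y P) (n%:R : C).
by move: (x P - b) d0 => d d0 *; field.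
Qed.

End SingularGrowth.

(** * Simple roots and divisibility by p *)

Section SimpleRoots.
Variable R : realType.
Local Notation C := (Cplx R).
Variable p : {poly C}.
Hypothesis p0 : p != 0.
Hypothesis hsimple : forall b : C, (mup b p <= 1)%N.

Lemma deriv_root_neq0 b : p.[b] = 0 -> p^`().[b] != 0.
Proof.
move=> pb; apply/negP => /eqP dpb; have [D DE] := double_root pb dpb.
have := hsimple b; rewrite mup_leq // DE => /negP; apply.
exact: dvdp_mulr.
Qed.

Lemma simple_roots_seq : exists2 rs : seq C, (forall b, (p.[b] == 0) = (b \in rs)) &
  forall E : {poly C}, (forall b, p.[b] = 0 -> E.[b] = 0) -> exists D, E = p * D.
Proof.
have [rs pE] := closed_field_poly_normal p.
have l0 : lead_coef p != 0 by rewrite lead_coef_eq0.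
have rootE b : (p.[b] == 0) = (b \in rs).
  by rewrite -[_ == 0]/(root p b) pE rootZ // root_prod_XsubC.
have urs : uniq rs.
  apply/count_mem_uniq => b; have := hsimple b.
  rewrite pE -mul_polyC mupMr ?rootC // mu_prod_XsubC.
  by rewrite -has_pred1 has_count; case: (count_mem b rs) => [|[|k]].
exists rs => // E hE.
have [|D ->] := @uniq_roots_prod_XsubC _ E rs _ (etrans (uniq_rootsE rs) urs).
  by apply/allP => b brs; apply/rootP/hE/eqP; rewrite rootE.
exists ((lead_coef p)^-1 *: D); rewrite {1}pE -scalerAl -scalerAr scalerA divff // scale1r.
by rewrite mulrC.
Qed.

End SimpleRoots.

(** * Pole-free functions on the curve are A(x) + y B(x) *)

Section AlgebraicFunctions.
Variable R : realType.
Local Notation C := (Cplx R).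
Variables (X : riemann_surface R) (p : {poly C}) (H : hyperelliptic X p).
Variables (m n : nat) (sp : size p = n.+1) (nE : n = (2 * m).+1%N).
Hypothesis hsimple : forall b : C, (mup b p <= 1)%N.
Local Notation x := (xcoord H).
Local Notation y := (ycoord H).
Local Notation oo := (infpt H).

(** Points with the abscissa of [P0] are left out: over the abscissa of the fixed second point, the
    formulas concerned divide by zero. *)
Definition bounded_around (phi : X -> C) P0 := exists M : R,
  \forall P \near P0, generic H P -> x P <> x P0 -> nm (phi P) <= M.

Lemma bounded_aroundD phi psi P0 : bounded_around phi P0 -> bounded_around psi P0 ->
  bounded_around (fun P => phi P + psi P) P0.
Proof.
move=> [M hM] [N hN]; exists (M + N); apply: filterS2 hM hN => P hM hN gP xP.
by apply: le_trans (nmD _ _) _; rewrite lerD ?hM ?hN.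
Qed.

Lemma bounded_aroundM phi psi P0 : bounded_around phi P0 -> bounded_around psi P0 ->
  bounded_around (fun P => phi P * psi P) P0.
Proof.
move=> [M hM] [N hN]; exists (M * N); apply: filterS2 hM hN => P hM hN gP xP.
by rewrite nmM ler_pM ?hM ?hN.
Qed.

Lemma bounded_around_cst (a : C) P0 : bounded_around (fun=> a) P0.
Proof. by exists (nm a); apply: nearW. Qed.

Lemma bounded_aroundN phi P0 : bounded_around phi P0 -> bounded_around (fun P => - phi P) P0.
Proof. by move=> [M hM]; exists M; apply: filterS hM => P; rewrite nmN. Qed.

Lemma bounded_aroundX phi k P0 : bounded_around phi P0 -> bounded_around (fun P => phi P ^+ k) P0.
Proof.
move=> h; elim: k => [|k IH]; first by exists 1; apply: nearW => P _ _; rewrite expr0 nm1.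
have [M hM] := bounded_aroundM h IH; exists M.
by apply: filterS hM => P; rewrite exprS.
Qed.

Lemma bounded_around_y P0 : P0 <> oo -> bounded_around y P0.
Proof.
move=> Pf; exists (nm (y P0) + 1).
apply: filterS (y_near Pf (nm_near (y P0) (@ltr01 R))) => P hP _ _.
by have := nmD (y P - y P0) (y P0); rewrite subrK; lra.
Qed.

Lemma bounded_around_comp_x (f : C -> C) P0 : P0 <> oo -> bounded_at f (x P0) ->
  bounded_around (fun P => f (x P)) P0.
Proof.
move=> Pf [M /nm_dnbhs[d d0 hM]]; exists M.
apply: filterS (x_near Pf (nm_near (x P0) d0)) => P hP _ /eqP xP; exact: hM.
Qed.

Lemma sect_xcoord P0 : generic H P0 -> \forall P \near P0, sect H P0 (x P) = P.
Proof.
move=> gP; have [Pf px] := gP; have [az zP hz] := xchartP Pf px.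
apply: filterS (dom_near zP) => P zP'; have [_ <-] := hz _ zP'.
by rewrite /sect coordK.
Qed.

Lemma bounded_around_sect phi P0 : generic H P0 ->
  bounded_at (fun t => phi (sect H P0 t)) (x P0) -> bounded_around phi P0.
Proof.
move=> gP hb; have [Pf _] := gP; have [M hM] := bounded_around_comp_x Pf hb.
by exists M; apply: filterS2 hM (sect_xcoord gP) => P h e gP' xP; rewrite -e h.
Qed.

(* No poles at finite points; over S and at the branch points this is only
   asserted as boundedness, which suffices by the removable singularities in
   [liouville_polynomial]. *)
Record pole_free (phi : X -> C) (S : seq C) := PoleFree {
  pole_free_expands2 : forall P, generic H P -> x P \notin S ->
    expands2 (fun t => phi (sect H P t)) (x P);
  pole_free_bounded : forall P, P <> oo -> (p.[x P] = 0 \/ x P \in S) -> bounded_around phi P }.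

Lemma pole_freeM phi psi S : pole_free phi S -> pole_free psi S ->
  pole_free (fun P => phi P * psi P) S.
Proof.
move=> [h1 h2] [k1 k2]; split; first by move=> P gP xP; apply: expands2M; [exact: h1|exact: k1].
by move=> P Pf h; apply: bounded_aroundM; [exact: h2|exact: k2].
Qed.

Lemma pole_free_y S : pole_free y S.
Proof.
split; first by move=> P gP _; exact: sect_y_expands2.
by move=> P Pf _; exact: bounded_around_y.
Qed.

Lemma p_neq0 : p != 0.
Proof. by rewrite -size_poly_gt0 sp. Qed.

Lemma bounded_at_trace phi S b : pole_free phi S -> p.[b] = 0 \/ b \in S ->
  bounded_at (trace H phi) b.
Proof.
move=> [_ h2] hb; have [rs rsE _] := simple_roots_seq p_neq0 hsimple.
apply: trace_bounded_at => P0 Pf xP0; have [|M hM] := h2 P0 Pf; first by rewrite xP0.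
exists M; have /nm_dnbhs[d d0 hd] := near_notin rs (x P0).
apply: filterS2 hM (x_near Pf (nm_near (x P0) d0)) => P h hx Pf' xP.
have xP' : x P != x P0 by rewrite xP0; apply/eqP.
apply: h; last exact/eqP.
by split => //; rewrite rsE; exact: hd.
Qed.

Lemma trace_polynomial phi S k : pole_free phi S -> growth H (2 * k%:Z) phi ->
  exists2 A : {poly C}, (size A <= k.+1)%N &
    forall P, generic H P -> x P \notin S -> phi P + phi (invol H P) = A.[x P].
Proof.
move=> hp [K [M hK]].
have [rs rsE _] := simple_roots_seq p_neq0 hsimple.
have [||| A sA hA] := @liouville_polynomial R k.+1 (trace H phi) (rs ++ S).
- move=> t; rewrite mem_cat negb_or => /andP[trs tS].
  have [P [Pf xP]] := pt_over H t.
  have gP : generic H P by split; rewrite // xP rsE.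
  have [If xI yI] := involP Pf; have gI := generic_invol gP.
  rewrite -xP; apply: trace_expands2 => //; first by apply: (pole_free_expands2 hp); rewrite ?xP.
  by rewrite -xI; apply: (pole_free_expands2 hp); rewrite ?xI ?xP.
- move=> s; rewrite mem_cat -rsE => hs; apply: (bounded_at_trace hp).
  by case/orP: hs => [/eqP|]; [left|right].
- exists (2 * (`|K| + 1)), M => a aM _.
  have [P [Pf xP]] := pt_over H a; have [If xI yI] := involP Pf.
  have h Q : Q <> oo -> x Q = a -> nm (phi Q) <= (`|K| + 1) * nm a ^+ k.
    move=> Qf xQ; have := hK Q Qf; rewrite xQ => /(_ aM).
    rewrite exprz_double => hQ.
    rewrite -(@ler_pXn2r _ 2%N) ?nnegrE // ?mulr_ge0 ?addr_ge0 ?exprn_ge0 //.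
    apply: le_trans hQ _; rewrite exprMn ler_wpM2r ?exprn_ge0 ?exprn_ge0 //.
    by apply: le_trans (ler_norm K) _; have := normr_ge0 K; nra.
  rewrite -[in nm (trace _ _ _)]xP traceE // exprSr mulrA ler_wpM2r //.
  apply: le_trans (nmD _ _) _; have := h P Pf xP; have := h _ If (etrans xI xP).
  by rewrite -mulrA; lra.
exists A => // P gP xP; have [Pf px] := gP.
by rewrite -hA ?traceE // mem_cat negb_or -rsE px xP.
Qed.

Lemma vanishing_at_root (E : {poly C}) (g : C -> C) b : p.[b] = 0 -> bounded_at g b ->
  (\forall t \near b^', E.[t] = p.[t] * g t) -> E.[b] = 0.
Proof.
move=> pb [M hM] hE; apply/eqP/negPn/negP => Eb.
have n0 : 0 < nm E.[b] / 2 by rewrite divr_gt0 // nm_gt0.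
have M0 : 0 < `|M| + 1 by have := normr_ge0 M; lra.
have /expands2_continuous /nm_continuousP /(_ _ n0) /nm_nbhs[d1 d10 h1] := expands2_poly E b.
have /expands2_continuous /nm_continuousP /(_ _ (divr_gt0 n0 M0)) /nm_nbhs[d2 d20 h2] := expands2_poly p b.
have [d3 d30 h3] := (nm_dnbhs _ _).1 (filterI hM hE).
pose r := Num.min d1 (Num.min d2 d3) / 2.
have mn0 : 0 < Num.min d1 (Num.min d2 d3) by rewrite !lt_min d10 d20 d30.
have r0 : 0 < r by rewrite divr_gt0.
have : r < Num.min d1 (Num.min d2 d3) by rewrite /r; lra.
rewrite !lt_min => /and3P[rd1 rd2 rd3].
have nr : nm (ofR r : C) = r by rewrite nm_ofR gtr0_norm.
have e : b + ofR r - b = ofR r by rewrite addrC addKr.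
have tb : b + ofR r != b by rewrite -subr_eq0 e -nm_gt0 nr.
have := h1 (b + ofR r); rewrite e nr => /(_ rd1) k1.
have := h2 (b + ofR r); rewrite e nr pb subr0 => /(_ rd2) k2.
have := h3 (b + ofR r) tb; rewrite e nr => /(_ rd3) [k3 k4].
move: k1; rewrite k4 => k1.
have := nmB_ge E.[b] (E.[b] - p.[b + ofR r] * g (b + ofR r)).
rewrite (nmC E.[b] (_ * _)) (_ : E.[b] - (_ - _) = p.[b + ofR r] * g (b + ofR r)); last by ring.
rewrite nmM => k5.
move: k2; rewrite ltr_pdivlMr // => k2.
have : nm p.[b + ofR r] * nm (g (b + ofR r)) <= nm p.[b + ofR r] * (`|M| + 1).
  by rewrite ler_wpM2l //; apply: le_trans k3 _; have := ler_norm M; lra.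
lra.
Qed.

(** The traces of phi and of y phi are polynomials A and E. Since y (phi - phi') = E for the
    conjugate value phi', the difference phi - phi' is y E / p, and the point is that p divides
    E. *)
Lemma algebraic_function phi S k : pole_free phi S -> growth H (2 * k%:Z) phi ->
  exists A B : {poly C}, [/\ (size A <= k.+1)%N, (2 * size B + n <= 2 * k + 2)%N || (B == 0) &
    forall P, generic H P -> x P \notin S -> phi P = A.[x P] + y P * B.[x P]].
Proof.
move=> hp hg.
have [rs rsE rsD] := simple_roots_seq p_neq0 hsimple.
have [A sA hA] := trace_polynomial hp hg.
have gyphi : growth H (2 * (m.+1 + k)%N%:Z) (fun P => y P * phi P).
  by apply: growthW (growthM (growth_y H sp) hg) _; rewrite nE; clear; lia.
have [E sE hE] := trace_polynomial (pole_freeM (pole_free_y S) hp) gyphi.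
have [D ED] : exists D, E = p * D.
  apply: rsD => b pb.
  (* From (phi - phi')^2 = 2 (phi^2 + phi'^2) - (phi + phi')^2 one gets E^2 = p g. As [g] is bounded
     at the roots of p, E vanishes there, and the roots are simple. *)
  pose g t := 2 * trace H (fun P => phi P * phi P) t - A.[t] ^+ 2.
  have gb : bounded_at g b.
    have h1 := bounded_at_trace (pole_freeM hp hp) (or_introl pb).
    have h2 := expands2_bounded_at (expands2N (expands2X 2 (expands2_poly A b))).
    apply: bounded_atD h2.
    by apply: (bounded_atM _ h1); exact/expands2_bounded_at/expands2_cst.
  have : (E ^+ 2).[b] = 0.
    apply: (vanishing_at_root pb gb).
    apply: filterS (near_notin (rs ++ S) b) => t.
    rewrite mem_cat negb_or => /andP[trs tS].
    have [P [Pf xP]] := pt_over H t.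
    have gP : generic H P by split; rewrite // xP rsE.
    have [If xI yI] := involP Pf.
    have tS' : x P \notin S by rewrite xP.
    rewrite horner_exp /g -xP -(hE P gP tS') -(hA P gP tS') traceE // yI -(curve_eq Pf).
    ring.
  by rewrite horner_exp => /eqP; rewrite expf_eq0 => /andP[_ /eqP].
have AB P : generic H P -> x P \notin S ->
    phi P = (2^-1 *: A).[x P] + y P * (2^-1 *: D).[x P].
  move=> gP xP; have [Pf px] := gP; have [If xI yI] := involP Pf.
  have y0 : y P != 0 by rewrite y_eq0.
  have h1 := hA P gP xP; have := hE P gP xP; rewrite ED hornerM -(curve_eq Pf) yI => h2.
  have {}h2 : phi P - phi (invol H P) = y P * D.[x P].
    by apply: (mulfI y0); rewrite mulrBr -mulNr h2; ring.
  by rewrite !hornerZ -h1 mulrCA -h2; field.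
exists (2^-1 *: A), (2^-1 *: D); split => //.
  exact: leq_trans (size_scale_leq _ _) sA.
apply: (growth_y_inv (H := H) sp nE).
have sA2 : (size (2^-1 *: A) <= k.+1)%N by exact: leq_trans (size_scale_leq _ _) sA.
have [M hM] := large_generic H sp nE.
apply: (@growth_large _ _ _ _ _ _ _ (Num.max M (1 + \sum_(s <- S) nm s)) _
  (growthB hg (growth_poly H sA2))) => P Pf.
rewrite ge_max => /andP[/(hM _ Pf) gP PS].
have xS : x P \notin S.
  apply/negP => xS; move: PS; rewrite [in X in 1 + X](big_rem _ xS) /=.
  have : 0 <= \sum_(s <- rem (x P) S) nm s by rewrite sumr_ge0.
  lra.
by rewrite AB // addrC addKr.
Qed.

Lemma algebraic_function_unique (A B A' B' : {poly C}) (S : seq C) :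
  (forall P, generic H P -> x P \notin S ->
     A.[x P] + y P * B.[x P] = A'.[x P] + y P * B'.[x P]) -> A = A' /\ B = B'.
Proof.
move=> h; have [rs rsE _] := simple_roots_seq p_neq0 hsimple.
have key a : a \notin rs ++ S -> A.[a] = A'.[a] /\ B.[a] = B'.[a].
  rewrite mem_cat negb_or => /andP[ars aS]; have [P [Pf xP]] := pt_over H a.
  have gP : generic H P by split; rewrite // xP rsE.
  have [If xI yI] := involP Pf; have gI := generic_invol gP.
  have y0 : y P != 0 by rewrite y_eq0 // xP rsE.
  have h1 := h P gP; have h2 := h _ gI; rewrite xI yI xP in h2; rewrite xP in h1.
  have {}h1 := h1 aS; have {}h2 := h2 aS.
  have eA : A.[a] = A'.[a].
    have : 2 * A.[a] = 2 * A'.[a].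
      transitivity ((A.[a] + y P * B.[a]) + (A.[a] + - y P * B.[a])); first by ring.
      by rewrite h1 h2; ring.
    by apply: mulfI; rewrite pnatr_eq0.
  split => //; apply: (mulfI y0); apply: (addrI A.[a]); rewrite h1 eA //.
by split; apply: (@poly_eq_everywhere _ _ _ (rs ++ S)) => a /key[].
Qed.

End AlgebraicFunctions.

(** * The remainder after subtraction of R and the correction terms *)

Section RegularPart.
Variable R : realType.
Local Notation C := (Cplx R).
Variables (X : riemann_surface R) (p : {poly C}) (H : hyperelliptic X p).
Variables (m n : nat) (sp : size p = n.+1) (nE : n = (2 * m).+1%N) (m1 : (0 < m)%N).
Hypothesis hsimple : forall b : C, (mup b p <= 1)%N.
Variables (F : cft R) (T : F) (c : C) (hT : is_virasoro T c).
Variables (B : field_bundle F X) (corr : seq (insertion B) -> C).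
Hypothesis hcorr : is_state corr.
Hypothesis hcov : virasoro_covariant T c corr.
Hypothesis h1 : corr [::] <> 0.
Variables (Th1 Thy : {poly C}) (a : nat -> C).
Local Notation x := (xcoord H).
Local Notation y := (ycoord H).
Local Notation oo := (infpt H).
Local Notation e := (corr [::]).
Local Notation tau := (T1 H T corr).
Hypothesis hTheta : forall P, generic H P ->
  p.[x P] * tau P = c / 32 * (p^`().[x P] ^+ 2 / p.[x P]) * e + 1 / 4 * Theta Th1 Thy (x P) (y P).
Hypothesis pa : forall k, (k <= n)%N -> nth 0 p (n - k) = a k.
Implicit Types P Q : X.

Lemma T1_growth : growth H (-6) (fun P => tau P - c / 32 * e * x P ^- 2).
Proof.
have [K hK] := T1_infinity H hcorr hcov.
have [M hM] := proper_at_infty hK; have [N hN] := large_generic H sp nE.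
exists (K ^+ 2), (Num.max M N) => P Pf; rewrite ge_max => /andP[/(hM _ Pf) {}hM /(hN _ Pf) gP].
rewrite (_ : -6 = - (2 * 3%:Z)) // exprz_doubleN.
rewrite (_ : K ^+ 2 * _ = (K * nm (x P) ^- 3) ^+ 2); last by rewrite -exprVn -exprMn.
by have := hM gP; move: (nm_ge0 (tau P - c / 32 * e * x P ^- 2)); rewrite !expr2 => k1 k2; apply: ler_pM.
Qed.

Lemma TTc_growth Q : generic H Q -> growth H (-6) (fun P => TTc H T corr P Q).
Proof.
move=> gQ; have [K hK] := TTc_infinity hcorr hcov h1 gQ.
have [M hM] := proper_at_infty hK; have [N hN] := large_generic H sp nE.
exists (K ^+ 2), (Num.max M N) => P Pf; rewrite ge_max => /andP[/(hM _ Pf) {}hM /(hN _ Pf) gP].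
rewrite (_ : -6 = - (2 * 3%:Z)) // exprz_doubleN.
rewrite (_ : K ^+ 2 * _ = (K * nm (x P) ^- 3) ^+ 2); last by rewrite -exprVn -exprMn.
by have := hM gP; move: (nm_ge0 (TTc H T corr P Q)); rewrite !expr2 => k1 k2; apply: ler_pM.
Qed.

Definition sing P Q := Rsing p Th1 Thy c e (x P) (y P) (x Q) (y Q).
Definition asym P Q := Rcorr n a Th1 Thy c e (x P) (y P) (x Q) (y Q).
Definition regular_part P Q :=
  e * (TTc H T corr P Q * (p.[x P] * p.[x Q])) - sing P Q - asym P Q.

Lemma regular_part_growth Q : generic H Q ->
  growth H (2 * (n - 3)%N%:Z) (fun P => regular_part P Q).
Proof.
move=> gQ.
have s1 := size_Th1 sp nE m1 T1_growth hTheta.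
have s2 := size_Thy sp nE m1 T1_growth hTheta.
have s3 := Theta_growth sp nE m1 T1_growth hTheta.
have h2 := singular_growth sp nE m1 pa s1 s2 s3 (x Q) (y Q).
have hn : -6 + 2 * n%:Z <= 2 * (n - 3)%N%:Z by move: m1; rewrite nE; clear; lia.
have h3 := growthZ (e * p.[x Q]) (growthW (growthM (TTc_growth gQ) (growth_poly H (eq_leq sp))) hn).
apply: growth_eq (growthB h3 h2) => P _; rewrite /regular_part /sing /asym; ring.
Qed.

Lemma Rcorr_expands2 (Y : C -> C) b y2 x0 : expands2 Y x0 ->
  expands2 (fun t => Rcorr n a Th1 Thy c e t (Y t) b y2) x0.
Proof. by move=> hY; rewrite /Rcorr /Theta; expand2 hY. Qed.

Ltac bound2 hx hy hp hd := lazymatch goal with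
  | |- bounded_around _ (fun P => @GRing.add _ (@?f P) (@?g P)) _ =>
      apply (@bounded_aroundD _ _ _ _ f g); bound2 hx hy hp hd
  | |- bounded_around _ (fun P => @GRing.opp _ (@?f P)) _ =>
      apply (@bounded_aroundN _ _ _ _ f); bound2 hx hy hp hd
  | |- bounded_around _ (fun P => @GRing.mul _ (@?f P) (@?g P)) _ =>
      apply (@bounded_aroundM _ _ _ _ f g); bound2 hx hy hp hd
  | |- bounded_around _ (fun P => @GRing.exp _ (@?f P) ?k) _ =>
      apply (@bounded_aroundX _ _ _ _ f k); bound2 hx hy hp hd
  | |- bounded_around _ (fun P => horner ?q (xcoord _ P)) _ => exact (hp q)
  | |- _ => first [exact (bounded_around_cst _ _ _) | exact hx | exact hy | exact hd]
  end.

Lemma bounded_around_x P0 : P0 <> oo -> bounded_around H x P0.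
Proof.
by move=> Pf; apply: (bounded_around_comp_x (f := id) Pf); exact/expands2_bounded_at/expands2_id.
Qed.

Lemma bounded_around_poly (A : {poly C}) P0 : P0 <> oo -> bounded_around H (fun P => A.[x P]) P0.
Proof.
move=> Pf; apply: (bounded_around_comp_x (f := fun t => A.[t]) Pf).
exact/expands2_bounded_at/expands2_poly.
Qed.

Lemma bounded_around_asym P0 Q : P0 <> oo -> bounded_around H (fun P => asym P Q) P0.
Proof.
move=> Pf; have k1 := bounded_around_y Pf; have k2 := bounded_around_x Pf.
have k3 A := bounded_around_poly A Pf.
by rewrite /asym /Rcorr /Theta; bound2 k2 k1 k3 k1.
Qed.

Lemma bounded_around_sing P0 Q : P0 <> oo -> x P0 <> x Q -> bounded_around H (fun P => sing P Q) P0.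
Proof.
move=> Pf PQ; have k1 := bounded_around_y Pf; have k2 := bounded_around_x Pf.
have k3 A := bounded_around_poly A Pf.
have k4 : bounded_around H (fun P => (x P - x Q)^-1) P0.
  apply: (bounded_around_comp_x (f := fun t => (t - x Q)^-1) Pf).
  apply: expands2_bounded_at; apply: expands2V; first by rewrite subr_eq0; exact/eqP.
  exact: expands2B (expands2_id _) (expands2_cst _ _).
pose d P := (x P - x Q)^-1.
have [M hM] : bounded_around H (fun P =>
  c / 4 * e * ((p.[x P] * p.[x Q] + y P * y Q * (qmix p (x Q)).[x P]) * d P ^+ 4)
  + c / 32 * e * ((p^`().[x P] * p^`().[x Q] + y P * y Q * (rmix p (x Q)).[x P]) * d P ^+ 2)
  + 1 / 8 * ((p.[x P] * Theta Th1 Thy (x Q) (y Q) + p.[x Q] * (Th1.[x P] + y P * Thy.[x P])) * d P ^+ 2)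
  + 1 / 8 * (y P * Thy.[x Q] + y Q * Thy.[x P]) * ((qmix p (x Q)).[x P] * d P ^+ 2)
  + 1 / 4 * (y P * y Q) * ((qmix Th1 (x Q)).[x P] * d P ^+ 2)) P0.
  bound2 k2 k1 k3 k4.
by exists M; apply: filterS hM => P; rewrite /sing RsingE /d !exprVn.
Qed.

Lemma y_sect_sqr P0 : generic H P0 -> \forall t \near x P0, y (sect H P0 t) ^+ 2 = p.[t].
Proof.
move=> gP; apply: cnearS (sect_near gP (generic_near gP)) => t [_ _ tf xt].
by rewrite curve_eq // xt.
Qed.

Lemma regular_part_sect P0 Q : generic H P0 -> \forall t \near x P0,
  regular_part (sect H P0 t) Q = e * (TTc H T corr (sect H P0 t) Q * (p.[t] * p.[x Q]))
   - Rsing p Th1 Thy c e t (y (sect H P0 t)) (x Q) (y Q)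
   - Rcorr n a Th1 Thy c e t (y (sect H P0 t)) (x Q) (y Q).
Proof.
move=> gP; apply: cnearS (sect_near gP (generic_near gP)) => t [_ _ tf xt].
by rewrite /regular_part /sing /asym xt.
Qed.

Lemma regular_part_bounded_diag Q : generic H Q -> bounded_around H (fun P => regular_part P Q) Q.
Proof.
move=> gQ; have [Qf qx] := gQ; apply: bounded_around_sect => //.
have hY := sect_y_expands2 gQ.
have [M hM] := TTc_ope hT hcorr hcov h1 gQ.
have y0 : y Q != 0 by rewrite y_eq0.
have k1 := @Rsing_bounded_same_sheet _ p Th1 Thy c e (x Q) (y Q) _ y0 (curve_eq Qf) hY (y_sect_sqr gQ).
rewrite sectK // in k1; have {}k1 := k1 erefl.
have k2 := expands2_bounded_at (Rcorr_expands2 (x Q) (y Q) hY).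
pose L t := e * TTc H T corr (sect H Q t) Q -
  (c / 2 * e / (t - x Q) ^+ 4 + (tau (sect H Q t) + tau Q) / (t - x Q) ^+ 2).
have kL : bounded_at L (x Q) by exists M.
have kp : bounded_at (fun t => p.[t] * p.[x Q]) (x Q).
  by apply: expands2_bounded_at; apply: expands2M (expands2_poly p _) (expands2_cst _ _).
have kN (f : C -> C) : bounded_at f (x Q) -> bounded_at (fun t => - f t) (x Q).
  by move=> [K hK]; exists K; apply: filterS hK => t; rewrite nmN.
have := bounded_atD (bounded_atD (bounded_atM kL kp) (kN _ k1)) (kN _ k2).
apply: bounded_at_near.
have n1 := near_dnear (sect_near gQ (generic_near gQ)).
apply: filterS2 n1 (near_dnear (regular_part_sect Q gQ)) => t [gt zt tf xt] ->.
have ht := hTheta gt; have hq := hTheta gQ; rewrite xt in ht.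
have [_ pt0] := gt; rewrite xt in pt0.
rewrite /L /ope_part.
(* Solving [hTheta] for Theta turns [ope_part] into the pole of the OPE times p1 p2: the terms p'^2
   / p cancel. *)
have -> : Theta Th1 Thy t (y (sect H Q t)) = 4 * (p.[t] * tau (sect H Q t)
    - c / 32 * (p^`().[t] ^+ 2 / p.[t]) * e) by rewrite ht; field.
have -> : Theta Th1 Thy (x Q) (y Q) = 4 * (p.[x Q] * tau Q
    - c / 32 * (p^`().[x Q] ^+ 2 / p.[x Q]) * e) by rewrite hq; field.
move: (Rsing _ _ _ _ _ _ _ _ _) (Rcorr _ _ _ _ _ _ _ _ _ _) (TTc _ _ _ _ _) => r r' u.
move: p.[t] p.[x Q] p^`().[t] p^`().[x Q] (tau _) (tau Q) pt0 qx => P1 P2 D1 D2 u1 u2 n10 n20.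
have [->|tb] := eqVneq t (x Q); first by rewrite subrr !expr0n /= !invr0; ring.
have : t - x Q != 0 by rewrite subr_eq0.
by move: (t - x Q) => d d0; field; rewrite d0 n10 n20.
Qed.

Lemma regular_part_bounded_opposite Q : generic H Q ->
  bounded_around H (fun P => regular_part P Q) (invol H Q).
Proof.
move=> gQ; have [Qf qx] := gQ; have [If xI yI] := involP Qf; have gI := generic_invol gQ.
have y0 : y Q != 0 by rewrite y_eq0.
apply: bounded_around_sect => //.
have IQ : invol H Q <> Q.
  move=> h; move: yI; rewrite h => /eqP; rewrite -subr_eq0 opprK -mulr2n -mulr_natr mulf_eq0.
  by rewrite (negbTE y0) pnatr_eq0.
have hY := sect_y_expands2 gI.
have k0 := TTc_expands2 hcorr hcov gI IQ.
have yS := y_sect_sqr gI; rewrite xI in hY yS k0 *.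
have k1 := @Rsing_bounded_opposite_sheet _ p Th1 Thy c e (x Q) (y Q) _ y0 (curve_eq Qf) hY yS.
rewrite -[in sect H _ (x Q)]xI sectK // in k1; have {}k1 := k1 yI.
have k2 := expands2_bounded_at (Rcorr_expands2 (x Q) (y Q) hY).
have kN (f : C -> C) : bounded_at f (x Q) -> bounded_at (fun t => - f t) (x Q).
  by move=> [K hK]; exists K; apply: filterS hK => t; rewrite nmN.
have k3 : bounded_at (fun t => e * (TTc H T corr (sect H (invol H Q) t) Q * (p.[t] * p.[x Q]))) (x Q).
  by apply: expands2_bounded_at; expand2 k0.
have := bounded_atD (bounded_atD k3 (kN _ k1)) (kN _ k2).
apply: bounded_at_near; have := regular_part_sect Q gI; rewrite xI.
by move=> /near_dnear; apply: filterS => t.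
Qed.

Lemma regular_part_pole_free Q : generic H Q ->
  pole_free H (fun P => regular_part P Q) [:: x Q].
Proof.
move=> gQ; have [Qf qx] := gQ; split.
  move=> P gP; rewrite inE => PQ.
  have PQ' : P <> Q by move=> h; rewrite h eqxx in PQ.
  have hY := sect_y_expands2 gP; have k0 := TTc_expands2 hcorr hcov gP PQ'.
  have k1 := @Rsing_expands2 _ p Th1 Thy c e (x Q) (y Q) (x P) _ PQ hY.
  have k2 := Rcorr_expands2 (x Q) (y Q) hY.
  have k3 : expands2 (fun t => e * (TTc H T corr (sect H P t) Q * (p.[t] * p.[x Q]))) (x P).
    by expand2 k0.
  apply: expands2_eq (expands2B (expands2B k3 k1) k2).
  by apply: cnearS (regular_part_sect Q gP) => t ->.
move=> P Pf hP.
(* As [Q] is generic, a branch point does not lie over [x Q]; so [sing] is bounded there, and the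
   factor p tames the two-point function. *)
have [pP|pP] := eqVneq p.[x P] 0.
  have PQ : x P <> x Q by move=> h; rewrite h in pP; rewrite pP eqxx in qx.
  have dp : p^`().[x P] != 0 by apply: deriv_root_neq0 => //; exact: p_neq0 sp.
  have [M hM] := TTc_bounded_branch hcorr hcov h1 Pf pP dp gQ.
  have k0 : bounded_around H (fun P => TTc H T corr P Q * p.[x P]) P.
    by exists M; apply: filterS hM => P' h gP' _; exact: h.
  have k1 := bounded_around_sing Pf PQ; have k2 := bounded_around_asym Q Pf.
  have [N hN] := bounded_aroundD (bounded_aroundD (bounded_aroundM (bounded_around_cst H e P)
    (bounded_aroundM k0 (bounded_around_cst H p.[x Q] P))) (bounded_aroundN k1)) (bounded_aroundN k2).
  exists N; apply: filterS hN => P' h gP' xP'; apply: le_trans (h gP' xP').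
  by rewrite /regular_part -mulrA.
case: hP => [/eqP h|]; first by rewrite h in pP.
rewrite inE => /eqP xP; have [->|->] := same_x Pf Qf xP.
  exact: regular_part_bounded_diag.
exact: regular_part_bounded_opposite.
Qed.

Lemma TTc_sym P Q : P <> Q -> TTc H T corr P Q = TTc H T corr Q P.
Proof.
move=> PQ; rewrite /TTc (corr_swap hcorr); first by rewrite [corr [:: _] * _]mulrC.
by rewrite /= inE andbT; apply/eqP.
Qed.

Lemma Rsing_sym (x1 y1 x2 y2 : C) :
  Rsing p Th1 Thy c e x1 y1 x2 y2 = Rsing p Th1 Thy c e x2 y2 x1 y1.
Proof.
rewrite /Rsing (mulrC x2 x1) (mulrC y2 y1) (addrC x2 x1).
rewrite (_ : (x2 - x1) ^+ 4 = (x1 - x2) ^+ 4); last by ring.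
rewrite (_ : (x2 - x1) ^+ 2 = (x1 - x2) ^+ 2); last by ring.
rewrite (mulrC p.[x2] p.[x1]) (mulrC p^`().[x2] p^`().[x1]) (addrC (p.[x2] * _)) (addrC (y2 * _)).
by [].
Qed.

Lemma Rcorr_sym (x1 y1 x2 y2 : C) :
  Rcorr n a Th1 Thy c e x1 y1 x2 y2 = Rcorr n a Th1 Thy c e x2 y2 x1 y1.
Proof. rewrite /Rcorr; ring. Qed.

Lemma regular_part_sym P Q : P <> Q -> regular_part P Q = regular_part Q P.
Proof.
move=> PQ; rewrite /regular_part /sing /asym TTc_sym // Rsing_sym Rcorr_sym.
by rewrite (mulrC p.[x Q]).
Qed.

Lemma regular_part_polynomial Q : generic H Q ->
  exists A D : {poly C}, [/\ (size A <= n - 2)%N, (size D <= m - 2)%N &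
    forall P, generic H P -> x P <> x Q -> regular_part P Q = A.[x P] + y P * D.[x P]].
Proof.
move=> gQ.
have [A [D [sA sD h]]] := algebraic_function sp nE hsimple (regular_part_pole_free gQ)
  (regular_part_growth gQ).
exists A, D; split.
- by apply: leq_trans sA _; move: m1; rewrite nE; clear; lia.
(* As n is odd, 2 size D <= n - 4 improves to size D <= m - 2. *)
- case/orP: sD => [|/eqP ->]; last by rewrite size_poly0.
  by move: m1 (size D) => ? s; rewrite nE; clear; lia.
- by move=> P gP PQ; apply: h => //; rewrite inE; exact/eqP.
Qed.

End RegularPart.

(** * Lagrange interpolation *)

Section Interpolation.
Variable K : fieldType.

Lemma lagrange_interpolation (s : seq K) : uniq s -> exists L : K -> {poly K},
  (forall z, (size (L z) <= size s)%N) /\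
  (forall f : {poly K}, (size f <= size s)%N -> f = \sum_(z <- s) f.[z] *: L z).
Proof.
elim: s => [_|z0 s IH /= /andP[z0s us]].
  exists (fun=> 0); split => [z|f]; first by rewrite size_poly0.
  by rewrite leqn0 size_poly_eq0 big_nil => /eqP.
have [L [sL hL]] := IH us.
pose M z := (z - z0)^-1 *: (('X - z0%:P) * L z).
(* The basis has to sum to 1, the case of the constant polynomial 1; this determines the member at
   [z0]. *)
pose M0 := 1 - \sum_(z <- s) M z.
have sM z : (size (M z) <= (size s).+1)%N.
  apply: leq_trans (size_scale_leq _ _) _; apply: leq_trans (size_polyMleq _ _) _.
  by rewrite size_XsubC add2n /= ltnS sL.
have sM0 : (size M0 <= (size s).+1)%N.
  apply: leq_trans (size_polyD _ _) _; rewrite geq_max size_poly1 /= size_polyN.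
  by apply: leq_trans (size_sum _ _ _) _; apply/bigmax_leqP_seq => z _ _; exact: sM.
exists (fun z => if z == z0 then M0 else M z); split => [z|f sf].
  by case: ifP => _; [exact: sM0|exact: sM].
rewrite big_cons eqxx.
have [q fE] : exists q, f = q * ('X - z0%:P) + f.[z0]%:P.
  have /factor_theorem[q hq] : root (f - f.[z0]%:P) z0 by rewrite /root !hornerE subrr.
  by exists q; rewrite -hq subrK.
have sq : (size q <= size s)%N.
  have [->|q0] := eqVneq q 0; first by rewrite size_poly0.
  have : (size (q * ('X - z0%:P))%R <= (size s).+1)%N.
    rewrite (_ : q * _ = f - f.[z0]%:P); last by rewrite {1}fE addrK.
    apply: leq_trans (size_polyD _ _) _; rewrite geq_max sf size_polyN.
    by apply: leq_trans (size_polyC_leq1 _) _.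
  by rewrite size_Mmonic ?monicXsubC // size_XsubC addn2.
have e z : z \in s -> f.[z] *: M z = (q.[z] *: L z) * ('X - z0%:P) + f.[z0] *: M z.
  move=> zs; have zz0 : z - z0 != 0.
    by rewrite subr_eq0; apply: contraNneq z0s => <-.
  rewrite {1}fE !hornerE /= scalerDl; congr (_ + _).
  by rewrite /M scalerA -mulrA mulfV // mulr1 [in RHS]mulrC scalerAr.
rewrite (eq_big_seq (fun z => (q.[z] *: L z) * ('X - z0%:P) + f.[z0] *: M z)); last first.
  move=> z zs; rewrite (_ : (z == z0) = false) ?e //.
  by apply: contraNF z0s => /eqP <-.
rewrite big_split /= -mulr_suml -hL // -scaler_sumr /M0 scalerBr.
rewrite [RHS]addrC -addrA [X in _ + X]addrC subrK {1}fE.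
by congr (_ + _); rewrite alg_polyC.
Qed.

End Interpolation.

(** * Degrees of bivariate polynomials *)

Section BivariateSizes.
Variable K : fieldType.
Implicit Types (u v : {poly {poly K}}) (k l : nat).

(** In [u.[x1, x2]] the outer variable takes the value [x1], so [k] bounds the degree in [x1] and
    [l] the degree in [x2], both shifted by one. *)
Definition bisize (k l : nat) u := (size u <= k)%N /\ (sizeY u <= l)%N.

Lemma sizeY_leq u l : (forall i, (size (nth 0%R u i) <= l)%N) -> (sizeY u <= l)%N.
Proof. by move=> h; apply/bigmax_leqP. Qed.

Lemma bisizeD k l u v : bisize k l u -> bisize k l v -> bisize k l (u + v).
Proof.
move=> [h1 h2] [k1 k2]; split.
  by apply: leq_trans (size_polyD _ _) _; rewrite geq_max h1.
apply: sizeY_leq => i; rewrite coefD; apply: leq_trans (size_polyD _ _) _.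
by rewrite geq_max !(leq_trans (max_size_coefXY _ _)).
Qed.

Lemma bisizeZ k l (a : K) u : bisize k l u -> bisize k l (a%:P *: u).
Proof.
move=> [h1 h2]; split; first exact: leq_trans (size_scale_leq _ _) h1.
apply: sizeY_leq => i; rewrite coefZ mul_polyC.
by apply: leq_trans (size_scale_leq _ _) _; apply: leq_trans (max_size_coefXY _ _) h2.
Qed.

Lemma bisize_swap k l u : bisize k l u -> bisize l k (swapXY u).
Proof. by move=> [h1 h2]; split; rewrite ?sizeYE ?swapXYK // -sizeYE. Qed.

Lemma bisize_sum k l (s : seq K) (u : K -> {poly {poly K}}) :
  (forall z, z \in s -> bisize k l (u z)) -> bisize k l (\sum_(z <- s) u z).
Proof.
move=> h; rewrite big_seq; elim/big_ind: _ => //.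
  by split; rewrite ?sizeYE ?raddf0 size_poly0.
by move=> v w; exact: bisizeD.
Qed.

Lemma bisize_separated k l (q L : {poly K}) : (size L <= k)%N -> (size q <= l)%N ->
  bisize k l (q *: L^:P).
Proof.
move=> h1 h2; split.
  by apply: leq_trans (size_scale_leq _ _) _; rewrite size_map_polyC.
apply: sizeY_leq => i; rewrite coefZ coef_map /= mulrC mul_polyC.
exact: leq_trans (size_scale_leq _ _) h2.
Qed.

Lemma horner2_separated (q L : {poly K}) x1 x2 : (q *: L^:P).[x1, x2] = q.[x2] * L.[x1].
Proof. by rewrite hornerZ horner_map /= !hornerE. Qed.

End BivariateSizes.

Lemma exists_nodes (R : realType) k (S : seq (Cplx R)) :
  exists s, [/\ uniq s, size s = k & forall b, b \in s -> b \notin S].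
Proof.
elim: k S => [|k IH] S; first by exists [::].
have [b bS] := exists_notin S; have [s [us <- hs]] := IH (b :: S).
exists (b :: s); split => //=.
  by rewrite us andbT; apply/negP => /hs; rewrite inE eqxx.
by move=> b'; rewrite inE => /orP[/eqP->//|/hs]; rewrite inE negb_or => /andP[].
Qed.

(** * From polynomials in each point to polynomials in both *)

Section SymmetricFunctions.
Variable R : realType.
Local Notation C := (Cplx R).
Variables (X : riemann_surface R) (p : {poly C}) (H : hyperelliptic X p).
Variables (m n : nat) (sp : size p = n.+1) (nE : n = (2 * m).+1%N).
Hypothesis hsimple : forall b : C, (mup b p <= 1)%N.
Local Notation x := (xcoord H).
Local Notation y := (ycoord H).
Local Notation oo := (infpt H).
Variables (phi : X -> X -> C) (k l : nat).
Hypothesis phi_sym : forall P Q, P <> Q -> phi P Q = phi Q P.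
Hypothesis phi_poly : forall Q, generic H Q -> exists A D : {poly C},
  [/\ (size A <= k)%N, (size D <= l)%N &
      forall P, generic H P -> x P <> x Q -> phi P Q = A.[x P] + y P * D.[x P]].

(* The coefficients of [phi _ Q], evaluated at [b], are half sums and
   differences of the values of [phi Q] at the two points over [b]. *)
Lemma coefficients_at b : p.[b] != 0 -> exists a1 a2 d1 d2 : {poly C},
  [/\ [/\ (size a1 <= k)%N, (size a2 <= l)%N, (size d1 <= k)%N & (size d2 <= l)%N] &
  forall Q (A D : {poly C}), generic H Q -> x Q <> b ->
    (forall P, generic H P -> x P <> x Q -> phi P Q = A.[x P] + y P * D.[x P]) ->
    A.[b] = a1.[x Q] + y Q * a2.[x Q] /\ D.[b] = d1.[x Q] + y Q * d2.[x Q]].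
Proof.
move=> pb; have [P [Pf xP]] := pt_over H b.
have gP : generic H P by split; rewrite ?xP.
have [If xI yI] := involP Pf; have gI := generic_invol gP.
have y0 : y P != 0 by rewrite y_eq0 // xP.
have [A1 [D1 [sA1 sD1 h1]]] := phi_poly gP.
have [A2 [D2 [sA2 sD2 h2]]] := phi_poly gI.
have sz j (u v : {poly C}) (q : C) : (size u <= j)%N -> (size v <= j)%N ->
    (size (q *: (u + v)) <= j)%N.
  move=> su sv; apply: leq_trans (size_scale_leq _ _) _.
  by apply: leq_trans (size_polyD _ _) _; rewrite geq_max su.
exists (2^-1 *: (A1 + A2)), (2^-1 *: (D1 + D2)),
  ((2 * y P)^-1 *: (A1 + - A2)), ((2 * y P)^-1 *: (D1 + - D2)).
split; first by split; apply: sz => //; rewrite size_polyN.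
move=> Q A D gQ xQ hQ.
have PQ : x P <> x Q by rewrite xP => /esym.
have k1 := hQ P gP PQ; have := hQ _ gI; rewrite xI yI => /(_ PQ) k2.
have {}h1 := h1 Q gQ (nesym PQ); have := h2 Q gQ; rewrite xI => /(_ (nesym PQ)) {}h2.
have nPQ : P <> Q by move=> e; rewrite e in PQ.
have nIQ : invol H P <> Q by move=> e; move: PQ; rewrite -xI e.
rewrite (phi_sym nPQ) h1 in k1; rewrite (phi_sym nIQ) h2 in k2; rewrite -xP.
move: k1 k2; rewrite !hornerZ !hornerD !hornerN.
move: A1.[_] A2.[_] D1.[_] D2.[_] A.[_] D.[_] => u1 u2 v1 v2 w1 w2 k1 k2; split.
  have -> : w1 = 2^-1 * (w1 + y P * w2 + (w1 + - y P * w2)) by field.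
  by rewrite -k1 -k2; field.
have -> : w2 = (2 * y P)^-1 * (w1 + y P * w2 - (w1 + - y P * w2)) by field.
by rewrite -k1 -k2; field.
Qed.

(** The coefficient polynomials A and D of [phi _ Q] are interpolated from their values at nodes off
    the roots of p, and these values depend on [Q] as in [coefficients_at]. This covers all [Q] not
    over a node. *)
Lemma bipolynomial : exists P1 Py1 Py2 Py12 : {poly {poly C}},
  [/\ bisize k k P1, bisize l k Py1, bisize k l Py2, bisize l l Py12 &
   forall P Q, generic H P -> generic H Q -> x P <> x Q ->
    phi P Q = P1.[x P, x Q] + y P * Py1.[x P, x Q] + y Q * Py2.[x P, x Q]
     + y P * y Q * Py12.[x P, x Q]].
Proof.
have [rs rsE _] := simple_roots_seq (p_neq0 sp) hsimple.
have [sA [uA szA hA]] := exists_nodes k rs; have [sD [uD szD hD]] := exists_nodes l rs.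
have [LA [sLA LAE]] := lagrange_interpolation uA.
have [LD [sLD LDE]] := lagrange_interpolation uD.
have coefs (b : C) : exists fb : ({poly C} * {poly C}) * ({poly C} * {poly C}), p.[b] != 0 ->
    [/\ (size fb.1.1 <= k)%N, (size fb.1.2 <= l)%N, (size fb.2.1 <= k)%N & (size fb.2.2 <= l)%N] /\
    forall Q (A D : {poly C}), generic H Q -> x Q <> b ->
    (forall P, generic H P -> x P <> x Q -> phi P Q = A.[x P] + y P * D.[x P]) ->
    A.[b] = fb.1.1.[x Q] + y Q * fb.1.2.[x Q] /\ D.[b] = fb.2.1.[x Q] + y Q * fb.2.2.[x Q].
  have [_|pb] := eqVneq p.[b] 0; first by exists ((0, 0), (0, 0)).
  by have [a1 [a2 [d1 [d2 h]]]] := coefficients_at pb; exists ((a1, a2), (d1, d2)).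
have /choice[f hf] := coefs.
have pA b : b \in sA -> p.[b] != 0 by move=> /hA; rewrite rsE.
have pD b : b \in sD -> p.[b] != 0 by move=> /hD; rewrite rsE.
pose P1 := \sum_(b <- sA) (f b).1.1 *: (LA b)^:P.
pose Py2 := \sum_(b <- sA) (f b).1.2 *: (LA b)^:P.
pose Py1 := \sum_(b <- sD) (f b).2.1 *: (LD b)^:P.
pose Py12 := \sum_(b <- sD) (f b).2.2 *: (LD b)^:P.
have horner2_sum (s : seq C) (u : C -> {poly {poly C}}) (t1 t2 : C) :
    (\sum_(b <- s) u b).[t1, t2] = \sum_(b <- s) (u b).[t1, t2].
  by rewrite horner_sum horner_sum.
exists P1, Py1, Py2, Py12; split.
- by apply: bisize_sum => b /pA /hf[[? ? ? ?] _]; apply: bisize_separated; rewrite -?szA ?sLA ?szA.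
- by apply: bisize_sum => b /pD /hf[[? ? ? ?] _]; apply: bisize_separated; rewrite -?szD ?sLD ?szD.
- by apply: bisize_sum => b /pA /hf[[? ? ? ?] _]; apply: bisize_separated; rewrite -?szA ?sLA ?szA.
- by apply: bisize_sum => b /pD /hf[[? ? ? ?] _]; apply: bisize_separated; rewrite -?szD ?sLD ?szD.
have off P Q : generic H P -> generic H Q -> x P <> x Q -> x Q \notin sA ++ sD ->
    phi P Q = P1.[x P, x Q] + y P * Py1.[x P, x Q] + y Q * Py2.[x P, x Q]
     + y P * y Q * Py12.[x P, x Q].
  move=> gP gQ PQ; rewrite mem_cat negb_or => /andP[QA QD].
  have [A [D [sizeA sizeD hAD]]] := phi_poly gQ.
    have eA : A.[x P] = P1.[x P, x Q] + y Q * Py2.[x P, x Q].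
    rewrite [in LHS](LAE A) ?szA // horner_sum !horner2_sum mulr_sumr -big_split /=; apply: eq_big_seq => b bA.
    have [|-> _] := (hf b (pA b bA)).2 Q A D gQ _ hAD; first by move=> e; rewrite e bA in QA.
    by rewrite !horner2_separated hornerZ; ring.
  have eD : D.[x P] = Py1.[x P, x Q] + y Q * Py12.[x P, x Q].
    rewrite [in LHS](LDE D) ?szD // horner_sum !horner2_sum mulr_sumr -big_split /=; apply: eq_big_seq => b bD.
    have [|_ ->] := (hf b (pD b bD)).2 Q A D gQ _ hAD; first by move=> e; rewrite e bD in QD.
    by rewrite !horner2_separated hornerZ; ring.
  by rewrite hAD // eA eD; ring.
(* To admit a [Q] over a node, [P] is fixed instead: [phi _ P] has the form A + y D, and uniqueness
   identifies A and D from the points off the nodes. *)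
move=> P Q gP gQ PQ; have nPQ : P <> Q by move=> e; rewrite e in PQ.
have [A [D [_ _ hAD]]] := phi_poly gP.
have [eA eD] : A = P1.[(x P)%:P] + y P *: Py1.[(x P)%:P] /\
    D = Py2.[(x P)%:P] + y P *: Py12.[(x P)%:P].
  apply: (algebraic_function_unique sp hsimple (S := x P :: sA ++ sD) (H := H)) => Q' gQ'.
  rewrite inE negb_or => /andP[/eqP xQ' Q'n].
  rewrite -hAD // phi_sym; last by move=> e; rewrite e in xQ'.
  rewrite off //; last exact: nesym.
  by rewrite !hornerD !hornerZ; ring.
rewrite phi_sym // hAD //; last exact: nesym.
by rewrite eA eD !hornerD !hornerZ; ring.
Qed.

(** Averaging the representations of [phi P Q] and [phi Q P] makes the coefficients symmetric and
    respects the bounds on the sizes. *)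
Lemma symmetric_bipolynomial : exists P1 Py1 Py2 Py12 : {poly {poly C}},
  [/\ bisize k k P1, bisize l k Py1, Py2 = swapXY Py1, bisize l l Py12 &
   [/\ P1 = swapXY P1, Py12 = swapXY Py12 &
   forall P Q, generic H P -> generic H Q -> x P <> x Q ->
    phi P Q = P1.[x P, x Q] + y P * Py1.[x P, x Q] + y Q * Py2.[x P, x Q]
     + y P * y Q * Py12.[x P, x Q]]].
Proof.
have [P1 [Py1 [Py2 [Py12 [s1 s2 s3 s4 h]]]]] := bipolynomial.
pose sym u v : {poly {poly C}} := (2^-1)%:P *: (u + swapXY v).
have symE u v t1 t2 : (sym u v).[t1, t2] = 2^-1 * (u.[t1, t2] + v.[t2, t1]).
  by rewrite /sym hornerZ hornerM hornerC !hornerD horner2_swapXY.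
have swap_sym u v : swapXY (sym u v) = sym v u.
  rewrite /sym swapXY_is_scalable /= map_polyC /= mul_polyC.
  by rewrite raddfD /= swapXYK addrC.
have bisize_sym i j u v : bisize i j u -> bisize j i v -> bisize i j (sym u v).
  by move=> hu hv; apply: bisizeZ; apply: bisizeD => //; exact: bisize_swap.
exists (sym P1 P1), (sym Py1 Py2), (swapXY (sym Py1 Py2)), (sym Py12 Py12).
split=> //; try exact: bisize_sym; split; rewrite ?swap_sym // => P Q gP gQ PQ.
have -> : phi P Q = 2^-1 * (phi P Q + phi Q P).
  by rewrite (phi_sym (P := Q)); [field|move=> e; rewrite e in PQ].
rewrite !symE h // h //; [by field|exact: nesym].
Qed.

End SymmetricFunctions.

(** * Differentiability in two complex variables *)

Section ProductDifferentiability.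
Variable R : realType.
Local Notation C := (Cplx R).
Implicit Types f g : C * C -> C.

Lemma differentiable_fst (f : C -> C) (t : C * C) : derivable f t.1 1 ->
  differentiable (fun s : C * C => f s.1) t.
Proof.
move=> hf.
have hfst : differentiable (@fst C C) t.
  have lin : linear (@fst C C) by [].
  pose L : {linear (C * C)%type -> C} := HB.pack (@fst C C) (GRing.isLinear.Build _ _ _ _ (@fst C C) lin).
  apply: (@linear_differentiable _ _ _ L) => s; exact: cvg_fst.
exact: differentiable_comp hfst ((derivable1_diffP f t.1).1 hf).
Qed.

Lemma differentiable_snd (f : C -> C) (t : C * C) : derivable f t.2 1 ->
  differentiable (fun s : C * C => f s.2) t.
Proof.
move=> hf.
have hsnd : differentiable (@snd C C) t.
  have lin : linear (@snd C C) by [].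
  pose L : {linear (C * C)%type -> C} := HB.pack (@snd C C) (GRing.isLinear.Build _ _ _ _ (@snd C C) lin).
  apply: (@linear_differentiable _ _ _ L) => s; exact: cvg_snd.
exact: differentiable_comp hsnd ((derivable1_diffP f t.2).1 hf).
Qed.

Lemma differentiable_pow f k t : differentiable f t -> differentiable (fun s => f s ^+ k) t.
Proof.
move=> hf; elim: k => [|k IH]; first exact: differentiable_cst.
rewrite (_ : (fun s => f s ^+ k.+1) = f * (fun s => f s ^+ k)); first exact: differentiableM.
by apply: funext => s; rewrite exprS.
Qed.

Lemma differentiable_horner (A : {poly C}) f t : differentiable f t ->
  differentiable (fun s => A.[f s]) t.
Proof.
move=> hf; elim/poly_ind: A => [|A a IH].
  by under eq_fun do rewrite horner0; exact: differentiable_cst.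
rewrite (_ : (fun s => _) = (fun s => A.[f s]) * f + cst a).
  by apply: differentiableD; [exact: differentiableM|exact: differentiable_cst].
by apply: funext => s; rewrite hornerMXaddC.
Qed.

Lemma differentiable_horner2 (u : {poly {poly C}}) f g t : differentiable f t ->
  differentiable g t -> differentiable (fun s => u.[f s, g s]) t.
Proof.
move=> hf hg; elim/poly_ind: u => [|u a IH].
  by under eq_fun do rewrite !horner0; exact: differentiable_cst.
rewrite (_ : (fun s => _) = (fun s => u.[f s, g s]) * f + (fun s => a.[g s])).
  by apply: differentiableD; [exact: differentiableM|exact: differentiable_horner].
by apply: funext => s; rewrite hornerMXaddC hornerD hornerM hornerC.
Qed.

(* Divide by Q in [A.[f t] - A.[f u] = (f t - f u) * Q.[f t]], where
   [Q.[f u] = A^`().[f u]]. *)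
Lemma implicit_derivable (A : {poly C}) (f g : C -> C) (u : C) :
  {for u, continuous f} -> (\forall t \near u, A.[f t] = g t) -> derivable g u 1 ->
  A^`().[f u] != 0 -> derivable f u 1.
Proof.
move=> cf Afg dg dA.
have [Q AE] : exists Q, A - A.[f u]%:P = Q * ('X - (f u)%:P).
  by apply/factor_theorem; rewrite /root !hornerE subrr.
have QE : Q.[f u] != 0.
  have -> // : Q.[f u] = A^`().[f u].
  rewrite -[in RHS](subrK A.[f u]%:P A) AE derivD derivC addr0 derivM derivXsubC mulr1.
  by rewrite hornerD hornerM hornerXsubC subrr mulr0 add0r.
have Qc : {for u, continuous (fun t => Q.[f t])}.
  apply: continuous_comp cf _.
  exact: has_deriv_continuous (has_deriv_horner Q (has_deriv_id (f u))).
have sh : (fun h : C => h *: 1 + u) @ 0^' --> u.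
  apply/nm_cvgP => d d0; apply/nm_dnbhs; exists d => // h _.
  by rewrite subr0 /= addrK [_ *: _]mulr1.
have shn (P : set C) : (\forall t \near u, P t) -> \forall h \near (0 : C)^', P (h *: 1 + u).
  by move=> hP; exact: sh hP.
have c1 : (fun h : C => Q.[f (h *: 1 + u)]) @ 0^' --> Q.[f u] by exact: cvg_comp sh Qc.
have c2 : (fun h : C => h^-1 *: (g (h *: 1 + u) - g u)) @ 0^' --> 'D_1 g u.
  by have [] := derivableP dg.
apply/cvg_ex; exists ('D_1 g u * Q.[f u]^-1).
apply: (cvg_trans _ (cvgM c2 (cvgV QE c1))); apply: near_eq_cvg.
have n0 : \forall t \near u, Q.[f t] != 0.
  have n1 : 0 < nm Q.[f u] by rewrite nm_gt0.
  have /nm_continuousP /(_ _ n1) := Qc; apply: cnearS => t h; apply/eqP => h0.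
  by move: h; rewrite h0 nmC subr0 ltxx.
apply: filterS2 (shn _ n0) (shn _ Afg) => h q0 eA; rewrite /= -eA.
have gu : g u = A.[f u].
  by have /nm_nbhs[d d0 hd] := Afg; rewrite hd // subrr nm0.
have : (A - A.[f u]%:P).[f (h *: 1 + u)] = (Q * ('X - (f u)%:P)).[f (h *: 1 + u)] by rewrite AE.
rewrite !hornerE /= gu => ->.
by rewrite -scalerAl mulrAC mulfV // mul1r.
Qed.

End ProductDifferentiability.

(** * Regularity on the diagonal *)

Section DiagonalRegularity.
Variable R : realType.
Local Notation C := (Cplx R).
Variables (X : riemann_surface R) (p : {poly C}) (H : hyperelliptic X p).
Hypothesis p0 : p != 0.
Hypothesis hsimple : forall b : C, (mup b p <= 1)%N.
Local Notation x := (xcoord H).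
Local Notation y := (ycoord H).
Local Notation oo := (infpt H).
Implicit Types (P Q : X) (z w : chart R X).

Lemma param_continuous z P (f : X -> C) : dom z P -> {for P, continuous f} ->
  {for coord z P, continuous (f \o param z)}.
Proof.
move=> zP cf; apply: continuous_comp; last by rewrite coordK.
by apply: param_cont; exists P.
Qed.

(** One of x and y is a local coordinate at [P], y at a branch point and x elsewhere, hence
    derivable in any chart. The other one follows from the curve equation by
    [implicit_derivable]. *)
Lemma coordinates_derivable_at z P : atlas z -> dom z P -> P <> oo ->
  derivable (x \o param z) (coord z P) 1 /\ derivable (y \o param z) (coord z P) 1.
Proof.
move=> az zP Pf.
have cx := param_continuous zP (xcoord_cont Pf).
have cy := param_continuous zP (ycoord_cont Pf).
have curve : \forall t \near coord z P, p.[x (param z t)] = y (param z t) ^+ 2.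
  by apply: cnearS (param_near zP (near_neq Pf)) => t [tf _ _]; rewrite curve_eq.
have transfer w (f : X -> C) : atlas w -> dom w P ->
    (forall Q, dom w Q -> Q <> oo /\ coord w Q = f Q) -> derivable (f \o param z) (coord z P) 1.
  move=> aw wP hw; have [/derivable_has_deriv d _] := atlas_compatible az aw zP wP.
  suff /has_deriv_near/(_ d)[] : \forall t \near coord z P, transition z w t = (f \o param z) t by [].
  by apply: cnearS (param_near zP (dom_near wP)) => t [/hw[_ e] _ _]; rewrite /transition /= e.
have [pP|pP] := eqVneq p.[x P] 0.
  have dp : p^`().[x P] != 0 by exact: deriv_root_neq0.
  have [w [aw wP hw]] := ychartP Pf dp.
  have dy := transfer w y aw wP hw; split; last exact: dy.
  have d : derivable (fun t => y (param z t) ^+ 2) (coord z P) 1.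
    have /derivable_has_deriv h := dy.
    by have [d _] := has_derivM h h; exact: d.
  by apply: (implicit_derivable cx curve d); rewrite /= coordK.
have [aw wP hw] := xchartP Pf pP; have dx := transfer _ x aw wP hw; split; first exact: dx.
have d : derivable (fun t => p.[x (param z t)]) (coord z P) 1.
  have /derivable_has_deriv h := dx.
  by have [d _] := has_deriv_horner p h; exact: d.
have sqr : \forall t \near coord z P, ('X^2).[(y \o param z) t] = p.[x (param z t)].
  by apply: cnearS curve => t ->; rewrite hornerXn.
apply: (implicit_derivable cy sqr d).
rewrite derivXn hornerMn hornerXn /= coordK // -mulr_natr mulf_neq0 ?pnatr_eq0 //.
by rewrite expr1 y_eq0.
Qed.

Lemma coordinates_derivable z P0 : atlas z -> dom z P0 -> P0 <> oo ->
  \forall t \near coord z P0, derivable (x \o param z) t 1 /\ derivable (y \o param z) t 1.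
Proof.
move=> az zP Pf; apply: cnearS (param_near zP (near_neq Pf)) => t [tf zt et].
by have := coordinates_derivable_at az zt tf; rewrite et.
Qed.

(** [Phi] is differentiable also where x1 = x2, so its composite with the coordinates in the two
    charts is the extension across the diagonal. *)
Lemma diag_regular_comp (f : X -> X -> C) (Phi : C -> C -> C -> C -> C) :
  (forall (x1 y1 x2 y2 : C * C -> C) t, differentiable x1 t -> differentiable y1 t ->
     differentiable x2 t -> differentiable y2 t ->
     differentiable (fun s => Phi (x1 s) (y1 s) (x2 s) (y2 s)) t) ->
  (forall P Q, generic H P -> generic H Q -> x P <> x Q ->
     f P Q = Phi (x P) (y P) (x Q) (y Q)) ->
  diag_regular H f.
Proof.
move=> dPhi fE P0 Q0 z w Pf Qf _ az aw zP wQ.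
exists (fun t => Phi (x (param z t.1)) (y (param z t.1)) (x (param w t.2)) (y (param w t.2))).
split.
  exists ([set t | derivable (x \o param z) t 1 /\ derivable (y \o param z) t 1],
    [set t | derivable (x \o param w) t 1 /\ derivable (y \o param w) t 1]) => /=.
    by split; exact: coordinates_derivable.
  move=> [t1 t2] /= [[dx1 dy1] [dx2 dy2]]; apply: dPhi.
  - exact (@differentiable_fst _ (x \o param z) (t1, t2) dx1).
  - exact (@differentiable_fst _ (y \o param z) (t1, t2) dy1).
  - exact (@differentiable_snd _ (x \o param w) (t1, t2) dx2).
  - exact (@differentiable_snd _ (y \o param w) (t1, t2) dy2).
exists (dom z, dom w) => /=; first by split; exact: dom_near.
by move=> [P Q] /= [zP' wQ'] gP gQ PQ; rewrite !coordK // fE.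
Qed.

End DiagonalRegularity.

(** * Assembly of the four claims *)

Section GrowthAsO.
Variable R : realType.
Local Notation C := (Cplx R).
Variables (X : riemann_surface R) (p : {poly C}) (H : hyperelliptic X p).

Lemma growth_bigO (phi : X -> C) k : growth H (2 * k%:Z) phi ->
  phi =O_ ((infpt H)^') (fun P => xcoord H P ^+ k).
Proof.
move=> [K [M h]]; apply/eqO_exP; exists (ofR (`|K| + 1)).
  by rewrite -ofR0 ofR_lt; have := normr_ge0 K; lra.
rewrite /dnbhs; apply: filterS (x_large H M) => P hP /eqP Pf.
have := h P Pf (ltW (hP Pf)); rewrite exprz_double => {}h.
rewrite !normE -ofRM ofR_le nmX.
rewrite -(@ler_pXn2r _ 2%N) ?nnegrE ?mulr_ge0 ?addr_ge0 ?exprn_ge0 ?nm_ge0 //.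
apply: le_trans h _; rewrite exprMn ler_wpM2r ?exprn_ge0 ?nm_ge0 //.
by apply: le_trans (ler_norm K) _; have := normr_ge0 K; nra.
Qed.

End GrowthAsO.

Section CurveCoefficients.
Variable K : fieldType.
Variables (n : nat) (a : nat -> K) (p : {poly K}).
Hypothesis pE : p = \sum_(k < n.+1) a k *: 'X^(n - k).

Lemma curve_coef k : (k <= n)%N -> nth 0 p (n - k) = a k.
Proof.
move=> kn; rewrite pE coef_sum (bigD1 (inord k : 'I_n.+1)) //= inordK //.
rewrite coefZ coefXn eqxx mulr1 big1 ?addr0 // => i ik.
rewrite coefZ coefXn (_ : (_ == _) = false) ?mulr0 //.
apply: contraNF ik => /eqP e; apply/eqP/val_inj; rewrite /= inordK //.
by move: e kn (ltn_ord i); clear; lia.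
Qed.

Lemma size_curve : a 0%N != 0 -> size p = n.+1.
Proof.
move=> a0; apply/eqP; rewrite eqn_leq; apply/andP; split.
  rewrite pE; apply: leq_trans (size_sum _ _ _) _; apply/bigmax_leqP => i _.
  by apply: leq_trans (size_scale_leq _ _) _; rewrite size_polyXn ltnS leq_subr.
rewrite ltnNge; apply: contra a0 => /leq_sizeP /(_ n (leqnn n)) h.
by rewrite -(curve_coef (leq0n n)) subn0 h.
Qed.

End CurveCoefficients.

Section RcorrDifferentiable.
Variable R : realType.
Local Notation C := (Cplx R).
Variables (n : nat) (a : nat -> C) (Th1 Thy : {poly C}) (c e : C).

Ltac diff := lazymatch goal with
  | |- differentiable (fun s => @GRing.add _ (@?f s) (@?g s)) _ =>
      apply (@differentiableD _ _ _ f g); diff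
  | |- differentiable (fun s => @GRing.opp _ (@?f s)) _ =>
      apply (@differentiableN _ _ _ f); diff
  | |- differentiable (fun s => @GRing.mul _ (@?f s) (@?g s)) _ =>
      apply (@differentiableM _ _ f g); diff
  | |- differentiable (fun s => @GRing.exp _ (@?f s) ?k) _ =>
      apply (@differentiable_pow _ f k); diff
  | |- differentiable (fun s => horner ?q (@?f s)) _ =>
      apply (@differentiable_horner _ q f); diff
  | |- _ => first [assumption | exact (differentiable_cst _ _)]
  end.

Lemma differentiable_Rcorr (x1 y1 x2 y2 : C * C -> C) t : differentiable x1 t -> differentiable y1 t ->
  differentiable x2 t -> differentiable y2 t ->
  differentiable (fun s => Rcorr n a Th1 Thy c e (x1 s) (y1 s) (x2 s) (y2 s)) t.
Proof. by move=> dx1 dy1 dx2 dy2; rewrite /Rcorr /Theta; diff. Qed.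

Lemma differentiable_bipolynomial (P1 Py1 Py2 Py12 : {poly {poly C}}) (x1 y1 x2 y2 : C * C -> C) t :
  differentiable x1 t -> differentiable y1 t ->
  differentiable x2 t -> differentiable y2 t ->
  differentiable (fun s => P1.[x1 s, x2 s] + y1 s * Py1.[x1 s, x2 s] + y2 s * Py2.[x1 s, x2 s]
    + y1 s * y2 s * Py12.[x1 s, x2 s]) t.
Proof.
move=> dx1 dy1 dx2 dy2; have h u := differentiable_horner2 u dx1 dx2.
have h1 := h P1; have h2 := h Py1; have h3 := h Py2; have h4 := h Py12.
apply: differentiableD; last by apply: differentiableM h4; exact: differentiableM.
by apply: differentiableD (differentiableM dy2 h3); exact: differentiableD h1 (differentiableM dy1 h2).
Qed.

End RcorrDifferentiable.

Theorem theorem2 (R : realType) (g n : nat) (hg : (1 <= g)%N)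
    (hn : n = (2 * g + 1)%N)
    (a : nat -> Cplx R) (ha : a 0%N != 0) (p : {poly Cplx R})
    (hp : p = \sum_(k < n.+1) a k *: 'X^(n - k))
    (hsimple : forall x : Cplx R, (mup x p <= 1)%N)
    (X : riemann_surface R) (H : hyperelliptic X p)
    (F : cft R) (T : F) (c : Cplx R) (hT : is_virasoro T c)
    (B : field_bundle F X) (corr : seq (insertion B) -> Cplx R)
    (hcorr : is_state corr) (hcov : virasoro_covariant T c corr)
    (h1 : corr [::] <> 0)
    (Th1 Thy : {poly Cplx R})
    (hTheta : forall P : X, generic H P ->
       let x := xcoord H P in let y := ycoord H P in
       p.[x] * corr [:: Tx H B T P] =
       c / 32 * (p^`().[x] ^+ 2 / p.[x]) * corr [::]
       + 1 / 4 * Theta Th1 Thy x y)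
    (hThy : (g <= 2)%N -> Thy = 0) :
  let x := xcoord H in let y := ycoord H in
  let e := corr [::] in
  let G := fun P Q => TTc H T corr P Q * (p.[x P] * p.[x Q]) in
  let Rf := fun P Q => Rsing p Th1 Thy c e (x P) (y P) (x Q) (y Q) in
  (forall Q : X, generic H Q ->
     (fun P => G P Q) =O_ ((infpt H)^') (fun P => x P ^+ (n - 3)))
  /\ diag_regular H (fun P Q => G P Q - e^-1 * Rf P Q)
  /\ (exists P1 Py1 Py2 Py12 : {poly {poly Cplx R}},
        [/\ (size P1 <= n - 2)%N, (sizeY P1 <= n - 2)%N,
            (sizeY Py1 <= n - 2)%N & (size Py2 <= n - 2)%N]
        /\ [/\ (size Py1 <= (n - 1)./2 - 2)%N,
               (sizeY Py2 <= (n - 1)./2 - 2)%N,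
               (size Py12 <= (n - 1)./2 - 2)%N &
               (sizeY Py12 <= (n - 1)./2 - 2)%N]
        /\ (forall x1 x2 : Cplx R, P1.[x1, x2] = P1.[x2, x1])
        /\ (forall x1 x2 : Cplx R, Py12.[x1, x2] = Py12.[x2, x1])
        /\ (forall x1 y1 x2 y2 : Cplx R,
              y1 * Py1.[x1, x2] + y2 * Py2.[x1, x2] =
              y2 * Py1.[x2, x1] + y1 * Py2.[x2, x1])
        /\ (forall P Q : X, generic H P -> generic H Q -> x P <> x Q ->
              e * G P Q =
              Rf P Q
              + (P1.[x P, x Q] + y P * Py1.[x P, x Q] + y Q * Py2.[x P, x Q]
                 + y P * y Q * Py12.[x P, x Q])
              + Rcorr n a Th1 Thy c e (x P) (y P) (x Q) (y Q))).
Proof.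
move=> x y e G Rf.
have sp : size p = n.+1 := size_curve hp ha.
have nE : n = (2 * g).+1%N by rewrite hn addn1.
have pa := curve_coef hp.
have m1E : ((n - 1)./2 = g)%N by move: nE; clear; lia.
have tE P : generic H P -> p.[x P] * T1 H T corr P =
    c / 32 * (p^`().[x P] ^+ 2 / p.[x P]) * e + 1 / 4 * Theta Th1 Thy (x P) (y P).
  exact: hTheta.
pose D := regular_part H n T c corr Th1 Thy a.
have Dsym P Q : P <> Q -> D P Q = D Q P by exact: regular_part_sym.
have Dpol Q (gQ : generic H Q) := regular_part_polynomial sp nE hg hsimple hT hcorr hcov h1 tE pa gQ.
have [P1 [Py1 [Py2 [Py12 [s1 s2 s3 s4 [e1 e12 DE]]]]]] := symmetric_bipolynomial sp hsimple Dsym Dpol.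
have e0 : e != 0 by exact/eqP.
have GE P Q : generic H P -> generic H Q -> x P <> x Q -> e * G P Q = Rf P Q
    + (P1.[x P, x Q] + y P * Py1.[x P, x Q] + y Q * Py2.[x P, x Q] + y P * y Q * Py12.[x P, x Q])
    + Rcorr n a Th1 Thy c e (x P) (y P) (x Q) (y Q).
  by move=> gP gQ PQ; rewrite -DE // /D /regular_part /sing /asym -/e -/(Rf P Q) -/(G P Q); ring.
split; [|split].
(* In doubled orders, -6 from the two-point function and 2n from p give 2 (n - 3). *)
- move=> Q gQ; apply: growth_bigO.
  have h3 := growthZ p.[x Q] (growthM (TTc_growth sp nE hcorr hcov h1 gQ) (growth_poly H (eq_leq sp))).
  apply: growthW (growth_eq _ h3) _; first by move=> P _; rewrite /G; ring.
  by move: hg; rewrite nE; clear; lia.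
(* By [GE], subtracting R leaves a polynomial in the four coordinates, namely P and the correction
   terms. *)
- apply: (@diag_regular_comp _ _ _ H (p_neq0 sp) hsimple _ (fun x1 y1 x2 y2 => e^-1 *
    (P1.[x1, x2] + y1 * Py1.[x1, x2] + y2 * Py2.[x1, x2] + y1 * y2 * Py12.[x1, x2]
     + Rcorr n a Th1 Thy c e x1 y1 x2 y2))).
    move=> x1 y1 x2 y2 t d1 d2 d3 d4.
    apply: differentiableM; first exact: differentiable_cst.
    by apply: differentiableD; [exact: differentiable_bipolynomial|exact: differentiable_Rcorr].
  move=> P Q gP gQ PQ; apply: (mulfI e0); rewrite mulrBr GE // !mulVKf //. rewrite -/x -/y; ring.
exists P1, Py1, Py2, Py12; rewrite m1E; move: s1 s2 s4 => [? ?] [? ?] [? ?].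
have [? ?] : bisize (n - 2) (g - 2) Py2 by rewrite s3; exact: bisize_swap.
split; first by split.
split; first by split.
split; first by move=> x1 x2; rewrite {1}e1 horner2_swapXY.
split; first by move=> x1 x2; rewrite {1}e12 horner2_swapXY.
split; last exact: GE.
by move=> x1 y1 x2 y2; rewrite s3 !horner2_swapXY addrC.
Qed.
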